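(* Let $U\ne\{0\}$ and $X$ be complex Hilbert spaces, let $(G,L,K)$ be an impedance passive boundary node on $(U,X,U)$ such that $\mathrm{Ker}(G)\cap\mathrm{Ker}(K)$ is dense in $X$ and such that the operator $L|_{\mathrm{Ker}(G+K)}$ generates a strongly stable semigroup. Assume that $\phi:U\to U$ is a locally Lipschitz continuous monotone function with $\phi(0)=0$ and that there exist $\alpha,\beta,\delta>0$ such that $$\mathrm{Re}\,\langle\phi(u),u\rangle\ge\alpha\|u\|^2\ \text{ when }\|u\|<\delta,\qquad\mathrm{Re}\,\langle\phi(u),u\rangle\ge\beta\ \text{ when }\|u\|\ge\delta.$$ Then the origin is a globally asymptotically stable equilibrium point of $$(\ast)\qquad\dot x(t)=Lx(t),\qquad Gx(t)=\phi(-y(t)),\qquad y(t)=Kx(t),\qquad t\ge0,$$ i.e., the generalised solutions of $(\ast)$ on $[0,\infty)$ corresponding to all initial states $x(0)=x_0\in X$ exist and satisfy $\|x(t)\|\to0$ as $t\to\infty$.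
   Context: $\phi$ is monotone if $\mathrm{Re}\,\langle\phi(u_2)-\phi(u_1),u_2-u_1\rangle\ge0$ for all $u_1,u_2\in U$. A strongly continuous semigroup $\mathbb{T}$ on $X$ is strongly stable if $\mathbb{T}_tx_0\to0$ as $t\to\infty$ for all $x_0\in X$. A triple $(G,L,K)$ is a boundary node on $(U,X,Y)$ if $L:D(L)\subset X\to X$ is linear, $G\in\mathcal{L}(D(L),U)$, $K\in\mathcal{L}(D(L),Y)$ ($D(L)$ with the graph norm), the restriction $A:=L|_{\mathrm{Ker}(G)}$ generates a strongly continuous semigroup on $X$, and $G$ has a bounded right inverse $G^r\in\mathcal{L}(U,D(L))$, $GG^r=I$. It is impedance passive if $Y=U$ and $\mathrm{Re}\,\langle Lx,x\rangle_X\le\mathrm{Re}\,\langle Gx,Kx\rangle_U$ for all $x\in D(L)$. A strong solution of $(\ast)$ is $x\in H^1_{\mathrm{loc}}(0,\infty;X)$ (in $H^1(0,\tau;X)$ for every $\tau>0$) such that $x(t)\in D(L)$ and $Gx(t)=\phi(-Kx(t))$ for all $t\ge0$, and $\dot x(t)=Lx(t)$ for a.e. $t\ge0$. A generalised solution of $(\ast)$ on $[0,\infty)$ is $x\in C([0,\infty);X)$ for which there is a sequence $(x^k)$ of strong solutions with $\sup_{t\in[0,\tau]}\|x^k(t)-x(t)\|\to0$ as $k\to\infty$ for all $\tau>0$. *)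

(* Defs.v *)
From HB Require Import structures.
From mathcomp Require Import all_boot all_order all_algebra.
From mathcomp Require Export complex.
From mathcomp Require Export all_classical all_reals all_analysis.

Set Implicit Arguments.
Unset Strict Implicit.
Unset Printing Implicit Defensive.

Import Order.TTheory GRing.Theory Num.Theory.
Import numFieldNormedType.Exports.

Local Open Scope classical_set_scope.
Local Open Scope ring_scope.
Local Open Scope complex_scope.

(* The inner product is linear in its first argument and conjugate-linear in
   its second one, as in the forms of sesquilinear.v. *)
HB.mixin Record isHilbert (R : realType) (X : Type)
    of CompleteNormedModule R[i] X := {
  dotp : {dot X for (@Num.conj R[i])} ;
  dotp_norm : forall x : X, dotp x x = `|x| ^+ 2 }.

#[short(type="hilbertType")]
HB.structure Definition Hilbert (R : realType) :=
  {X of isHilbert R X & CompleteNormedModule R[i] X}.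

(* The norm of a normedModType over R[i] takes its values in R[i]; [hnorm] is
   the same number as an element of R. *)
Definition hnorm (R : realType) (X : hilbertType R) (x : X) : R :=
  complex.Re `|x|.

Definition Re_dotp (R : realType) (X : hilbertType R) (x y : X) : R :=
  complex.Re (dotp x y).

Section UnboundedOperators.
Context {R : realType}.

(* An unbounded operator is a total function considered only on its domain. *)

Definition subspace (X : hilbertType R) (D : set X) : Prop :=
  D 0 /\ forall (a : R[i]) (x y : X), D x -> D y -> D (a *: x + y).

Definition linear_on (X W : hilbertType R) (D : set X) (F : X -> W) : Prop :=
  forall (a : R[i]) (x y : X), D x -> D y -> F (a *: x + y) = a *: F x + F y.

Definition graph_norm (X : hilbertType R) (L : X -> X) (x : X) : R :=
  hnorm x + hnorm (L x).

Definition ker_on (X W : hilbertType R) (D : set X) (F : X -> W) : set X :=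
  [set x | D x /\ F x = 0].

Record C0_semigroup (X : hilbertType R) (T : R -> {linear X -> X}) : Prop := {
  C0_bounded : forall t : R, 0 <= t -> continuous (T t) ;
  C0_id : forall x, T 0 x = x ;
  C0_add : forall s t : R, 0 <= s -> 0 <= t -> forall x, T (s + t) x = T s (T t x) ;
  C0_cont : forall x, T t x @[t --> 0^'+] --> x }.

(* [A] with domain [D] is exactly the infinitesimal generator of [T], so [D]
   consists of all the points at which the difference quotient converges. *)
Definition is_generator (X : hilbertType R) (T : R -> {linear X -> X})
    (D : set X) (A : X -> X) : Prop :=
  forall x y : X,
    (h^-1)%:C *: (T h x - x) @[h --> 0^'+] --> y <-> D x /\ A x = y.

Definition generates_C0_semigroup (X : hilbertType R)
    (D : set X) (A : X -> X) : Prop :=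
  exists T : R -> {linear X -> X}, C0_semigroup T /\ is_generator T D A.

Definition strongly_stable (X : hilbertType R)
    (T : R -> {linear X -> X}) : Prop :=
  forall x : X, T t x @[t --> +oo] --> (0 : X).

Definition generates_strongly_stable_semigroup (X : hilbertType R)
    (D : set X) (A : X -> X) : Prop :=
  exists T : R -> {linear X -> X},
    [/\ C0_semigroup T, is_generator T D A & strongly_stable T].

Record boundary_node (U X Y : hilbertType R) (D : set X)
    (G : X -> U) (L : X -> X) (K : X -> Y) : Prop := {
  bn_dom : subspace D ;
  bn_L : linear_on D L ;
  bn_G : linear_on D G /\
    exists M : R, forall x, D x -> hnorm (G x) <= M * graph_norm L x ;
  bn_K : linear_on D K /\
    exists M : R, forall x, D x -> hnorm (K x) <= M * graph_norm L x ;
  bn_gen : generates_C0_semigroup (ker_on D G) L ;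
  bn_right_inv : exists (Gr : {linear U -> X}) (M : R), forall u,
    [/\ D (Gr u), G (Gr u) = u & graph_norm L (Gr u) <= M * hnorm u] }.

Definition impedance_passive (U X : hilbertType R) (D : set X)
    (G : X -> U) (L : X -> X) (K : X -> U) : Prop :=
  forall x, D x -> Re_dotp (L x) x <= Re_dotp (G x) (K x).

Definition monotone_map (U : hilbertType R) (phi : U -> U) : Prop :=
  forall u1 u2 : U, 0 <= Re_dotp (phi u2 - phi u1) (u2 - u1).

Definition locally_lipschitz (U : hilbertType R) (phi : U -> U) : Prop :=
  forall u0 : U, exists2 V : set U, nbhs u0 V & [lipschitz phi u | u in V].

End UnboundedOperators.

Section BochnerSobolev.
Context {R : realType} {X : hilbertType R}.
Implicit Types (A : set R) (s f x dx : R -> X).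

Local Notation mu := (@lebesgue_measure R).

Definition simple_function s : Prop :=
  finite_set (range s) /\ forall v : X, measurable (s @^-1` [set v]).

(* Used only for sets [A] of finite measure. *)
Definition simple_integral A s : X :=
  \sum_(v \in range s) (fine (mu (A `&` s @^-1` [set v])))%:C *: v.

Definition strongly_measurable A f : Prop :=
  exists s : nat -> R -> X, (forall n, simple_function (s n)) /\
    forall t, A t -> s n t @[n --> \oo] --> f t.

Definition is_bochner_integral A f (v : X) : Prop :=
  exists s : nat -> R -> X,
    [/\ forall n, simple_function (s n),
        forall t, A t -> s n t @[n --> \oo] --> f t,
        (\int[mu]_(t in A) (hnorm (s n t - f t))%:E)%E @[n --> \oo] --> 0%E &
        simple_integral A (s n) @[n --> \oo] --> v].

Definition in_L2 A f : Prop :=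
  strongly_measurable A f /\
  (\int[mu]_(t in A) ((hnorm (f t)) ^+ 2)%:E < +oo)%E.

(* [x], as a function on [0, tau], is the continuous representative of an
   element of H^1(0, tau; X) whose weak derivative is represented by [dx]:
   x(t) - x(0) is the Bochner integral of [dx] over [0, t], with [dx] in L^2.
   Membership of [x] itself in L^2(0, tau; X) follows from its continuity. *)
Definition H1_derivative (tau : R) x dx : Prop :=
  in_L2 `[0, tau] dx /\
  forall t, 0 <= t <= tau -> is_bochner_integral `[0, t] dx (x t - x 0).

Definition H1loc_derivative x dx : Prop :=
  forall tau : R, 0 < tau -> H1_derivative tau x dx.

End BochnerSobolev.

Section Solutions.
Context {R : realType} {U X : hilbertType R}.
Variables (D : set X) (G : X -> U) (L : X -> X) (K : X -> U) (phi : U -> U).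

Definition strong_solution (x : R -> X) : Prop :=
  exists dx : R -> X,
    [/\ H1loc_derivative x dx,
        forall t : R, 0 <= t -> D (x t) /\ G (x t) = phi (- K (x t)) &
        {ae @lebesgue_measure R, forall t : R, 0 <= t -> dx t = L (x t)}].

Definition generalised_solution (x : R -> X) : Prop :=
  {within `[0, +oo[, continuous x} /\
  exists xk : nat -> R -> X, (forall k, strong_solution (xk k)) /\
    forall tau : R, 0 < tau ->
      ereal_sup [set (hnorm (xk k t - x t))%:E | t in `[0, tau]]
        @[k --> \oo] --> 0%E.

Definition origin_globally_asymptotically_stable : Prop :=
  forall x0 : X,
    (exists x : R -> X, generalised_solution x /\ x 0 = x0) /\
    (forall x : R -> X, generalised_solution x -> x 0 = x0 ->
       x t @[t --> +oo] --> (0 : X)).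

End Solutions.

(* Main.v *)
Require Import Defs.
From mathcomp Require Import all_boot all_order all_algebra.
From mathcomp Require Import finmap measurable_realfun classical_sets ring lra.
Import Order.TTheory GRing.Theory Num.Theory.
Import numFieldNormedType.Exports.
Local Open Scope classical_set_scope.
Local Open Scope ring_scope.

(** Let [B] be the operator [x |-> L x] restricted to the states that satisfy
the feedback law [G x = phi (- K x)]. Passivity of the node and monotonicity of
[phi] make [B] dissipative, so the theorem is about a nonlinear contraction
semigroup on a Hilbert space, and only real parts of inner products matter.

Solutions. The resolvent equation [x - m L x = f] with feedback is solvable:
two solutions of [x - m L x = f] differ by some [e] with [e = m L e], and on such
[e] the values [G e] and [K e] determine each other with comparable norms and a
coercive pairing ([node_eigen_bounds]). Prescribing [K x = - w] leaves an
equation for [w] in [U] whose left-hand side is strongly monotone and locally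
Lipschitz, hence onto ([strongly_monotone_surj], [feedback_range]). A
dissipative operator with this property has strong evolutions from every point
of its domain: implicit Euler approximations converge, [B x] stays bounded by
its initial norm and is weakly continuous in time ([dissipative_evolution]), and
it is a pointwise limit of continuous Yosida approximations, so that [x] is a
Bochner primitive of [B x] ([dissipative_strong_evolution]). Two strong
solutions never move apart ([strong_solution_contraction]); since every point of
the dense set where [G] and [K] both vanish is an admissible initial state,
uniform limits of strong solutions reach every initial state
([generalised_solution_exists]).

Stability. Along a strong solution the graph norm is bounded, so the sector
condition gives [|phi v - v|^2 <= C Re <phi v, v>] with [v = - K x]
([sector_bound]). Here [phi v - v = (G + K) x] is the amount by which the
solution fails to satisfy the boundary condition of the stable semigroup, while
[Re <phi v, v>] bounds the decay of the energy [|x|^2] from below. For an orbit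
[y] of the stable semigroup, [|x - y|^2 + C/4 |x|^2] is therefore nonincreasing
([lyapunov_comparison]). The energy [|x|^2] has a limit, so from some time on
the distance to [y] can hardly grow, and [x] tends to [0] together with [y]
([strong_solution_cvg0]). The contraction property carries this over to
generalised solutions. *)

Set Implicit Arguments.
Unset Strict Implicit.
Unset Printing Implicit Defensive.

Local Notation ip := Re_dotp.
Local Notation "r *! x" := ((r%:C)%C *: x) (at level 40, left associativity).

(** * The real inner product *)
Section HilbertBasics.
Context {R : realType} {X : hilbertType R}.
Implicit Types (x y z w : X) (r : R).

Lemma normE x : `|x| = ((hnorm x)%:C)%C.
Proof. by rewrite RRe_real// ger0_real. Qed.

Lemma hnorm_ge0 x : 0 <= hnorm x.
Proof. by rewrite -ler0c -normE. Qed.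

Lemma hnorm0 : hnorm (0 : X) = 0.
Proof. by rewrite /hnorm normr0. Qed.

Lemma hnorm_eq0 x : hnorm x = 0 -> x = 0.
Proof. by move=> h; apply/normr0_eq0; rewrite normE h. Qed.

Lemma hnorm_addr x y : hnorm (x + y) <= hnorm x + hnorm y.
Proof. by rewrite -lecR rmorphD /= -!normE ler_normD. Qed.

Lemma hnorm_oppr x : hnorm (- x) = hnorm x.
Proof. by rewrite /hnorm normrN. Qed.

Lemma hnormBC x y : hnorm (x - y) = hnorm (y - x).
Proof. by rewrite -hnorm_oppr opprB. Qed.

Lemma hnorm_subr x y : hnorm (x - y) <= hnorm x + hnorm y.
Proof. by rewrite -[hnorm y]hnorm_oppr; exact: hnorm_addr. Qed.

Lemma hnorm_triangle z x y : hnorm (x - y) <= hnorm (x - z) + hnorm (z - y).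
Proof. by rewrite -[X in hnorm X](_ : (x - z) + (z - y) = x - y) ?hnorm_addr// addrA subrK. Qed.

Lemma hnormZ r x : hnorm (r *! x) = `|r| * hnorm x.
Proof.
apply: complexI; rewrite -normE normrZ normE [in RHS]rmorphM /=; congr (_ * _).
by rewrite normc_def /= expr0n /= addr0 sqrtr_sqr.
Qed.

Lemma ipDl x y z : ip (x + y) z = ip x z + ip y z.
Proof. by rewrite /ip linearDl /= raddfD. Qed.

Lemma ipC x y : ip x y = ip y x.
Proof.
rewrite /ip (hermC dotp) expr0 mul1r; apply: complexI.
rewrite !complexRe !ReE conjCK addrC //.
Qed.

Lemma ipDr x y z : ip x (y + z) = ip x y + ip x z.
Proof. by rewrite ipC ipDl ![ip _ x]ipC. Qed.

Lemma ipNl x y : ip (- x) y = - ip x y.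
Proof. by rewrite /ip linearNl raddfN. Qed.

Lemma ipNr x y : ip x (- y) = - ip x y.
Proof. by rewrite ipC ipNl ipC. Qed.

Lemma ipZl r x y : ip (r *! x) y = r * ip x y.
Proof.
by rewrite /ip linearZl_LR /=; case: (dotp x y) => a b /=; rewrite mul0r subr0.
Qed.

Lemma ipZr r x y : ip x (r *! y) = r * ip x y.
Proof. by rewrite ipC ipZl ipC. Qed.

Lemma ip0l x : ip 0 x = 0.
Proof. by rewrite -[0](subrr x) ipDl ipNl subrr. Qed.

Lemma ip0r x : ip x 0 = 0.
Proof. by rewrite ipC ip0l. Qed.

Lemma ipxx x : ip x x = hnorm x ^+ 2.
Proof. by rewrite /ip dotp_norm normE -rmorphXn. Qed.

Definition ipE := (ipDl, ipDr, ipNl, ipNr, ipZl, ipZr, ip0l, ip0r).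

(** Separation by the real inner product. Since that form is real bilinear, it
turns identities between real combinations of vectors into scalar ones. *)
Lemma ip_ext x y : (forall w, ip x w = ip y w) -> x = y.
Proof.
move=> h; apply/subr0_eq/hnorm_eq0/eqP; rewrite -sqrf_eq0 -ipxx.
by rewrite ipDl ipNl h subrr.
Qed.

Lemma hnormD_sq x y : hnorm (x + y) ^+ 2 = hnorm x ^+ 2 + 2 * ip x y + hnorm y ^+ 2.
Proof. by rewrite -!ipxx !ipE (ipC y x); ring. Qed.

Lemma hnormB_sq x y : hnorm (x - y) ^+ 2 = hnorm x ^+ 2 - 2 * ip x y + hnorm y ^+ 2.
Proof. by rewrite -!ipxx !ipE (ipC y x); ring. Qed.

Lemma ip_le x y : ip x y <= hnorm x * hnorm y.
Proof.
have [->|y0] := eqVneq y 0; first by rewrite ip0r hnorm0 mulr0.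
have ny : 0 < hnorm y.
  by rewrite lt_def hnorm_ge0 andbT; apply: contra_neq y0; exact: hnorm_eq0.
have [x0|nx] := eqVneq (hnorm x) 0.
  by rewrite (hnorm_eq0 x0) ip0l hnorm0 mul0r.
have {}nx : 0 < hnorm x by rewrite lt_def nx hnorm_ge0.
have : 0 <= hnorm (hnorm y *! x - hnorm x *! y) ^+ 2 by rewrite sqr_ge0.
rewrite -ipxx !ipE !ipxx (ipC y x) => h.
have : 0 <= (2 * (hnorm x * hnorm y)) * (hnorm x * hnorm y - ip x y).
  by move: h; congr (0 <= _); ring.
by rewrite pmulr_rge0 ?subr_ge0// mulr_gt0// mulr_gt0.
Qed.

Lemma ip_abs x y : `|ip x y| <= hnorm x * hnorm y.
Proof.
by rewrite ler_norml ip_le andbT lerNl -ipNl -[hnorm x]hnorm_oppr ip_le.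
Qed.

Lemma ip_ge x y : - (hnorm x * hnorm y) <= ip x y.
Proof. by have := ip_abs x y; rewrite ler_norml => /andP[]. Qed.

Lemma hnorm_le_ip x (c : R) : 0 <= c -> (forall w, ip x w <= c * hnorm w) -> hnorm x <= c.
Proof.
move=> c0 /(_ x); rewrite ipxx expr2; have [->|nx] := eqVneq (hnorm x) 0; first by [].
by rewrite ler_pM2r// lt_def nx hnorm_ge0.
Qed.

(** The norm that defines the topology takes complex values; this and
[nbhs_hnormP] allow estimates with real tolerances only. *)
Lemma hnorm_cvgP {T : Type} (F : set_system T) {FF : Filter F} (f : T -> X) (l : X) :
  f t @[t --> F] --> l <->
  forall e : R, 0 < e -> \forall t \near F, hnorm (f t - l) < e.
Proof.
rewrite cvgrPdist_lt; split=> h e e0.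
  have /h : 0 < (e%:C)%C by rewrite ltcR.
  by apply: filterS => t; rewrite normE ltcR hnormBC.
have eE : (complex.Re e)%:C%C = e by rewrite RRe_real// gtr0_real.
have /h : 0 < complex.Re e by rewrite -ltcR eE.
by apply: filterS => t; rewrite normE -eE ltcR hnormBC.
Qed.

Lemma hnorm_cvg0P {T : Type} (F : set_system T) {FF : Filter F} (f : T -> X) (l : X) :
  f t @[t --> F] --> l <-> hnorm (f t - l) @[t --> F] --> (0 : R).
Proof.
rewrite hnorm_cvgP cvgrPdist_lt; split=> h e e0.
all: by apply: filterS (h _ e0) => t; rewrite sub0r normrN ger0_norm// hnorm_ge0.
Qed.

Lemma nbhs_hnormP (x : X) (P : set X) :
  nbhs x P <-> exists2 e : R, 0 < e & forall y, hnorm (y - x) < e -> P y.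
Proof.
split.
  move=> /nbhs_normP[e /= e0 he].
  have eE : (complex.Re e)%:C%C = e by rewrite RRe_real// gtr0_real.
  exists (complex.Re e); first by rewrite -ltcR eE.
  by move=> y hy; apply: he => /=; rewrite normE -eE ltcR hnormBC.
move=> [e e0 he]; apply/nbhs_normP; exists (e%:C)%C => /=; first by rewrite ltcR.
by move=> y /=; rewrite normE ltcR hnormBC; exact: he.
Qed.

Lemma hilbert_complete (u : nat -> X) :
  (forall e : R, 0 < e -> exists N, forall n m, (N <= n)%N -> (N <= m)%N ->
     hnorm (u n - u m) < e) ->
  exists l : X, u n @[n --> \oo] --> l.
Proof.
move=> h; suff /cauchy_cvg/cvg_ex[l hl] : cauchy (u @ \oo) by exists l.
apply/cauchyP => e e0.
have eE : (complex.Re e)%:C%C = e by rewrite RRe_real// gtr0_real.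
have /h[N hN] : 0 < complex.Re e by rewrite -ltcR eE.
exists (u N); exists N => // n /= Nn.
by rewrite -ball_normE /ball_ /= normE -eE ltcR; exact: hN.
Qed.

End HilbertBasics.

(** Identities between real combinations of vectors. *)
Ltac vec := apply: ip_ext => ?; rewrite !ipE; try ring; try field;
  repeat (rewrite gt_eqF ?addr_gt0 //).

(** * Limits and fixed points *)
Section LimitsAndFixedPoints.
Context {R : realType}.

Lemma at_right0P (P : R -> Prop) :
  (\forall h \near 0^'+, P h) <-> exists2 d : R, 0 < d & forall h, 0 < h < d -> P h.
Proof.
split.
  move=> /nbhs_ballP[d /= d0 hd]; exists d => // h /andP[h0 hd'].
  by apply: hd => //=; rewrite /ball /= sub0r normrN gtr0_norm.
move=> [d d0 hd]; apply/nbhs_ballP; exists d => //= h.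
by rewrite /ball /= sub0r normrN => + h0; rewrite gtr0_norm// => hd'; apply: hd; rewrite h0.
Qed.

Lemma inv_succ_small (e : R) : 0 < e ->
  exists N, forall n, (N <= n)%N -> n.+1%:R^-1 < e.
Proof.
move=> e0; exists (Num.truncn e^-1) => n hn.
rewrite -[e]invrK ltf_pV2 ?posrE ?invr_gt0//.
by apply: lt_le_trans (truncnS_gt _) _; rewrite ler_nat ltnS.
Qed.

Lemma archi_lt (e : R) (c : R) : 0 < e -> 0 <= c -> exists N : nat, c / N.+1%:R < e.
Proof.
move=> e0 c0; have e1 : 0 < e / (c + 1) by rewrite divr_gt0// ltr_wpDl.
have [N /(_ N (leqnn _)) h] := inv_succ_small e1; exists N.
have c1 : 0 < c + 1 by rewrite ltr_wpDl.
apply: (@le_lt_trans _ _ ((c + 1) / N.+1%:R)); first by rewrite ler_wpM2r ?invr_ge0// lerDl.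
by rewrite mulrC -ltr_pdivlMr.
Qed.

Lemma exp_small (q e : R) : 0 <= q < 1 -> 0 < e ->
  exists N, forall n, (N <= n)%N -> q ^+ n < e.
Proof.
move=> /andP[q0 q1] e0.
have : (fun n => q ^+ n) @ \oo --> (0 : R) by apply: cvg_expr; rewrite ger0_norm.
move=> /cvgrPdist_lt/(_ e e0)[N _ hN]; exists N => n hn.
by have := hN n hn; rewrite sub0r normrN ger0_norm// exprn_ge0.
Qed.

Lemma le_of_eps (a b c : R) : 0 <= c ->
  (forall e, 0 < e -> e <= 1 -> a <= b + e * c) -> a <= b.
Proof.
move=> c0 h; rewrite leNgt; apply/negP => ab.
pose e := Num.min 1 ((a - b) / (c + 1) / 2).
have c1 : 0 < c + 1 by rewrite ltr_wpDl.
have e0 : 0 < e by rewrite lt_min ltr01 /= !divr_gt0// subr_gt0.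
have /h : e <= 1 by rewrite ge_min lexx.
move=> /(_ e0); have : e * c <= (a - b) / (c + 1) / 2 * (c + 1).
  by apply: ler_pM; rewrite ?(ltW e0)// ?ge_min ?lexx ?orbT// lerDl.
have -> : (a - b) / (c + 1) / 2 * (c + 1) = (a - b) / 2 by field; rewrite gt_eqF.
by lra.
Qed.

Context {X : hilbertType R}.

Lemma lin_sub (f : {linear X -> X}) x y : f (x - y) = f x - f y.
Proof. exact: linearB. Qed.

Lemma lin_scale (f : {linear X -> X}) (r : R) x : f (r *! x) = r *! f x.
Proof. exact: linearZ. Qed.

Definition linE f := (lin_sub f, lin_scale f).

Lemma dense_hnorm (S : set X) : dense S ->
  forall x (e : R), 0 < e -> exists2 y, S y & hnorm (y - x) < e.
Proof.
move=> hS x e e0.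
pose O : set X := [set y | hnorm (y - x) < e].
have [|y [/interior_subset Oy Sy]] := hS O^° _ (@open_interior _ O).
  by exists x; apply/nbhs_hnormP; exists e.
by exists y.
Qed.

(** Picard iteration; the hypothesis on [f c] makes the closed ball invariant. *)
Lemma ball_fixed_point (f : X -> X) (c : X) (r q : R) :
  0 <= q < 1 -> 0 <= r -> hnorm (f c - c) <= (1 - q) * r ->
  (forall x y, hnorm (x - c) <= r -> hnorm (y - c) <= r ->
     hnorm (f x - f y) <= q * hnorm (x - y)) ->
  exists2 x, hnorm (x - c) <= r & f x = x.
Proof.
move=> /andP[q0 q1] r0 fc fq.
pose u n := iter n f c.
have cB : hnorm (c - c) <= r by rewrite subrr hnorm0.
have fB x : hnorm (x - c) <= r -> hnorm (f x - c) <= r.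
  move=> xr; apply: le_trans (hnorm_triangle (f c) _ _) _.
  have := fq _ _ xr cB; have : q * hnorm (x - c) <= q * r by rewrite ler_wpM2l.
  lra.
have uB n : hnorm (u n - c) <= r by elim: n => [|n] //=; exact: fB.
have uq n m : hnorm (u (n + m)%N - u n) <= q ^+ n * r.
  elim: n => [|n ih]; first by rewrite expr0 mul1r add0n.
  rewrite exprS -mulrA; apply: le_trans (fq _ _ (uB _) (uB _)) _.
  by rewrite ler_wpM2l.
have [l hl] : exists l : X, u n @[n --> \oo] --> l.
  apply: hilbert_complete => e e0.
  have e0' : 0 < e / (r + 1) / 2 by rewrite !divr_gt0// ltr_wpDl.
  have [N hN] := exp_small (introT andP (conj q0 q1)) e0'.
  exists N => n m hn hm.
  apply: le_lt_trans (hnorm_triangle (u N) _ _) _.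
  rewrite -(subnKC hn) -(subnKC hm) (hnormBC (u N)).
  have := uq N (n - N)%N; have := uq N (m - N)%N; have := hN N (leqnn _).
  move=> h; have : q ^+ N * r <= e / (r + 1) / 2 * r by rewrite ler_wpM2r// ltW.
  have : e / (r + 1) / 2 * r < e / 2.
    rewrite -subr_gt0 (_ : _ - _ = e / (r + 1) / 2); last by field; rewrite gt_eqF// ltr_wpDl.
    by [].
  lra.
move/hnorm_cvgP : hl => hl.
have lB : hnorm (l - c) <= r.
  apply/ler_addgt0Pr => e e0; have [N _ hN] := hl e e0.
  apply: le_trans (hnorm_triangle (u N) _ _) _; rewrite hnormBC.
  by have := hN N (leqnn _); have := uB N; rewrite /=; lra.
exists l => //; apply/subr0_eq/hnorm_eq0/le_anti; rewrite hnorm_ge0 andbT.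
apply/ler_addgt0Pr => e e0; rewrite add0r.
have e2 : 0 < e / 2 by lra.
have [N _ hN] := hl _ e2.
apply: le_trans (hnorm_triangle (u N.+1) _ _) _.
have := hN N.+1 (leqnSn _); have := hN N (leqnn _) => /=.
have := fq _ _ lB (uB N); rewrite (hnormBC l) /= => h1 h2 h3.
have : q * hnorm (u N - l) <= 1 * hnorm (u N - l).
  by rewrite ler_wpM2r ?hnorm_ge0// ltW.
move: h1 h2 h3; rewrite mul1r; lra.
Qed.

End LimitsAndFixedPoints.

(** * Semigroups with dissipative generators *)
Section Semigroups.
Context {R : realType} {X : hilbertType R}.
Variables (T : R -> {linear X -> X}) (D : set X) (A : X -> X).
Hypothesis hT : C0_semigroup T.
Hypothesis hA : is_generator T D A.

Lemma semigroup_eps (t : R) x : 0 <= t -> forall e : R, 0 < e ->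
  exists2 d : R, 0 < d & forall y, hnorm (y - x) < d -> hnorm (T t y - T t x) < e.
Proof.
move=> t0 e e0; have /hnorm_cvgP := @C0_bounded _ _ _ hT t t0 x => /(_ _ e0) /nbhs_hnormP[d d0 hd].
by exists d => // y /hd.
Qed.

Lemma semigroup_near0 x (e : R) : 0 < e ->
  exists2 d : R, 0 < d & forall s : R, 0 <= s -> s < d -> hnorm (T s x - x) < e.
Proof.
move=> e0; have /hnorm_cvgP/(_ e e0)/at_right0P[d d0 hd] := @C0_cont _ _ _ hT x.
exists d => // s; rewrite le_eqVlt => /predU1P[<- _|s0 sd].
  by rewrite (C0_id hT) subrr hnorm0.
by apply: hd; rewrite s0.
Qed.

(** Uniform boundedness near time [0]. If no ball and no time interval had a
common bound, nested closed balls would shrink to a point [l] with [T s l]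
unbounded along times [s] tending to [0], against strong continuity at [l]. *)
Lemma semigroup_locally_bounded :
  exists2 d : R, 0 < d & exists2 M : R, 0 < M &
    forall (s : R) x, 0 <= s -> s < d -> hnorm (T s x) <= M * hnorm x.
Proof.
have [[c [r [n [r0 H]]]]|H] := pselect (exists (c : X) (r : R) (n : nat), 0 < r /\
    forall (s : R) x, 0 <= s -> s < n.+1%:R^-1 -> hnorm (x - c) < r -> hnorm (T s x) <= n%:R).
  exists n.+1%:R^-1; first by rewrite invr_gt0.
  exists (4 * n%:R / r + 1); first by rewrite ltr_wpDl// divr_ge0// ltW.
  move=> s x s0 sd; have [->|x0] := eqVneq x 0; first by rewrite linear0 hnorm0 mulr0.
  have nx : 0 < hnorm x.
    by rewrite lt_def hnorm_ge0 andbT; apply: contra_neq x0; exact: hnorm_eq0.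
  pose a := r / 2 / hnorm x.
  have a0 : 0 < a by rewrite !divr_gt0.
  have h1 : hnorm (T s (c + a *! x)) <= n%:R.
    apply: H => //; rewrite addrC addKr hnormZ gtr0_norm// /a divfK ?gt_eqF//; lra.
  have h2 : hnorm (T s c) <= n%:R by apply: H => //; rewrite subrr hnorm0.
  have : a * hnorm (T s x) <= 2 * n%:R.
    have E : a *! T s x = T s (c + a *! x) - T s c.
      by rewrite -linearB (addrC c) addrK linearZ.
    have := hnormZ a (T s x); rewrite gtr0_norm// => <-; rewrite E.
    by have := hnorm_subr (T s (c + a *! x)) (T s c); lra.
  rewrite mulrC -ler_pdivlMr// => /le_trans; apply.
  have -> : 2 * n%:R / a = 4 * n%:R / r * hnorm x.
    by rewrite /a; field; rewrite !gt_eqF.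
  by rewrite ler_wpM2r ?lerDl ?hnorm_ge0.
exfalso.
have step (z : nat * (X * R)) : exists v : R * (X * R), 0 < z.2.2 ->
   [/\ 0 <= v.1, v.1 < z.1.+1%:R^-1, 0 < v.2.2 & v.2.2 <= z.1.+1%:R^-1 /\
     forall y, hnorm (y - v.2.1) <= v.2.2 ->
       hnorm (y - z.2.1) <= z.2.2 /\ z.1%:R < hnorm (T v.1 y)].
  case: z => k [c r] /=.
  have [r0|/negP rn] := boolP (0 < r); last by exists (0, (c, 0)).
  have : ~ (forall (s : R) x, 0 <= s -> s < k.+1%:R^-1 -> hnorm (x - c) < r -> hnorm (T s x) <= k%:R).
    by move=> h; apply: H; exists c, r, k.
  move=> /existsNP[s /existsNP[x /not_implyP[s0 /not_implyP[sn /not_implyP[xr /negP]]]]].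
  rewrite -ltNge => Tx.
  have e0 : 0 < hnorm (T s x) - k%:R by rewrite subr_gt0.
  have [d d0 hd] := semigroup_eps x s0 e0.
  pose q := Num.min (d / 2) (Num.min k.+1%:R^-1 (r - hnorm (x - c))).
  have q0 : 0 < q by rewrite !lt_min divr_gt0//= invr_gt0 ltr0n /= subr_gt0.
  exists (s, (x, q)) => _ /=; split => //.
  split; first by rewrite /q !ge_min lexx orbT.
  move=> y yq; split.
    apply: le_trans (hnorm_triangle x _ _) _.
    have : q <= r - hnorm (x - c) by rewrite /q !ge_min lexx !orbT.
    lra.
  have /hd : hnorm (y - x) < d.
    by apply: le_lt_trans yq _; rewrite /q gt_min ltr_pdivrMr// ltr_pMr// ltr1n.
  have := hnorm_triangle (T s y) (T s x) 0.
  by rewrite !subr0 hnormBC; lra.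
have [f Pf] := choice step.
pose st := fix st n := if n is m.+1 then (f (m, st m)).2 else ((0 : X), (1 : R)).
have st0 n : 0 < (st n).2 by elim: n => [|n ih] //=; case: (Pf (n, st n) ih).
have stS n : (st n.+1).2 <= n.+1%:R^-1.
  by have [_ _ _ []] := Pf (n, st n) (st0 n).
have stB n y : hnorm (y - (st n.+1).1) <= (st n.+1).2 ->
    hnorm (y - (st n).1) <= (st n).2 /\ n%:R < hnorm (T (f (n, st n)).1 y).
  by move=> h; have [_ _ _ [_ ]] := Pf (n, st n) (st0 n); exact.
have stM n m y : hnorm (y - (st (n + m)%N).1) <= (st (n + m)%N).2 ->
    hnorm (y - (st n).1) <= (st n).2.
  by elim: m => [|m ih]; rewrite ?addn0// addnS => /stB[/ih].
have cc n m : hnorm ((st (n + m)%N).1 - (st n).1) <= (st n).2.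
  by apply: (stM n m); rewrite subrr hnorm0 ltW.
have [l hl] : exists l : X, (st n).1 @[n --> \oo] --> l.
  apply: hilbert_complete => e e0.
  have e2 : 0 < e / 2 by rewrite divr_gt0.
  have [N hN] := inv_succ_small e2; exists N.+1 => n m hn hm.
  apply: le_lt_trans (hnorm_triangle (st N.+1).1 _ _) _.
  rewrite -(subnKC hn) -(subnKC hm) (hnormBC (st N.+1).1).
  have rN := le_lt_trans (stS N) (hN N (leqnn _)).
  by rewrite [ltRHS]splitr ltrD// (le_lt_trans _ rN).
have lB n : hnorm (l - (st n).1) <= (st n).2.
  apply/ler_addgt0Pr => e e0; move/hnorm_cvgP : hl => /(_ e e0)[N _ hN].
  apply: le_trans (hnorm_triangle (st (n + N)%N).1 _ _) _.
  have := cc n N; have := hN (n + N)%N (leq_addl _ _) => /=; rewrite hnormBC; lra.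
have [d d0 hd] := semigroup_near0 l ltr01.
have [N1 hN1] := inv_succ_small d0.
pose N := maxn N1 (Num.truncn (hnorm l + 1)).+1.
have [s0 sN _ _] := Pf (N, st N) (st0 N).
have [_] := stB N l (lB N.+1).
have /hd : (f (N, st N)).1 < d.
  by apply: lt_trans sN _; apply: hN1; exact: leq_maxl.
move=> /(_ s0) h1 h2.
have h3 : hnorm l + 1 < N%:R.
  by apply: lt_le_trans (truncnS_gt _) _; rewrite ler_nat leq_maxr.
have := hnorm_triangle l (T (f (N, st N)).1 l) 0.
rewrite !subr0; move: h1 h2 h3 => /=; lra.
Qed.

Lemma generator_cvgP x y : D x /\ A x = y <->
  forall e : R, 0 < e -> exists2 d : R, 0 < d &
    forall h, 0 < h < d -> hnorm (T h x - x - h *! y) <= e * h.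
Proof.
rewrite -(hA x y) hnorm_cvgP.
have E h : 0 < h -> hnorm (T h x - x - h *! y) = h * hnorm (((h^-1)%:C)%C *: (T h x - x) - y).
  move=> h0; rewrite -[X in X * _]gtr0_norm// -hnormZ; congr hnorm.
  by apply: ip_ext => w; rewrite !ipE; field; rewrite gt_eqF.
split=> H e e0.
  have /at_right0P[d d0 hd] := H e e0; exists d => // h /[dup] hh /andP[h0 _].
  by rewrite E// mulrC ler_wpM2r ?ltW// hd.
have e2 : 0 < e / 2 by rewrite divr_gt0.
have [d d0 hd] := H _ e2; apply/at_right0P; exists d => // h /[dup] hh /andP[h0 _].
have := hd _ hh; rewrite E// mulrC ler_pM2r// => /le_lt_trans; apply.
by rewrite ltr_pdivrMr// ltr_pMr// ltr1n.
Qed.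

Lemma generator_sub x y : D x -> D y -> D (x - y) /\ A (x - y) = A x - A y.
Proof.
move=> Dx Dy; apply/generator_cvgP => e e0.
have e2 : 0 < e / 2 by rewrite divr_gt0.
have [/(_ (conj Dx erefl) _ e2)[d d0 hd] _] := generator_cvgP x (A x).
have [/(_ (conj Dy erefl) _ e2)[d' d0' hd'] _] := generator_cvgP y (A y).
exists (Num.min d d'); first by rewrite lt_min d0.
move=> h; rewrite lt_min => /andP[h0 /andP[hhd hhd']].
have := hd h; have := hd' h; rewrite h0 hhd hhd' => /(_ isT) h2 /(_ isT) h1.
have -> : T h (x - y) - (x - y) - h *! (A x - A y) =
    (T h x - x - h *! A x) - (T h y - y - h *! A y) by rewrite (linE (T h)); vec.
by apply: le_trans (hnorm_subr _ _) _; lra.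
Qed.

Lemma generator_semigroup t x : 0 <= t -> D x -> D (T t x) /\ A (T t x) = T t (A x).
Proof.
move=> t0 Dx; apply/hA.
have /hA h : D x /\ A x = A x by [].
have c := @C0_bounded _ _ _ hT t t0 (A x).
have := cvg_comp _ _ h c; apply: cvg_trans; apply: near_eq_cvg.
apply/at_right0P; exists 1 => // k /andP[k0 _] /=.
have E : T t (T k x) = T k (T t x) by rewrite -!(C0_add hT) ?(ltW k0)// addrC.
by rewrite (linE (T t)) (linE (T t)) E.
Qed.

Hypothesis A_dissipative : forall x, D x -> ip (A x) x <= 0.
Hypothesis D_dense : dense D.

(** Along a step [h] the energy changes by [2 h ip (A y) y] with [y = T t x], up
to an error that is small compared to [h] uniformly in [t]; adding the steps of
a fine subdivision leaves only the dissipative part. *)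
Lemma semigroup_contraction_small : exists2 d : R, 0 < d &
  forall (s : R) x, 0 <= s -> s < d -> hnorm (T s x) <= hnorm x.
Proof.
have [d d0 [M M0 hM]] := semigroup_locally_bounded; exists d => //.
suff H (t : R) x : D x -> 0 < t -> t < d -> hnorm (T t x) <= hnorm x.
  move=> t x; rewrite le_eqVlt => /predU1P[<- _|t0 td]; first by rewrite (C0_id hT).
  apply: (@le_of_eps _ _ _ (M + 1)); first by rewrite addr_ge0 ?(ltW M0).
  move=> e e0 _; have [y Dy xy] := dense_hnorm D_dense x e0.
  have := hM t (y - x) (ltW t0) td; have := H t y Dy t0 td.
  have := hnorm_triangle (T t y) (T t x) 0; have := hnorm_triangle x y 0.
  rewrite !subr0 linearB /= (hnormBC (T t x)) => h1 h2 h3 h4.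
  have : M * hnorm (y - x) <= M * e by apply: ler_wpM2l; exact: ltW.
  lra.
move=> Dx t0 td.
(* One step costs [h e] times this constant: the first term comes from the
   remainder of the first-order expansion, the second from the squared
   increment. *)
pose K := 2 * M ^+ 2 * hnorm x + M ^+ 2 * (hnorm (A x) + 1) ^+ 2.
have K0 : 0 <= K.
  by rewrite addr_ge0// !mulr_ge0 ?hnorm_ge0// ?exprn_ge0// ?addr_ge0 ?hnorm_ge0// ltW.
rewrite -ler_sqr ?nnegrE ?hnorm_ge0//.
apply: (@le_of_eps _ _ _ (t * K)); first by rewrite mulr_ge0// ltW.
move=> e e0 e1.
have [/(_ (conj Dx erefl) _ e0)[r r0 hr] _] := generator_cvgP x (A x).
have re0 : 0 < Num.min r e by rewrite lt_min r0.
have [N hN] := archi_lt re0 (ltW t0).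
set h := t / N.+1%:R in hN; have h0 : 0 < h by rewrite divr_gt0.
have hr' := hr h; move: hN; rewrite lt_min => /andP[hhr hhe].
rewrite h0 hhr in hr'; have {}hr' := hr' isT.
have step k : (k <= N.+1)%N -> hnorm (T (k%:R * h) x) ^+ 2 <= hnorm x ^+ 2 + k%:R * h * (e * K).
  elim: k => [|k ih] kN; first by rewrite !mul0r (C0_id hT) addr0.
  apply: le_trans (_ : hnorm (T (k%:R * h) x) ^+ 2 + h * (e * K) <= _); last first.
    by have := ih (ltnW kN); rewrite -natr1; lra.
  have kh0 : 0 <= k%:R * h by rewrite mulr_ge0// ltW.
  have khd : k%:R * h < d.
    apply: le_lt_trans td; rewrite [leRHS](_ : _ = N.+1%:R * h); last first.
      by rewrite /h mulrC divfK// pnatr_eq0.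
    by rewrite ler_wpM2r ?(ltW h0)// ler_nat ltnW.
  have -> : T (k.+1%:R * h) x = T (k%:R * h) (T h x).
    by rewrite -(C0_add hT) ?(ltW h0)//; congr (T _ x); rewrite -natr1; ring.
  set B := T (k%:R * h) in kh0 khd *.
  have hB y : hnorm (B y) <= M * hnorm y by apply: hM.
  have [DB AB] := generator_semigroup kh0 Dx.
  have EB : B (T h x) - B x = B (T h x - x - h *! A x) + h *! A (B x).
    by rewrite AB -/B -linearZ -linearB -linearD /= subrK.
  have -> : hnorm (B (T h x)) ^+ 2 = hnorm (B x) ^+ 2 + 2 * ip (B (T h x) - B x) (B x)
      + hnorm (B (T h x) - B x) ^+ 2.
    by rewrite -[in LHS](subrK (B x) (B (T h x))) addrC hnormD_sq ipC.
  have h1 : ip (B (T h x) - B x) (B x) <= h * (e * (M ^+ 2 * hnorm x)).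
    rewrite EB ipDl ipZl.
    have := A_dissipative DB; rewrite -/B -(pmulr_rle0 _ h0) => a1.
    have := ip_le (B (T h x - x - h *! A x)) (B x).
    have : hnorm (B (T h x - x - h *! A x)) * hnorm (B x) <= (M * (e * h)) * (M * hnorm x).
      apply: ler_pM; rewrite ?hnorm_ge0//.
      by apply: le_trans (hB _) _; rewrite ler_wpM2l// ltW.
    by rewrite (_ : h * (e * _) = M * (e * h) * (M * hnorm x)); [lra|ring].
  have h2 : hnorm (B (T h x) - B x) <= M * (h * (hnorm (A x) + 1)).
    rewrite -linearB; apply: le_trans (hB _) _; rewrite ler_wpM2l ?(ltW M0)//.
    rewrite -(subrK (h *! A x) (T h x - x)); apply: le_trans (hnorm_addr _ _) _.
    rewrite hnormZ gtr0_norm//.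
    have : e * h <= 1 * h by rewrite ler_wpM2r ?(ltW h0).
    lra.
  have h3 : hnorm (B (T h x) - B x) ^+ 2 <= h * (e * (M ^+ 2 * (hnorm (A x) + 1) ^+ 2)).
    apply: le_trans (_ : (M * (h * (hnorm (A x) + 1))) ^+ 2 <= _).
      by rewrite ler_sqr ?nnegrE ?hnorm_ge0// !mulr_ge0 ?addr_ge0 ?hnorm_ge0// ltW.
    rewrite (_ : _ ^+ 2 = h * (h * (M ^+ 2 * (hnorm (A x) + 1) ^+ 2))); last by ring.
    by rewrite ler_wpM2l ?(ltW h0)// ler_wpM2r ?(ltW hhe)// mulr_ge0// sqr_ge0.
  rewrite /K; lra.
have := step _ (leqnn _).
rewrite (_ : N.+1%:R * h = t); last by rewrite /h mulrC divfK// pnatr_eq0.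
by move=> /le_trans; apply; rewrite mulrCA.
Qed.

Lemma semigroup_contraction (t : R) x : 0 <= t -> hnorm (T t x) <= hnorm x.
Proof.
move=> t0; have [d d0 hd] := semigroup_contraction_small.
have [N hN] := archi_lt d0 t0; set h := t / _ in hN.
have h0 : 0 <= h by rewrite divr_ge0.
have step k : hnorm (T (k%:R * h) x) <= hnorm x.
  elim: k => [|k ih]; first by rewrite mul0r (C0_id hT).
  rewrite -natr1 mulrDl mul1r addrC (C0_add hT)// ?mulr_ge0//.
  by apply: le_trans ih; apply: hd.
have := step N.+1; congr (hnorm (T _ x) <= _).
by rewrite /h mulrC divfK// pnatr_eq0.
Qed.

(** A Riemann-sum substitute for [T t z - z] being the integral of [T s (A z)],
which avoids integrating vector-valued functions. *)
Lemma generator_increment (t w : R) z : D z -> 0 <= t ->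
  (forall s, 0 <= s <= t -> hnorm (T s (A z) - A z) <= w) ->
  hnorm (T t z - z - t *! A z) <= t * w.
Proof.
move=> Dz; rewrite le_eqVlt => /predU1P[<- _|t0 hw].
  by rewrite (C0_id hT) subrr sub0r scale0r oppr0 hnorm0 mul0r.
apply: (@le_of_eps _ _ _ t); first exact: ltW.
move=> e e0 _.
have [/(_ (conj Dz erefl) _ e0)[r r0 hr] _] := generator_cvgP z (A z).
have [N hN] := archi_lt r0 (ltW t0).
set h := t / N.+1%:R in hN; have h0 : 0 < h by rewrite divr_gt0.
have {}hr := hr h; rewrite h0 hN in hr; have {}hr := hr isT.
have tE : N.+1%:R * h = t by rewrite /h mulrC divfK// pnatr_eq0.
have step k : (k <= N.+1)%N ->
    hnorm (T (k%:R * h) z - z - (k%:R * h) *! A z) <= k%:R * h * (w + e).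
  elim: k => [|k ih] kN.
    by rewrite !mul0r (C0_id hT) subrr sub0r scale0r oppr0 hnorm0.
  have kh0 : 0 <= k%:R * h by rewrite mulr_ge0// ltW.
  have -> : T (k.+1%:R * h) z = T (k%:R * h) (T h z).
    by rewrite -(C0_add hT) ?(ltW h0)//; congr (T _ z); rewrite -natr1; ring.
  have kht : 0 <= k%:R * h <= t.
    by rewrite kh0 -tE ler_wpM2r ?(ltW h0)// ler_nat ltnW.
  have := hw _ kht; set B := T (k%:R * h) => hB.
  have -> : B (T h z) - z - (k.+1%:R * h) *! A z =
     (B z - z - (k%:R * h) *! A z) + B (T h z - z - h *! A z) + h *! (B (A z) - A z).
    by rewrite !(linE B) -natr1; vec.
  apply: le_trans (hnorm_addr _ _) _; apply: le_trans (lerD (hnorm_addr _ _) (lexx _)) _.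
  have h1 := ih (ltnW kN); have h2 := semigroup_contraction (T h z - z - h *! A z) kh0.
  rewrite hnormZ gtr0_norm//.
  have : h * hnorm (B (A z) - A z) <= h * w by rewrite ler_wpM2l// ltW.
  rewrite -natr1; move: h1 h2; rewrite -/B; lra.
have := step _ (leqnn _); rewrite tE; lra.
Qed.

(** [generator_increment] is uniform along the sequence, because the semigroup
contracts, and passes to the limit. *)
Lemma generator_closed (u : nat -> X) x y :
  (forall n, D (u n)) -> u n @[n --> \oo] --> x -> A (u n) @[n --> \oo] --> y ->
  D x /\ A x = y.
Proof.
move=> Du ux Auy; apply/generator_cvgP => e e0.
have e3 : 0 < e / 3 by rewrite divr_gt0.
have [d d0 hd] := semigroup_near0 y e3; exists d => // t /andP[t0 td].
apply: (@le_of_eps _ _ _ (2 + 3 * t)); first by rewrite addr_ge0 ?mulr_ge0 ?(ltW t0).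
move=> f f0 _.
have [N1 _ hN1] := (hnorm_cvgP _ _).1 ux _ f0.
have [N2 _ hN2] := (hnorm_cvgP _ _).1 Auy _ f0.
pose n := maxn N1 N2.
have {hN1} h1 := hN1 n (leq_maxl _ _); have {hN2} h2 := hN2 n (leq_maxr _ _).
rewrite /= in h1 h2.
have inc : hnorm (T t (u n) - u n - t *! A (u n)) <= t * (e / 3 + 2 * f).
  apply: generator_increment => [|//|]; [by []|exact: ltW|].
  move=> s /andP[s0 st].
  have := hnorm_triangle y (T s y) (A (u n)).
  have := hnorm_triangle (T s y) (T s (A (u n))) (A (u n)).
  rewrite -linearB /= => a1 a2; have := semigroup_contraction (A (u n) - y) s0.
  have := hd s s0 (le_lt_trans st td); rewrite (hnormBC y) in a2; lra.
have -> : T t x - x - t *! y = (T t (u n) - u n - t *! A (u n)) +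
   ((T t (x - u n) - (x - u n)) + t *! (A (u n) - y)) by rewrite (linE (T t)); vec.
apply: le_trans (hnorm_addr _ _) _; apply: le_trans (lerD (lexx _) (hnorm_addr _ _)) _.
have := hnorm_subr (T t (x - u n)) (x - u n); rewrite hnormZ gtr0_norm//.
have := semigroup_contraction (x - u n) (ltW t0); rewrite (hnormBC x).
have : t * hnorm (A (u n) - y) <= t * f by rewrite ler_wpM2l ?(ltW t0)// ltW.
have : 0 <= t * e by rewrite mulr_ge0 ?(ltW t0) ?(ltW e0).
lra.
Qed.

(** A bounded substitute for the operator [x |-> x - m A x]: its inverse
contracts, and it converges to that operator on the domain as [h] tends to [0]. *)
Let B (m h : R) x := x - (m / h) *! (T h x - x).

Let BB m h x y : B m h (x - y) = B m h x - B m h y.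
Proof. by rewrite /B (linE (T h)); vec. Qed.

Let B_comm m h k x : 0 <= h -> 0 <= k -> B m h (B m k x) = B m k (B m h x).
Proof.
move=> h0 k0; have E : T h (T k x) = T k (T h x) by rewrite -!(C0_add hT)// addrC.
by rewrite /B !(linE (T h)) !(linE (T k)) E; vec.
Qed.

Let B_bound m h x : 0 < m -> 0 < h -> hnorm x <= hnorm (B m h x).
Proof.
move=> m0 h0; have mh : 0 < m / h by rewrite divr_gt0.
have : hnorm ((1 + m / h) *! x) <= hnorm (B m h x) + m / h * hnorm x.
  rewrite (_ : _ *! x = B m h x + (m / h) *! T h x); last by rewrite /B; vec.
  apply: le_trans (hnorm_addr _ _) _; rewrite lerD2l hnormZ gtr0_norm//.
  by rewrite ler_wpM2l ?(ltW mh)// semigroup_contraction// ltW.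
rewrite hnormZ gtr0_norm ?addr_gt0//; lra.
Qed.

Let B_surj m h f : 0 < m -> 0 < h -> exists x, B m h x = f.
Proof.
move=> m0 h0; have mh : 0 < m / h by rewrite divr_gt0.
have mh1 : 0 < 1 + m / h by rewrite addr_gt0.
pose g x := (1 + m / h)^-1 *! (f + (m / h) *! T h x).
pose q := m / h / (1 + m / h).
have q1 : 0 <= q < 1 by rewrite divr_ge0 ?(ltW mh) ?(ltW mh1)//= ltr_pdivrMr//; lra.
have [| |x y _ _|x _ gx] := @ball_fixed_point _ _ g 0 (hnorm (g 0) / (1 - q)) q q1.
- by rewrite divr_ge0 ?hnorm_ge0//; lra.
- by rewrite subr0 mulrC divfK//; lra.
- rewrite (_ : g x - g y = q *! T h (x - y)); last first.
    by rewrite /g /q (linE (T h)); vec.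
  rewrite hnormZ ger0_norm; last by case/andP: q1.
  by rewrite ler_wpM2l ?semigroup_contraction ?(ltW h0)//; case/andP: q1.
exists x; rewrite /B.
have -> : f = (1 + m / h) *! g x - (m / h) *! T h x.
  by rewrite /g; vec.
by rewrite gx; vec.
Qed.

Let B_cvg m f (e : R) : 0 < m -> D f -> 0 < e -> exists2 d : R, 0 < d &
  forall h, 0 < h < d -> hnorm (B m h f - (f - m *! A f)) <= e.
Proof.
move=> m0 Df e0; have e1 : 0 < e / m by rewrite divr_gt0.
have [/(_ (conj Df erefl) _ e1)[d d0 hd] _] := generator_cvgP f (A f).
exists d => // h /[dup] hh /andP[h0 _]; have := hd _ hh.
rewrite (_ : B m h f - _ = - ((m / h) *! (T h f - f - h *! A f))); last first.
  by rewrite /B; vec.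
move=> h1; rewrite hnorm_oppr hnormZ gtr0_norm ?divr_gt0//.
have mh : 0 <= m / h by rewrite divr_ge0 ?(ltW m0) ?(ltW h0).
apply: le_trans (ler_wpM2l mh h1) _.
by have -> : m / h * (e / m * h) = e by field; rewrite !gt_eqF.
Qed.

(** The solutions [u n] of [B m (h n) (u n) = f] are Cauchy as [h n] tends to
[0]: these operators commute and their inverses contract, so the distance of two
solutions is at most that of the two values of the operators at [f], and these
converge because [f] is in the domain. *)
Lemma resolvent_on_domain m f : 0 < m -> D f -> exists x, D x /\ x - m *! A x = f.
Proof.
move=> m0 Df; pose h n : R := n.+1%:R^-1; have h0 n : 0 < h n by rewrite invr_gt0.
have [u hu] := choice (fun n => B_surj f m0 (h0 n)).
have Bu k n : 0 < k -> hnorm (B m k (u n) - f) <= hnorm (B m k f - B m (h n) f).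
  move=> k0; have := B_bound (B m k (u n) - f) m0 (h0 n).
  by rewrite BB (B_comm _ _ (ltW (h0 n)) (ltW k0)) hu.
have [l hl] : exists l : X, u n @[n --> \oo] --> l.
  apply: hilbert_complete => e e0.
  have e3 : 0 < e / 3 by rewrite divr_gt0.
  have [d d0 hd] := B_cvg m0 Df e3; have [N hN] := inv_succ_small d0.
  exists N => n k hn hk.
  apply: le_lt_trans (B_bound (u n - u k) m0 (h0 k)) _; rewrite BB hu.
  apply: le_lt_trans (Bu _ _ (h0 k)) _.
  apply: le_lt_trans (hnorm_triangle (f - m *! A f) _ _) _.
  rewrite (hnormBC (f - m *! A f)).
  have := hd (h n); have := hd (h k); rewrite !h0 !hN// => /(_ isT) + /(_ isT); lra.
have Bl k : 0 < k -> hnorm (B m k l - f) <= hnorm (B m k f - (f - m *! A f)).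
  move=> k0; have mk : 0 < m / k by rewrite divr_gt0.
  apply: (@le_of_eps _ _ _ (2 + 2 * (m / k))).
    by rewrite addr_ge0// mulr_ge0// ltW.
  move=> e e0 _.
  have [N1 _ hN1] := (hnorm_cvgP _ _).1 hl _ e0.
  have [d d0 hd] := B_cvg m0 Df e0; have [N2 hN2] := inv_succ_small d0.
  pose n := maxn N1 N2.
  have {hN1} h1 := hN1 n (leq_maxl _ _); have {hN2} h2 := hN2 n (leq_maxr _ _).
  have {hd} h3 := hd (h n); rewrite h0 h2 in h3; have {}h3 := h3 isT; rewrite /= in h1.
  apply: le_trans (hnorm_triangle (B m k (u n)) _ _) _; rewrite -BB.
  have h4 : hnorm (B m k (l - u n)) <= (1 + 2 * (m / k)) * e.
    apply: le_trans (_ : (1 + 2 * (m / k)) * hnorm (l - u n) <= _); last first.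
      by rewrite hnormBC ler_wpM2l ?(ltW h1)// addr_ge0// mulr_ge0// ltW.
    rewrite /B; apply: le_trans (hnorm_subr _ _) _; rewrite hnormZ gtr0_norm//.
    have : m / k * hnorm (T k (l - u n) - (l - u n)) <= m / k * (2 * hnorm (l - u n)).
      rewrite ler_wpM2l ?(ltW mk)//; apply: le_trans (hnorm_subr _ _) _.
      by have := semigroup_contraction (l - u n) (ltW k0); lra.
    lra.
  have := Bu k n k0; have := hnorm_triangle (f - m *! A f) (B m k f) (B m (h n) f).
  rewrite (hnormBC (f - m *! A f)); lra.
exists l; suff [Dl ->] : D l /\ A l = m^-1 *! (l - f).
  by split=> //; vec.
apply/generator_cvgP => e e0; have e1 : 0 < e * m by rewrite mulr_gt0.
have [d d0 hd] := B_cvg m0 Df e1; exists d => // k /[dup] hk /andP[k0 _].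
have := le_trans (Bl k k0) (hd _ hk).
rewrite (_ : B m k l - f = - ((m / k) *! (T k l - l - k *! (m^-1 *! (l - f))))); last first.
  by rewrite /B; vec.
rewrite hnorm_oppr hnormZ gtr0_norm ?divr_gt0//.
have -> : e * m = m / k * (e * k) by field; rewrite gt_eqF.
by rewrite ler_pM2l ?divr_gt0.
Qed.

(** Density and closedness extend solvability from [resolvent_on_domain]; this is
the half of the Lumer-Phillips theorem that goes from the semigroup to its
generator. *)
Lemma generator_resolvent m f : 0 < m -> exists x, D x /\ x - m *! A x = f.
Proof.
move=> m0; have ex n : exists x, D x /\ hnorm (x - m *! A x - f) < n.+1%:R^-1.
  have n0 : 0 < n.+1%:R^-1 :> R by rewrite invr_gt0.
  have [g Dg gf] := dense_hnorm D_dense f n0.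
  by have [x [Dx xg]] := resolvent_on_domain m0 Dg; exists x; rewrite xg.
have [u hu] := choice ex.
have uu n k : hnorm (u n - u k) <= hnorm ((u n - m *! A (u n)) - (u k - m *! A (u k))).
  have [[Dn _] [Dk _]] := (hu n, hu k).
  have [DD AA] := generator_sub Dn Dk.
  rewrite (_ : u n - m *! A (u n) - (u k - m *! A (u k)) = (u n - u k) - m *! A (u n - u k)); last by rewrite AA; vec.
  rewrite -ler_sqr ?nnegrE ?hnorm_ge0// [leRHS]hnormB_sq ipZr ipC.
  have := A_dissipative DD; rewrite -(pmulr_rle0 _ m0).
  have := sqr_ge0 (hnorm (m *! A (u n - u k))); lra.
have [x hx] : exists x : X, u n @[n --> \oo] --> x.
  apply: hilbert_complete => e e0; have e2 : 0 < e / 2 by rewrite divr_gt0.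
  have [N hN] := inv_succ_small e2; exists N => n k hn hk.
  apply: le_lt_trans (uu n k) _; apply: le_lt_trans (hnorm_triangle f _ _) _.
  have [[_ h1] [_ h2]] := (hu n, hu k); rewrite (hnormBC f).
  by rewrite [ltRHS]splitr ltrD//; [exact: lt_trans h1 (hN _ _)|exact: lt_trans h2 (hN _ _)].
have [Dx Ax] : D x /\ A x = m^-1 *! (x - f).
  apply: (@generator_closed u) => //; first by move=> n; case: (hu n).
  apply/hnorm_cvgP => e e0.
  have e2 : 0 < e * m / 2 by rewrite !mulr_gt0// invr_gt0.
  have [N1 _ hN1] := (hnorm_cvgP _ _).1 hx _ e2.
  have [N2 hN2] := inv_succ_small e2.
  exists (maxn N1 N2) => // n; rewrite /= geq_max => /andP[n1 n2].
  rewrite (_ : A (u n) - _ = m^-1 *! ((u n - x) - (u n - m *! A (u n) - f))); last first.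
    by vec.
  rewrite hnormZ gtr0_norm ?invr_gt0// mulrC ltr_pdivrMr//.
  apply: le_lt_trans (hnorm_subr _ _) _; rewrite [ltRHS]splitr ltrD//; first exact: hN1.
  by have [_ /lt_trans] := hu n; apply; apply: hN2.
exists x; split=> //; rewrite Ax; vec.
Qed.

(** First-order expansion of an orbit at time [s] in both directions: for
[t < s] the expansion is made at [t] and the derivative is moved to [s]. *)
Lemma orbit_increment (s t w : R) z : D z -> 0 <= s -> 0 <= t ->
  (forall r, 0 <= r <= `|t - s| -> hnorm (T r (A z) - A z) <= w) ->
  hnorm (T t z - T s z - (t - s) *! T s (A z)) <= `|t - s| * (2 * w).
Proof.
move=> Dz s0 t0 hw.
have w0 : 0 <= w by apply: le_trans (hnorm_ge0 _) (hw 0 _); rewrite lexx normr_ge0.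
have inc := generator_increment Dz (normr_ge0 _) hw.
have [st|ts] := leP s t.
  have ts0 : 0 <= t - s by rewrite subr_ge0.
  rewrite ger0_norm// in inc *.
  have {1}-> : t = s + (t - s) by ring.
  rewrite (C0_add hT)// -linearZ -!linearB /=.
  apply: le_trans (semigroup_contraction _ s0) _; apply: le_trans inc _.
  by rewrite ler_wpM2l// mulrDl mul1r lerDl.
have st0 : 0 < s - t by rewrite subr_gt0.
rewrite -normrN opprB gtr0_norm// in inc hw *.
set h := s - t in st0 inc hw *.
have Ts y : T s y = T t (T h y).
  by rewrite -(C0_add hT) ?(ltW st0)//; congr (T _ y); rewrite /h; ring.
rewrite !Ts.
have -> : T t z - T t (T h z) - (t - s) *! T t (T h (A z)) =
   T t (h *! (T h (A z) - A z) - (T h z - z - h *! A z)).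
  by rewrite !(linE (T t)) /h; vec.
apply: le_trans (semigroup_contraction _ t0) _; apply: le_trans (hnorm_subr _ _) _.
rewrite hnormZ gtr0_norm//.
have : h * hnorm (T h (A z) - A z) <= h * w.
  by rewrite ler_wpM2l ?(ltW st0)// hw// lexx ltW.
lra.
Qed.

End Semigroups.

(** * Strongly monotone maps *)
Section StronglyMonotone.
Context {R : realType} {U : hilbertType R}.

Lemma locally_lipschitz_ball (phi : U -> U) : locally_lipschitz phi ->
  forall u, exists2 r : R, 0 < r & exists2 l : R, 0 < l & forall x y,
    hnorm (x - u) < r -> hnorm (y - u) < r -> hnorm (phi x - phi y) <= l * hnorm (x - y).
Proof.
move=> hphi u; have [V /nbhs_hnormP[r r0 hr] [M [Mr hM]]] := hphi u.
have M1 : 0 < `|M| + 1 by rewrite ltr_wpDl.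
have E : (complex.Re (`|M| + 1))%:C%C = `|M| + 1 by rewrite RRe_real// gtr0_real.
exists r => //; exists (complex.Re (`|M| + 1)); first by rewrite -ltcR E.
move=> x y xr yr; have : M < `|M| + 1.
  by apply: le_lt_trans (real_ler_norm Mr) _; rewrite ltrDl.
move=> /hM /= /(_ (x, y)) /=; rewrite !normE -E -rmorphM lecR; apply.
by split; apply: hr.
Qed.

Variables (F : U -> U) (c : R).
Hypothesis c0 : 0 < c.
Hypothesis F_mono : forall u v, c * hnorm (u - v) ^+ 2 <= ip (F u - F v) (u - v).
Hypothesis F_lip : forall u, exists2 r : R, 0 < r & exists2 l : R, 0 < l & forall x y,
    hnorm (x - u) < r -> hnorm (y - u) < r -> hnorm (F x - F y) <= l * hnorm (x - y).

Lemma strongly_monotone_inv_lip u v : c * hnorm (u - v) <= hnorm (F u - F v).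
Proof.
have := le_trans (F_mono u v) (ip_le _ _).
have [->|n0] := eqVneq (hnorm (u - v)) 0; first by rewrite !mulr0 hnorm_ge0.
by rewrite expr2 mulrA ler_pM2r// lt_def n0 hnorm_ge0.
Qed.

(** Zarantonello iteration: [w - rho (F w - g)] contracts near [u] when [rho] is
small compared to the Lipschitz constant, and it preserves a ball about [u] when
[g] is close to [F u]. *)
Lemma strongly_monotone_open u : exists2 e : R, 0 < e &
  forall g, hnorm (F u - g) <= e -> exists w, F w = g.
Proof.
have [r r0 [l l0 hl]] := F_lip u.
pose m := l + c; have m0 : 0 < m by rewrite addr_gt0.
pose s := (c / m) ^+ 2.
have cm : 0 < c / m < 1 by rewrite divr_gt0//= ltr_pdivrMr// mul1r ltrDr.
have [s0 s1] : 0 < s /\ s < 1.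
  by case/andP: cm => a b; rewrite /s exprn_gt0// expr_lt1// ltW.
(* The squared contraction factor [1 - 2 rho c + rho^2 m^2] is smallest for this
   [rho] and then equals [1 - s], which is at most [(1 - s / 2)^2]. *)
pose rho := c / m ^+ 2; have rho0 : 0 < rho by rewrite divr_gt0// exprn_gt0.
exists (s / 2 * (r / 2) / rho); first by rewrite !mulr_gt0// ?invr_gt0.
move=> g ug.
have rr x : hnorm (x - u) <= r / 2 -> hnorm (x - u) < r.
  by move=> /le_lt_trans; apply; rewrite ltr_pdivrMr// ltr_pMr// ltr1n.
have [| | |x y xr yr|w _ wE] := @ball_fixed_point _ _ (fun w => w - rho *! (F w - g)) u (r / 2) (1 - s / 2).
- by apply/andP; split; lra.
- by rewrite divr_ge0// ltW.
- rewrite (_ : _ - u = - (rho *! (F u - g))); last by vec.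
  rewrite hnorm_oppr hnormZ gtr0_norm// mulrC -ler_pdivlMr//.
  by apply: le_trans ug _; rewrite opprB addrCA subrr addr0.
- have -> : x - rho *! (F x - g) - (y - rho *! (F y - g)) = (x - y) - rho *! (F x - F y) by vec.
  rewrite -ler_sqr ?nnegrE ?hnorm_ge0 ?mulr_ge0 ?hnorm_ge0//; last by lra.
  rewrite [leLHS]hnormB_sq ipZr ipC hnormZ gtr0_norm//.
  have h1 := F_mono x y; have h2 := hl x y (rr _ xr) (rr _ yr).
  have h3 : (rho * hnorm (F x - F y)) ^+ 2 <= s * hnorm (x - y) ^+ 2.
    rewrite -[s]/((c / m) ^+ 2) -exprMn ler_sqr ?nnegrE ?mulr_ge0 ?hnorm_ge0 ?invr_ge0 ?sqr_ge0//; try exact: ltW.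
    have h4 : hnorm (F x - F y) <= m * hnorm (x - y).
      by apply: le_trans h2 _; rewrite ler_wpM2r ?hnorm_ge0// lerDl ltW.
    apply: le_trans (ler_wpM2l (ltW rho0) h4) _.
    by rewrite mulrA (_ : rho * m = c / m)// /rho; field; rewrite gt_eqF.
  have h5 : s * hnorm (x - y) ^+ 2 <= rho * ip (F x - F y) (x - y).
    rewrite (_ : s = rho * c); last by rewrite /s /rho; field; rewrite gt_eqF.
    by rewrite -mulrA ler_wpM2l// ltW.
  have h6 : 0 <= s ^+ 2 * hnorm (x - y) ^+ 2 by rewrite mulr_ge0// sqr_ge0.
  rewrite exprMn; lra.
exists w; apply/subr0_eq/hnorm_eq0.
have : hnorm (rho *! (F w - g)) = 0.
  rewrite (_ : rho *! (F w - g) = w - (w - rho *! (F w - g))); last by vec.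
  by rewrite wE subrr hnorm0.
by rewrite hnormZ => /eqP; rewrite mulf_eq0 normr_eq0 gt_eqF//= => /eqP.
Qed.

(** The points of the segment from [F 0] to [g] that are values of [F] form a
closed set, because the inverse of [F] is Lipschitz, and an open one by
[strongly_monotone_open]. *)
Lemma strongly_monotone_surj g : exists u, F u = g.
Proof.
pose d := g - F 0; pose gt (t : R) := F 0 + t *! d.
pose S : set R := [set t | 0 <= t <= 1 /\ exists u, F u = gt t].
have S0 : S 0 by split; [rewrite lexx ler01|exists 0; rewrite /gt scale0r addr0].
have hS : has_sup S.
  by split; [exists 0|exists 1 => t [/andP[]]].
pose t1 := sup S.
have t10 : 0 <= t1 by apply: sup_upper_bound.
have t11 : t1 <= 1 by apply: ge_sup; [exists 0|move=> t [/andP[]]].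
have dt (t t' : R) u v : F u = gt t -> F v = gt t' -> c * hnorm (u - v) <= `|t - t'| * hnorm d.
  move=> hu hv; apply: le_trans (strongly_monotone_inv_lip u v) _.
  by rewrite hu hv -hnormZ (_ : gt t - gt t' = (t - t') *! d)// /gt; vec.
have ex n : exists tu : R * U, [/\ t1 - n.+1%:R^-1 < tu.1, tu.1 <= t1 & F tu.2 = gt tu.1].
  have n0 : 0 < n.+1%:R^-1 :> R by rewrite invr_gt0.
  have [t St tt] := sup_adherent n0 hS; have [_ [u hu]] := St.
  by exists (t, u); split => //; apply: sup_upper_bound.
have [tu htu] := choice ex.
have close n : `|(tu n).1 - t1| < n.+1%:R^-1.
  by have [a b _] := htu n; rewrite distrC ger0_norm ?subr_ge0// ltrBlDl -ltrBlDr.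
have [l hl] : exists l : U, (tu n).2 @[n --> \oo] --> l.
  apply: hilbert_complete => e e0.
  have d1 : 0 < hnorm d + 1 by rewrite ltr_wpDl// hnorm_ge0.
  have e2 : 0 < c * e / (hnorm d + 1) / 2 by rewrite !divr_gt0// mulr_gt0.
  have [N hN] := inv_succ_small e2; exists N => n m hn hm.
  have [[_ _ h1] [_ _ h2]] := (htu n, htu m).
  rewrite -(ltr_pM2l c0); apply: le_lt_trans (dt _ _ _ _ h1 h2) _.
  have : `|(tu n).1 - (tu m).1| < c * e / (hnorm d + 1).
    apply: le_lt_trans (ler_distD t1 _ _) _; rewrite (distrC t1) [ltRHS]splitr.
    by apply: ltrD; [exact: lt_trans (close n) (hN _ hn)|exact: lt_trans (close m) (hN _ hm)].
  rewrite ltr_pdivlMr// => /le_lt_trans; apply.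
  by rewrite ler_wpM2l// lerDl.
have Fl : F l = gt t1.
  apply/subr0_eq/hnorm_eq0/le_anti; rewrite hnorm_ge0 andbT.
  have [r r0 [k k0 hk]] := F_lip l.
  apply: (@le_of_eps _ _ _ (k + hnorm d)); first by rewrite addr_ge0 ?hnorm_ge0// ltW.
  move=> e e0 _; rewrite add0r.
  have re : 0 < Num.min r e by rewrite lt_min r0.
  have [N1 _ hN1] := (hnorm_cvgP _ _).1 hl _ re.
  have [N2 hN2] := inv_succ_small e0.
  pose n := maxn N1 N2.
  have {hN1} := hN1 n (leq_maxl _ _); have {hN2} h2 := hN2 n (leq_maxr _ _).
  rewrite /= lt_min => /andP[h1 h1']; have [_ _ Ftu] := htu n.
  apply: le_trans (hnorm_triangle (F (tu n).2) _ _) _.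
  have h3 : hnorm (F l - F (tu n).2) <= k * e.
    apply: le_trans (hk _ _ _ h1) _; first by rewrite subrr hnorm0.
    by rewrite hnormBC ler_wpM2l// ltW.
  have : hnorm (F (tu n).2 - gt t1) <= e * hnorm d.
    rewrite Ftu (_ : _ - _ = ((tu n).1 - t1) *! d); last by rewrite /gt; vec.
    by rewrite hnormZ ler_wpM2r ?hnorm_ge0// ltW// (lt_trans (close n)).
  lra.
have [t1E|t1n] := eqVneq t1 1.
  by exists l; rewrite Fl t1E /gt /d; vec.
have {}t1n : t1 < 1 by rewrite lt_neqAle t1n.
have [e e0 he] := strongly_monotone_open l.
have d1 : 0 < hnorm d + 1 by rewrite ltr_wpDl// hnorm_ge0.
pose q := Num.min (1 - t1) (e / (hnorm d + 1)).
have q0 : 0 < q by rewrite lt_min subr_gt0 t1n divr_gt0.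
have [w hw] : exists w, F w = gt (t1 + q).
  apply: he; rewrite Fl (_ : _ - _ = - (q *! d)); last by rewrite /gt; vec.
  rewrite hnorm_oppr hnormZ gtr0_norm//.
  apply: le_trans (_ : e / (hnorm d + 1) * (hnorm d + 1) <= _); last by rewrite divfK// gt_eqF.
  by apply: ler_pM; rewrite ?hnorm_ge0 ?(ltW q0)// ?ge_min ?lexx ?orbT// lerDl.
have : S (t1 + q).
  split; last by exists w.
  have : q <= 1 - t1 by rewrite ge_min lexx.
  by move=> h; apply/andP; split; lra.
by move=> /(sup_upper_bound hS); rewrite -/t1; lra.
Qed.

End StronglyMonotone.

(** * Resolvent equations of passive boundary nodes *)
Section BoundaryNode.
Context {R : realType} {U X : hilbertType R}.
Variables (D : set X) (G : X -> U) (L : X -> X) (K : X -> U).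
Hypothesis hnode : boundary_node D G L K.
Hypothesis hpassive : impedance_passive D G L K.

Lemma linear_on_sub (W : hilbertType R) (F : X -> W) x y :
  linear_on D F -> D x -> D y -> F (x - y) = F x - F y.
Proof.
move=> hF Dx Dy; rewrite (_ : x - y = (-1) *: y + x); last by rewrite scaleN1r addrC.
by rewrite hF// scaleN1r addrC.
Qed.

Lemma linear_on_add (W : hilbertType R) (F : X -> W) x y :
  linear_on D F -> D x -> D y -> F (x + y) = F x + F y.
Proof. by move=> hF Dx Dy; rewrite -[x in LHS]scale1r hF// scale1r. Qed.

Lemma node_domB x y : D x -> D y -> D (x - y).
Proof.
move=> Dx Dy; rewrite (_ : x - y = (-1) *: y + x); last by rewrite scaleN1r addrC.
by have [_] := bn_dom hnode; apply.
Qed.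

Lemma node_domD x y : D x -> D y -> D (x + y).
Proof. by move=> Dx Dy; rewrite -[x]scale1r; have [_] := bn_dom hnode; apply. Qed.

Lemma node_LB x y : D x -> D y -> L (x - y) = L x - L y.
Proof. exact: linear_on_sub (bn_L hnode). Qed.

Lemma node_GB x y : D x -> D y -> G (x - y) = G x - G y.
Proof. exact: linear_on_sub (bn_G hnode).1. Qed.

Lemma node_KB x y : D x -> D y -> K (x - y) = K x - K y.
Proof. exact: linear_on_sub (bn_K hnode).1. Qed.

Lemma node_bound : exists2 M : R, 0 < M & forall x, D x ->
  hnorm (G x) <= M * graph_norm L x /\ hnorm (K x) <= M * graph_norm L x.
Proof.
have [_ [MG hG]] := bn_G hnode; have [_ [MK hK]] := bn_K hnode.
have gn x : 0 <= graph_norm L x by rewrite addr_ge0 ?hnorm_ge0.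
exists (`|MG| + `|MK| + 1); first by rewrite ltr_wpDl// addr_ge0.
move=> x Dx; split.
  apply: le_trans (hG x Dx) _; rewrite ler_wpM2r//.
  by rewrite -addrA (le_trans (ler_norm _))// lerDl addr_ge0.
apply: le_trans (hK x Dx) _; rewrite ler_wpM2r//.
by rewrite (le_trans (ler_norm _))// -addrA addrCA lerDl addr_ge0.
Qed.

Lemma passive_sub x y : D x -> D y ->
  ip (L x - L y) (x - y) <= ip (G x - G y) (K x - K y).
Proof.
move=> Dx Dy; rewrite -node_LB// -node_GB// -node_KB//.
exact/hpassive/node_domB.
Qed.

Hypothesis kerG_dense : dense (ker_on D G).

(** The right inverse of [G] reduces the boundary value [v] to [0], where the
resolvent of a semigroup generator applies. *)
Lemma node_solve_G (m : R) f v : 0 < m -> exists x, [/\ D x, x - m *! L x = f & G x = v].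
Proof.
move=> m0; have [T [hT hA]] := bn_gen hnode.
have [Gr [M hGr]] := bn_right_inv hnode; have [Dr Gv _] := hGr v.
have diss x : ker_on D G x -> ip (L x) x <= 0.
  by move=> [Dx Gx]; apply: le_trans (hpassive Dx) _; rewrite Gx ip0l.
have [z [[Dz Gz] hz]] := generator_resolvent hT hA diss kerG_dense (f - (Gr v - m *! L (Gr v))) m0.
exists (Gr v + z); split; first exact: node_domD.
  rewrite (linear_on_add (bn_L hnode)) //.
  rewrite (_ : _ + _ - _ = (Gr v - m *! L (Gr v)) + (z - m *! L z)); last by vec.
  by rewrite hz addrCA subrr addr0.
by rewrite (linear_on_add (bn_G hnode).1)// Gv Gz addr0.
Qed.

(** On the eigenspace [e = m L e] the three norms of [e], [G e] and [K e] are
comparable, and passivity makes [K e] a coercive function of [G e] and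
conversely. *)
Lemma node_eigen_bounds (m : R) : 0 < m -> exists2 N : R, 0 < N & forall e, D e -> e = m *! L e ->
  [/\ N * hnorm (G e) ^+ 2 <= ip (G e) (K e), N * hnorm (K e) ^+ 2 <= ip (G e) (K e),
      N * hnorm (K e) <= hnorm (G e) & N * hnorm (G e) <= hnorm (K e)].
Proof.
move=> m0; have [M M0 hM] := node_bound.
pose Q := M * (1 + m^-1); have Q0 : 0 < Q by rewrite mulr_gt0// addr_gt0// invr_gt0.
have mQ : 0 < m * Q ^+ 2 by rewrite mulr_gt0// exprn_gt0.
exists (m * Q ^+ 2)^-1; first by rewrite invr_gt0.
move=> e De eE.
have gE : graph_norm L e = (1 + m^-1) * hnorm e.
  have -> : hnorm e = m * hnorm (L e) by rewrite {1}eE hnormZ gtr0_norm.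
  rewrite /graph_norm {1}eE hnormZ gtr0_norm// mulrDl mul1r; congr (_ + _).
  by rewrite mulrA mulVf ?mul1r// gt_eqF.
have [hG hK] := hM e De; rewrite gE mulrA -/Q in hG hK.
have he : hnorm e ^+ 2 <= m * ip (G e) (K e).
  rewrite -ipxx {1}eE ipZl ler_wpM2l ?(ltW m0)//; exact: hpassive.
have e2 : hnorm e ^+ 2 <= m * (hnorm (G e) * hnorm (K e)).
  by apply: le_trans he _; rewrite ler_wpM2l ?(ltW m0)// ip_le.
have H (z : R) : 0 <= z -> z <= Q * hnorm e -> (m * Q ^+ 2)^-1 * z ^+ 2 <= ip (G e) (K e).
  move=> z0 hz; rewrite ler_pdivrMl//.
  apply: le_trans (_ : (Q * hnorm e) ^+ 2 <= _).
    by rewrite ler_sqr// nnegrE mulr_ge0 ?hnorm_ge0// ltW.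
  rewrite exprMn (_ : m * Q ^+ 2 * _ = Q ^+ 2 * (m * ip (G e) (K e))); last by ring.
  by rewrite ler_wpM2l// sqr_ge0.
have H' (z w : R) : 0 <= z -> 0 <= w -> (m * Q ^+ 2)^-1 * z ^+ 2 <= z * w ->
    (m * Q ^+ 2)^-1 * z <= w.
  rewrite le_eqVlt => /predU1P[<-|z0] w0; first by rewrite mulr0.
  by move=> h; rewrite -(ler_pM2r z0) (mulrC w) -mulrA -expr2.
have HG := H _ (hnorm_ge0 _) hG; have HK := H _ (hnorm_ge0 _) hK.
have CS := ip_le (G e) (K e).
split=> //; apply: H'; rewrite ?hnorm_ge0//; last exact: le_trans HG CS.
by rewrite [leRHS]mulrC; exact: le_trans HK CS.
Qed.

(** With [f] fixed, [K x] is a strongly monotone Lipschitz function of the value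
prescribed for [G x], so the value of [K x] can be prescribed instead. *)
Lemma node_solve_K (m : R) f w : 0 < m -> exists x, [/\ D x, x - m *! L x = f & K x = w].
Proof.
move=> m0; have [N N0 hN] := node_eigen_bounds m0.
have [s hs] := choice (fun v => node_solve_G f v m0).
have eig u v : let e := s u - s v in
    [/\ D e, e = m *! L e, G e = u - v & K e = K (s u) - K (s v)].
  have [[Du fu Gu] [Dv fv Gv]] := (hs u, hs v).
  rewrite /= node_LB// node_GB// node_KB// Gu Gv; split=> //; first exact: node_domB.
  by apply/subr0_eq; rewrite -(subrr f) -{1}fu -fv; vec.
have [u v|u|v hv] := @strongly_monotone_surj _ _ (fun v => K (s v)) N N0 _ _ w.
- have [De eE Ge Ke] := eig u v; have [+ _ _ _] := hN _ De eE.
  by rewrite Ge Ke ipC.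
- exists 1 => //; exists N^-1; first by rewrite invr_gt0.
  move=> x y _ _; have [De eE Ge Ke] := eig x y; have [_ _ + _] := hN _ De eE.
  by rewrite Ge Ke ler_pdivlMl.
by exists (s v); have [? ? _] := hs v.
Qed.

Variable phi : U -> U.
Hypothesis hlip : locally_lipschitz phi.
Hypothesis hmono : monotone_map phi.

Definition feedback_dom : set X := [set x | D x /\ G x = phi (- K x)].

Lemma feedback_dissipative x y : feedback_dom x -> feedback_dom y ->
  ip (L x - L y) (x - y) <= 0.
Proof.
move=> [Dx Gx] [Dy Gy]; apply: le_trans (passive_sub Dx Dy) _.
have := hmono (- K y) (- K x); rewrite -Gx -Gy !ipE; lra.
Qed.

(** Prescribing [K x = - w] instead of [G x] leaves [phi w = G x], an equation in
[U] where only [phi] is nonlinear; there [- G x] is a strongly monotone function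
of [w], and adding the monotone [phi] keeps it so. *)
Lemma feedback_range (m : R) f : 0 < m -> exists2 x, feedback_dom x & x - m *! L x = f.
Proof.
move=> m0; have [N N0 hN] := node_eigen_bounds m0.
have [s hs] := choice (fun w => node_solve_K f (- w) m0).
have eig u v : let e := s u - s v in
    [/\ D e, e = m *! L e, G e = G (s u) - G (s v) & K e = - (u - v)].
  have [[Du fu Ku] [Dv fv Kv]] := (hs u, hs v).
  rewrite /= node_LB// node_GB// node_KB// Ku Kv; split=> //; first exact: node_domB.
    by apply/subr0_eq; rewrite -(subrr f) -{1}fu -fv; vec.
  by rewrite opprB opprK addrC.
have [u v|u|w hw] := @strongly_monotone_surj _ _ (fun w => phi w - G (s w)) N N0 _ _ 0.
- have [De eE Ge Ke] := eig u v; have [_ + _ _] := hN _ De eE.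
  have := hmono v u; rewrite Ge Ke hnorm_oppr !ipE; lra.
- have [r r0 [l l0 hl]] := locally_lipschitz_ball hlip u.
  exists r => //; exists (l + N^-1); first by rewrite addr_gt0// invr_gt0.
  move=> x y xr yr; have [De eE Ge Ke] := eig x y; have [_ _ _] := hN _ De eE.
  rewrite Ge Ke hnorm_oppr -ler_pdivlMl// => h.
  rewrite (_ : phi x - _ - _ = (phi x - phi y) - (G (s x) - G (s y))); last by vec.
  by apply: le_trans (hnorm_subr _ _) _; have := hl x y xr yr; lra.
exists (s w); have [Dw fw Kw] := hs w => //.
by split=> //; rewrite Kw opprK; apply/esym/subr0_eq.
Qed.

End BoundaryNode.

(** * Yosida approximations of dissipative operators *)
Section Maximal.
Context {R : realType} {X : hilbertType R}.

Definition dissipative (D : set X) (B : X -> X) :=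
  forall x y, D x -> D y -> ip (B x - B y) (x - y) <= 0.

Definition resolvent_total (D : set X) (B : X -> X) :=
  forall (h : R) f, 0 < h -> exists2 x, D x & x - h *! B x = f.

Definition resolvent_of (D : set X) (B : X -> X) (J : R -> X -> X) :=
  forall (h : R) f, 0 < h -> D (J h f) /\ J h f - h *! B (J h f) = f.

Lemma resolvent_exists D B : resolvent_total D B -> exists J, resolvent_of D B J.
Proof.
move=> hr.
have ex (p : R * X) : exists x, 0 < p.1 -> D x /\ x - p.1 *! B x = p.2.
  case: p => h f /=; have [h0|/negP hn] := boolP (0 < h); last by exists 0.
  by have [x Dx xf] := hr h f h0; exists x.
have [j hj] := choice ex; exists (fun h f => j (h, f)) => h f h0.
exact: (hj (h, f)).
Qed.

Lemma dissipative_resolvent_lip D B (h : R) x y : dissipative D B -> 0 < h ->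
  D x -> D y -> hnorm (x - y) <= hnorm ((x - h *! B x) - (y - h *! B y)).
Proof.
move=> hB h0 Dx Dy; have := hB x y Dx Dy; rewrite -(pmulr_rle0 _ h0) => d.
rewrite (_ : _ - _ - _ = (x - y) - h *! (B x - B y)); last by vec.
rewrite -ler_sqr ?nnegrE ?hnorm_ge0// [leRHS]hnormB_sq ipZr ipC.
have := sqr_ge0 (hnorm (h *! (B x - B y))); lra.
Qed.

Section Yosida.
Variables (D : set X) (B : X -> X) (J : R -> X -> X).
Hypothesis hB : dissipative D B.
Hypothesis hJ : resolvent_of D B J.

Lemma resolvent_lip (h : R) x y : 0 < h -> hnorm (J h x - J h y) <= hnorm (x - y).
Proof.
move=> h0; have [[Dx Ex] [Dy Ey]] := (hJ x h0, hJ y h0).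
by have := dissipative_resolvent_lip hB h0 Dx Dy; rewrite Ex Ey.
Qed.

Lemma resolvent_incr (h : R) x : 0 < h -> J h x - x = h *! B (J h x).
Proof. by move=> h0; have [_ {2}<-] := hJ x h0; vec. Qed.

Lemma resolvent_id (h : R) x : 0 < h -> D x -> J h (x - h *! B x) = x.
Proof.
move=> h0 Dx; apply/subr0_eq/hnorm_eq0/le_anti; rewrite hnorm_ge0 andbT.
have [Dz Ez] := hJ (x - h *! B x) h0.
by have := dissipative_resolvent_lip hB h0 Dz Dx; rewrite Ez subrr hnorm0.
Qed.

Lemma yosida_le (h : R) x : 0 < h -> D x -> hnorm (B (J h x)) <= hnorm (B x).
Proof.
move=> h0 Dx; rewrite -(ler_pM2l h0) -{1 3}(gtr0_norm h0) -!hnormZ -resolvent_incr//.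
have := resolvent_lip x (x - h *! B x) h0; rewrite resolvent_id//.
by rewrite (_ : x - (x - _) = h *! B x)//; vec.
Qed.

(** The limit [x] and the point [J 1 (x - v)] of the domain coincide, because
[u n = J 1 (u n - B (u n))] and [J 1] is continuous. *)
Lemma dissipative_closed (u : nat -> X) x v : (forall n, D (u n)) ->
  u n @[n --> \oo] --> x -> B (u n) @[n --> \oo] --> v -> D x /\ B x = v.
Proof.
move=> Du ux Bv; have [Dj Ej] := hJ (x - 1 *! v) ltr01.
suff jx : J 1 (x - 1 *! v) = x.
  by rewrite jx in Dj Ej; split=> //; apply: ip_ext => w; have := congr1 (fun y => ip y w) Ej; rewrite !ipE; lra.
apply/esym/subr0_eq/hnorm_eq0/le_anti; rewrite hnorm_ge0 andbT.
apply: (@le_of_eps _ _ _ 3) => // e e0 _; rewrite add0r.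
have [N1 _ hN1] := (hnorm_cvgP _ _).1 ux _ e0.
have [N2 _ hN2] := (hnorm_cvgP _ _).1 Bv _ e0.
pose n := maxn N1 N2.
have {hN1} /= h1 := hN1 n (leq_maxl _ _); have {hN2} /= h2 := hN2 n (leq_maxr _ _).
apply: le_trans (hnorm_triangle (u n) _ _) _; rewrite hnormBC.
rewrite -{2}(resolvent_id ltr01 (Du n)).
have := resolvent_lip (u n - 1 *! B (u n)) (x - 1 *! v) ltr01.
rewrite (_ : _ - _ - (x - _) = (u n - x) - (B (u n) - v)); last by vec.
have := hnorm_subr (u n - x) (B (u n) - v); lra.
Qed.

(** The increments [h B (J h x)] of two resolvents at the same point, tested with
dissipativity, show that [B (J k x)] and [B (J h x) - B (J k x)] have a
nonnegative inner product. *)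
Lemma yosida_mono (h k : R) x : 0 < h -> h < k ->
  hnorm (B (J h x) - B (J k x)) ^+ 2 <= hnorm (B (J h x)) ^+ 2 - hnorm (B (J k x)) ^+ 2.
Proof.
move=> h0 hk; have k0 := lt_trans h0 hk.
have [[Dh _] [Dk _]] := (hJ x h0, hJ x k0).
have := hB Dh Dk; have := resolvent_incr x h0; have := resolvent_incr x k0.
set a := B (J h x); set b := B (J k x) => ek eh.
have -> : J h x - J k x = h *! (a - b) - (k - h) *! b.
  rewrite (_ : J h x - J k x = (J h x - x) - (J k x - x)); last by vec.
  by rewrite eh ek; vec.
rewrite ipDr ipNr !ipZr ipxx => d.
have p : 0 <= ip (a - b) b.
  rewrite -(pmulr_rge0 _ (_ : 0 < k - h)) ?subr_gt0//.
  have : 0 <= h * hnorm (a - b) ^+ 2 by rewrite mulr_ge0 ?sqr_ge0// ltW.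
  by move: d; lra.
have -> : hnorm a ^+ 2 = hnorm (a - b) ^+ 2 + 2 * ip (a - b) b + hnorm b ^+ 2.
  by rewrite -hnormD_sq subrK.
lra.
Qed.

(** A bound on the Yosida approximations makes them converge strongly, because
their norms increase as the parameter decreases. *)
Lemma yosida_cvg x (M : R) : (forall h, 0 < h -> hnorm (J h x - x) <= h * M) ->
  [/\ D x, hnorm (B x) <= M & B (J n.+1%:R^-1 x) @[n --> \oo] --> B x].
Proof.
move=> hM; pose h n : R := n.+1%:R^-1; have h0 n : 0 < h n by rewrite invr_gt0.
pose b n := B (J (h n) x).
have bM n : hnorm (b n) <= M.
  by rewrite -(ler_pM2l (h0 n)) -{1}(gtr0_norm (h0 n)) -hnormZ -resolvent_incr ?hM.
have M0 : 0 <= M by apply: le_trans (bM 0%N); exact: hnorm_ge0.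
have hlt n m : (n < m)%N -> h m < h n by move=> nm; rewrite ltf_pV2 ?posrE// ltr_nat ltnS.
have bb n m : (n <= m)%N -> hnorm (b m - b n) ^+ 2 <= hnorm (b m) ^+ 2 - hnorm (b n) ^+ 2.
  rewrite leq_eqVlt => /predU1P[->|nm]; last exact: yosida_mono (h0 _) (hlt _ _ nm).
  by rewrite !subrr hnorm0 expr0n.
pose S := [set hnorm (b n) ^+ 2 | n in [set: nat]].
have hS : has_sup S.
  split; first by exists (hnorm (b 0%N) ^+ 2), 0%N.
  by exists (M ^+ 2) => _ [n _ <-]; rewrite ler_sqr ?nnegrE ?hnorm_ge0.
have [v hv] : exists v : X, b n @[n --> \oo] --> v.
  apply: hilbert_complete => e e0.
  have e2 : 0 < (e / 2) ^+ 2 by rewrite exprn_gt0// divr_gt0.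
  have [_ [N _ <-] hN] := sup_adherent e2 hS.
  have near n : (N <= n)%N -> hnorm (b n - b N) < e / 2.
    move=> Nn; rewrite -ltr_sqr ?nnegrE ?hnorm_ge0 ?divr_ge0 ?(ltW e0)//.
    apply: le_lt_trans (bb _ _ Nn) _.
    have : hnorm (b n) ^+ 2 <= sup S by apply: (sup_upper_bound hS); exists n.
    lra.
  exists N => n m hn hm; apply: le_lt_trans (hnorm_triangle (b N) _ _) _.
  by rewrite (hnormBC (b N)) [ltRHS]splitr ltrD// near.
have Jx : J (h n) x @[n --> \oo] --> x.
  apply/hnorm_cvgP => e e0.
  have e1 : 0 < e / (M + 1) by rewrite divr_gt0// ltr_wpDl.
  have [N hN] := inv_succ_small e1; exists N => // n /= Nn.
  apply: le_lt_trans (hM _ (h0 n)) _.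
  apply: le_lt_trans (_ : h n * (M + 1) < _).
    by rewrite ler_wpM2l ?(ltW (h0 n))// lerDl.
  by rewrite -ltr_pdivlMr ?hN// ltr_wpDl.
have [Dx Bx] := dissipative_closed (fun n => (hJ x (h0 n)).1) Jx hv.
split=> //; last by rewrite Bx.
rewrite Bx; apply/ler_addgt0Pr => e e0.
have [N _ hN] := (hnorm_cvgP _ _).1 hv _ e0.
have := hN N (leqnn _); have := hnorm_triangle (b N) v 0; rewrite !subr0 hnormBC /=.
by have := bM N; lra.
Qed.

Lemma yosida_cvg_dom x : D x -> B (J n.+1%:R^-1 x) @[n --> \oo] --> B x.
Proof.
move=> Dx; have [|//] := @yosida_cvg x (hnorm (B x)).
move=> h h0; rewrite resolvent_incr// hnormZ gtr0_norm//.
by rewrite ler_wpM2l ?(ltW h0)// yosida_le.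
Qed.

(** The bound on [B (u n)] becomes a bound on the Yosida approximations at [x], so
that [yosida_cvg] puts [x] in the domain. *)
Lemma dissipative_demiclosed (u : nat -> X) x (M : R) : (forall n, D (u n)) ->
  (forall n, hnorm (B (u n)) <= M) -> u n @[n --> \oo] --> x ->
  D x /\ hnorm (B x) <= M.
Proof.
move=> Du BM ux; have [|//] := @yosida_cvg x M.
move=> h h0; apply: (@le_of_eps _ _ _ 2) => // e e0 _.
have [N _ hN] := (hnorm_cvgP _ _).1 ux _ e0; have /= {}hN := hN N (leqnn _).
apply: le_trans (hnorm_triangle (J h (u N)) _ _) _.
have := resolvent_lip x (u N) h0; rewrite (hnormBC x).
have := hnorm_triangle (u N) (J h (u N)) x.
have : hnorm (J h (u N) - u N) <= h * M.
  rewrite resolvent_incr// hnormZ gtr0_norm// ler_wpM2l ?(ltW h0)//.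
  exact: le_trans (yosida_le h0 (Du N)) (BM N).
lra.
Qed.

End Yosida.

End Maximal.

(** * Implicit Euler evolutions of dissipative operators *)
Section WeakContinuity.
Context {R : realType} {X : hilbertType R}.
Variables (D : set X) (B : X -> X).
Hypothesis hB : dissipative D B.
Hypothesis hR : resolvent_total D B.

(** Minty's trick, tested at the resolvents of the perturbed operator
[B + (w - B x)], whose Yosida approximations at [x] converge to [w]. *)
Lemma weak_lower_continuity x (M e : R) w : D x -> 0 <= M -> 0 < e ->
  exists2 d : R, 0 < d & forall y, D y -> hnorm (B y) <= M -> hnorm (y - x) < d ->
    ip (B x) w - e <= ip (B y) w.
Proof.
move=> Dx M0 e0; pose w' := w - B x; pose B' z := B z + w'.
have hB' : dissipative D B'.
  by move=> y z Dy Dz; rewrite (_ : B' y - B' z = B y - B z) ?hB// /B'; vec.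
have [|J hJ] := @resolvent_exists _ _ D B'.
  move=> h f h0; have [y Dy yf] := hR (f + h *! w') h0.
  exists y => //; rewrite (_ : y - _ = (y - h *! B y) - h *! w'); last by rewrite /B'; vec.
  by rewrite yf addrK.
have Bx : B' x = w by rewrite /B' /w'; vec.
have := yosida_cvg_dom hB' hJ Dx; rewrite Bx => /hnorm_cvgP hcv.
pose C := hnorm (B x) + hnorm w + M + 1.
have C0 : 0 < C by rewrite ltr_wpDl// !addr_ge0 ?hnorm_ge0.
have r0 : 0 < e / 2 / C by rewrite !divr_gt0.
have [j _ hj] := hcv _ r0; have {hj} := hj j (leqnn _).
have h0 : 0 < j.+1%:R^-1 :> R by rewrite invr_gt0.
have [Dy _] := hJ _ x h0; have yE := resolvent_incr hJ x h0.
set h := j.+1%:R^-1 in h0 Dy yE *; set y1 := J h x in Dy yE *; set p := B' y1 in yE * => /= pw.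
pose Q := M + hnorm (B y1) + 1.
have Q0 : 0 < Q by rewrite ltr_wpDl// !addr_ge0 ?hnorm_ge0.
exists (e / 2 * h / Q); first by rewrite !divr_gt0// mulr_gt0// divr_gt0.
move=> y Dy' By yx.
have h1 : ip (B y1) p - e / 2 <= ip (B y) p.
  have := hB Dy' Dy; rewrite (_ : y - y1 = (y - x) - h *! p); last by rewrite -yE; vec.
  rewrite ipDr ipNr ipZr => d.
  have := ip_ge (B y - B y1) (y - x).
  have : hnorm (B y - B y1) * hnorm (y - x) <= Q * (e / 2 * h / Q).
    apply: ler_pM; rewrite ?hnorm_ge0 ?(ltW yx)//.
    by apply: le_trans (hnorm_subr _ _) _; rewrite /Q; lra.
  have -> : Q * (e / 2 * h / Q) = e / 2 * h by rewrite mulrC divfK ?gt_eqF.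
  move=> b1 b2.
  have : h * (ip (B y1) p - e / 2) <= h * ip (B y) p.
    have E : ip (B y - B y1) p = ip (B y) p - ip (B y1) p by rewrite ipDl ipNl.
    by move: d; rewrite E; lra.
  by rewrite ler_pM2l.
have h2 : ip (B x) w - e / 2 / C * (hnorm (B x) + hnorm w) <= ip (B y1) p.
  have E : B y1 = B x + (p - w) by rewrite /p /B' /w'; vec.
  have -> : ip (B y1) p = ip (B x) w + ip (B x) (p - w) + (ip (p - w) w + hnorm (p - w) ^+ 2).
    by rewrite -ipxx -ipDr -(addrC (p - w)) subrK -ipDr -(addrC (p - w)) subrK E ipDl.
  have := ip_ge (B x) (p - w); have := ip_ge (p - w) w; have := sqr_ge0 (hnorm (p - w)).
  have : hnorm (B x) * hnorm (p - w) <= hnorm (B x) * (e / 2 / C) by rewrite ler_wpM2l ?hnorm_ge0// ltW.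
  have : hnorm (p - w) * hnorm w <= (e / 2 / C) * hnorm w by rewrite ler_wpM2r ?hnorm_ge0// ltW.
  lra.
have h3 : ip (B y) p - M * (e / 2 / C) <= ip (B y) w.
  have -> : ip (B y) w = ip (B y) p - ip (B y) (p - w) by rewrite ipDr ipNr; ring.
  have := ip_le (B y) (p - w).
  have : hnorm (B y) * hnorm (p - w) <= M * (e / 2 / C).
    by apply: ler_pM; rewrite ?hnorm_ge0// ltW.
  lra.
have : e / 2 / C * C = e / 2 by rewrite divfK// gt_eqF.
rewrite {2}/C; have : 0 < e / 2 / C by []; lra.
Qed.

Lemma weak_continuity x (M e : R) w : D x -> 0 <= M -> 0 < e ->
  exists2 d : R, 0 < d & forall y, D y -> hnorm (B y) <= M -> hnorm (y - x) < d ->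
    `|ip (B y - B x) w| <= e.
Proof.
move=> Dx M0 e0.
have [d d0 hd] := weak_lower_continuity w Dx M0 e0.
have [d' d0' hd'] := weak_lower_continuity (- w) Dx M0 e0.
exists (Num.min d d'); first by rewrite lt_min d0.
move=> y Dy By; rewrite lt_min => /andP[y1 y2].
have := hd y Dy By y1; have := hd' y Dy By y2.
rewrite !ipE ler_norml => a b; apply/andP; split; lra.
Qed.

End WeakContinuity.

Section ImplicitEuler.
Context {R : realType} {X : hilbertType R}.
Variables (D : set X) (B : X -> X) (J : R -> X -> X).
Hypothesis hB : dissipative D B.
Hypothesis hJ : resolvent_of D B J.
Variables (z : X) (M : R).
Hypothesis Dz : D z.
Hypothesis zM : hnorm (B z) <= M.

Let M0 : 0 <= M. Proof. exact: le_trans (hnorm_ge0 _) zM. Qed.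

Definition euler (h : R) n := iter n (J h) z.

Lemma euler_dom (h : R) n : 0 < h -> D (euler h n) /\ hnorm (B (euler h n)) <= M.
Proof.
move=> h0; elim: n => [//|n [Dn Bn]]; split; first by have [] := hJ (euler h n) h0.
exact: le_trans (yosida_le hB hJ h0 Dn) Bn.
Qed.

Lemma euler_incr (h : R) n : 0 < h -> euler h n.+1 - euler h n = h *! B (euler h n.+1).
Proof. by move=> h0; exact: (resolvent_incr hJ). Qed.

(** An Euler segment is a sum of terms [h B (euler h j)], so it inherits any weak
estimate of these values. *)
Lemma euler_segment (h e : R) i k v w : 0 < h ->
  (forall j, (i < j <= i + k)%N -> `|ip (B (euler h j) - v) w| <= e) ->
  `|ip (euler h (i + k)%N - euler h i - (k%:R * h) *! v) w| <= k%:R * h * e.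
Proof.
move=> h0; elim: k => [|k ih] hj.
  by rewrite !mul0r addn0 subrr scale0r subrr ip0l normr0.
rewrite addnS (_ : _ - _ = (euler h (i + k)%N - euler h i - (k%:R * h) *! v) +
   h *! (B (euler h (i + k).+1) - v)); last first.
  by rewrite scalerBr -euler_incr// -natr1; vec.
rewrite ipDl ipZl; apply: le_trans (ler_normD _ _) _.
have a : `|ip (euler h (i + k)%N - euler h i - (k%:R * h) *! v) w| <= k%:R * h * e.
  by apply: ih => j /andP[ij jk]; apply: hj; rewrite ij addnS leqW.
rewrite normrM gtr0_norm//.
have : h * `|ip (B (euler h (i + k).+1) - v) w| <= h * e.
  by rewrite ler_wpM2l ?(ltW h0)// hj// addnS ltnS leq_addr leqnn.
rewrite -natr1; lra.
Qed.

Lemma euler_lip (h : R) i j : 0 < h ->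
  hnorm (euler h j - euler h i) <= `|j%:R - i%:R| * h * M.
Proof.
move=> h0; wlog ij : i j / (i <= j)%N.
  move=> H; have [/H//|/ltnW/H] := leqP i j.
  by rewrite hnormBC distrC.
rewrite ger0_norm ?subr_ge0 ?ler_nat// -(subnKC ij) natrD addrAC subrr add0r.
elim: (j - i)%N => [|k ih]; first by rewrite addn0 subrr hnorm0 !mul0r.
rewrite addnS; apply: le_trans (hnorm_triangle (euler h (i + k)) _ _) _.
rewrite euler_incr// hnormZ gtr0_norm//.
have := ler_wpM2l (ltW h0) (euler_dom (i + k).+1 h0).2.
rewrite -natr1; lra.
Qed.

(** One step of size [h] against [N + 1] steps of size [k = h / (N + 1)]. Each fine
increment is compared with its share of the coarse one at the point it leads
to, where dissipativity gives the first-order term a sign; the two fine points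
involved are at distance at most [h M], which leaves an error of order
[h^2]. *)
Lemma euler_refine_step (h k : R) N i j : 0 < h -> k = h / N.+1%:R ->
  hnorm (euler h i.+1 - euler k (j + N.+1)%N) ^+ 2 <=
  hnorm (euler h i - euler k j) ^+ 2 + 4 * (h ^+ 2 * M ^+ 2).
Proof.
move=> h0 kE; have k0 : 0 < k by rewrite kE divr_gt0.
have kN : N.+1%:R * k = h by rewrite kE mulrC divfK// pnatr_eq0.
set a := euler h i.+1; set a' := euler h i; set b := euler k.
set e := a - b _.
have [Da Ba] := euler_dom i.+1 h0; have Db n := euler_dom n k0.
have step m : (m <= N.+1)%N ->
    ip ((m%:R * k) *! B a - (b (j + m)%N - b j)) e <= m%:R * k * (2 * h * M ^+ 2).
  elim: m => [|m ih] mN; first by rewrite addn0 subrr !mul0r scale0r subrr ip0l.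
  rewrite addnS (_ : _ - _ = ((m%:R * k) *! B a - (b (j + m)%N - b j)) +
      k *! (B a - B (b (j + m).+1))); last first.
    by rewrite scalerBr -[k *! B (b _)]euler_incr// -natr1; vec.
  rewrite ipDl ipZl -natr1.
  have h1 : ip (B a - B (b (j + m).+1)) e <= 2 * h * M ^+ 2.
    rewrite (_ : e = (a - b (j + m).+1) + (b (j + m).+1 - b (j + N.+1)%N)); last by rewrite /e; vec.
    rewrite ipDr; have := hB Da (Db (j + m).+1).1.
    have := ip_le (B a - B (b (j + m).+1)) (b (j + m).+1 - b (j + N.+1)%N).
    have : hnorm (B a - B (b (j + m).+1)) * hnorm (b (j + m).+1 - b (j + N.+1)%N) <= (2 * M) * (h * M).
      apply: ler_pM; rewrite ?hnorm_ge0//.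
        apply: le_trans (hnorm_subr _ _) _; have := (Db (j + m).+1).2; rewrite -/b; lra.
      apply: le_trans (euler_lip _ _ k0) _; rewrite ler_wpM2r// -kN ler_wpM2r ?(ltW k0)//.
      rewrite distrC ger0_norm ?subr_ge0 ?ler_nat ?ltn_add2l// -natrB ?ltn_add2l//.
      by rewrite ler_nat -addnS subnDl leq_subr.
    by rewrite -/a; lra.
  have := ler_wpM2l (ltW k0) h1; have := ih (ltnW mN); lra.
have := step _ (leqnn _); rewrite kN -euler_incr// -/a -/a' => h1.
set e' := a' - b j.
have : hnorm e' ^+ 2 = hnorm e ^+ 2 - 2 * ip (a - a' - (b (j + N.+1)%N - b j)) e
    + hnorm (a - a' - (b (j + N.+1)%N - b j)) ^+ 2.
  by rewrite ipC -hnormB_sq /e' /e; congr (hnorm _ ^+ 2); vec.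
have := sqr_ge0 (hnorm (a - a' - (b (j + N.+1)%N - b j))); rewrite -/e; lra.
Qed.

Lemma euler_refine (h k : R) N i : 0 < h -> k = h / N.+1%:R ->
  hnorm (euler h i - euler k (i * N.+1)%N) ^+ 2 <= i%:R * (4 * (h ^+ 2 * M ^+ 2)).
Proof.
move=> h0 kE; elim: i => [|i ih]; first by rewrite mul0n /euler /= subrr hnorm0 expr0n mul0r.
rewrite mulSn addnC; apply: le_trans (euler_refine_step _ _ h0 kE) _.
by rewrite -natr1; lra.
Qed.

Lemma euler_segment_abs (h e : R) i j v w : 0 < h ->
  (forall l, (minn i j <= l <= maxn i j)%N -> `|ip (B (euler h l) - v) w| <= e) ->
  `|ip (euler h j - euler h i - ((j%:R - i%:R) * h) *! v) w| <= `|j%:R - i%:R| * h * e.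
Proof.
move=> h0; wlog ij : i j / (i <= j)%N.
  move=> H; case: (orP (leq_total i j)) => [/H//|ji] hl.
  have := H _ _ ji; rewrite minnC maxnC => /(_ hl); rewrite distrC.
  congr (_ <= _); rewrite -normrN; congr (`| _ |); rewrite !ipE; ring.
rewrite (minn_idPl ij) (maxn_idPr ij) => hl.
have -> : `|j%:R - i%:R| = (j - i)%:R :> R by rewrite -natrB// ger0_norm.
rewrite -natrB// -{1}(subnKC ij).
by apply: euler_segment => // l /andP[il lj]; rewrite hl// (ltnW il) -(subnKC ij).
Qed.

Let h n : R := 2^-1 ^+ n.
Let idx n (t : R) := Num.truncn (t * 2 ^+ n).

Let h_gt0 n : 0 < h n. Proof. by rewrite exprn_gt0// invr_gt0. Qed.

Let idx_itv n t : 0 <= t -> (idx n t)%:R * h n <= t < (idx n t)%:R * h n + h n.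
Proof.
move=> t0; have tn : 0 <= t * 2 ^+ n by rewrite mulr_ge0// exprn_ge0.
have := truncn_itv tn; rewrite -/(idx n t) => /andP[a b].
have hE : h n = (2 ^+ n)^-1 by rewrite /h exprVn.
rewrite hE; apply/andP; split; first by rewrite ler_pdivrMr// exprn_gt0.
by rewrite -[X in _ + X]mul1r -mulrDl natr1 ltr_pdivlMr// exprn_gt0.
Qed.

(** Dyadic steps are used because each of them refines all the earlier ones, as
[euler_refine] requires. *)
Let euler_cauchy t (e : R) : 0 <= t -> 0 < e -> exists N, forall n m, (N <= n)%N -> (N <= m)%N ->
  hnorm (euler (h n) (idx n t) - euler (h m) (idx m t)) < e.
Proof.
move=> t0 e0.
have M1 : 0 < M + 1 by rewrite ltr_wpDl.
have T1 : 0 < 4 * t * M ^+ 2 + 1 by rewrite ltr_wpDl// !mulr_ge0// sqr_ge0.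
pose q := Num.min (e / 4 / (M + 1)) ((e / 4) ^+ 2 / (4 * t * M ^+ 2 + 1)).
have q0 : 0 < q by rewrite lt_min !divr_gt0// exprn_gt0// divr_gt0.
have [|N hN] := @exp_small R 2^-1 q _ q0.
  by rewrite invr_ge0 ler0n invf_lt1// ltr1n.
have := hN N (leqnn _); rewrite -/(h N) lt_min !ltr_pdivlMr// => /andP[hM1 hM2].
exists N; suff H m : (N <= m)%N -> hnorm (euler (h N) (idx N t) - euler (h m) (idx m t)) < e / 2.
  move=> n m hn hm; apply: le_lt_trans (hnorm_triangle (euler (h N) (idx N t)) _ _) _.
  by rewrite hnormBC [ltRHS]splitr ltrD// H.
move=> Nm; pose k := (2 ^ (m - N))%N.
have k0 : (0 < k)%N by rewrite expn_gt0.
have kh : k%:R * h m = h N.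
  have -> : h m = h N * h (m - N)%N by rewrite /h -exprD subnKC.
  rewrite mulrCA /k natrX /h [2^-1 ^+ (m - N)]exprVn divff ?mulr1//.
have hm : h m = h N / k.-1.+1%:R.
  by rewrite prednK// -kh mulrC mulKf// pnatr_eq0 -lt0n.
have := euler_refine (idx N t) (h_gt0 N) hm; rewrite prednK// => h1.
apply: le_lt_trans (hnorm_triangle (euler (h m) (idx N t * k)%N) _ _) _.
have h2 : hnorm (euler (h N) (idx N t) - euler (h m) (idx N t * k)%N) < e / 4.
  rewrite -ltr_sqr ?nnegrE ?hnorm_ge0 ?divr_ge0 ?(ltW e0)//.
  apply: le_lt_trans h1 _; apply: le_lt_trans hM2.
  rewrite (_ : _%:R * _ = ((idx N t)%:R * h N) * (4 * h N * M ^+ 2)); last by ring.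
  have /andP[a _] := idx_itv N t0.
  apply: le_trans (_ : t * (4 * h N * M ^+ 2) <= _).
    by rewrite ler_wpM2r// !mulr_ge0 ?sqr_ge0// ltW.
  by have := h_gt0 N; lra.
have h3 : hnorm (euler (h m) (idx N t * k)%N - euler (h m) (idx m t)) < e / 4.
  apply: le_lt_trans (euler_lip _ _ (h_gt0 m)) _; apply: le_lt_trans (_ : h N * M < _); last first.
    by have := h_gt0 N; lra.
  rewrite ler_wpM2r// -{1}(gtr0_norm (h_gt0 m)) -normrM mulrBl natrM -mulrA kh.
  have /andP[a b] := idx_itv N t0; have /andP[c d] := idx_itv m t0.
  have hmN : h m <= h N by rewrite /h ler_wiXn2l// ?invr_ge0// invf_le1// ler1n.
  by rewrite ler_norml; apply/andP; split; lra.
by rewrite (_ : e / 2 = e / 4 + e / 4); [exact: ltrD|field].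
Qed.

Hypothesis hR : resolvent_total D B.

(** The limit of the Euler schemes. Difference quotients of the scheme are
averages of [B] at nearby points of bounded [B], where [B] is weakly close to its
value at the limit; hence the limit is weakly continuously differentiable with
derivative [B x], one-sided at time [0]. *)
Lemma dissipative_evolution : exists x : R -> X, [/\ x 0 = z,
  forall s t : R, 0 <= s -> 0 <= t -> hnorm (x t - x s) <= `|t - s| * M,
  forall t : R, 0 <= t -> D (x t) /\ hnorm (B (x t)) <= M &
  forall (t : R) w (e : R), 0 <= t -> 0 < e -> exists2 d : R, 0 < d &
    forall s : R, 0 <= s -> `|s - t| < d -> `|ip (B (x s) - B (x t)) w| <= e /\
      `|ip (x s - x t - (s - t) *! B (x t)) w| <= e * `|s - t|].
Proof.
pose xn n t := euler (h n) (idx n t).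
have ex (t : R) : exists l : X, 0 <= t -> xn n t @[n --> \oo] --> l.
  have [t0|/negP t0] := boolP (0 <= t); last by exists 0.
  by have [l hl] := hilbert_complete (fun e => euler_cauchy t0 (e:=e)); exists l.
have [x hx] := choice ex.
have ev t (e : R) : 0 <= t -> 0 < e -> exists N, forall n, (N <= n)%N -> hnorm (xn n t - x t) < e.
  move=> t0 e0; have [N _ hN] := (hnorm_cvgP _ _).1 (hx t t0) _ e0.
  by exists N => n /hN.
have evh (e : R) : 0 < e -> exists N, forall n, (N <= n)%N -> h n < e.
  by move=> e0; apply: exp_small => //; rewrite invr_ge0 ler0n invf_lt1// ltr1n.
have idist n s t : 0 <= s -> 0 <= t -> `|((idx n t)%:R - (idx n s)%:R) * h n - (t - s)| <= h n.
  move=> s0 t0; have /andP[a b] := idx_itv n t0; have /andP[c d] := idx_itv n s0.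
  by rewrite ler_norml; apply/andP; split; lra.
have idist2 n s t : 0 <= s -> 0 <= t -> `|(idx n t)%:R - (idx n s)%:R| * h n <= `|t - s| + h n.
  move=> s0 t0; rewrite -{1}(gtr0_norm (h_gt0 n)) -normrM.
  by have := ler_distD (t - s) (((idx n t)%:R - (idx n s)%:R) * h n) 0; have := idist n s t s0 t0; rewrite !subr0; lra.
have xlip s t : 0 <= s -> 0 <= t -> hnorm (x t - x s) <= `|t - s| * M.
  move=> s0 t0; apply: (@le_of_eps _ _ _ (2 + M)); first by rewrite addr_ge0.
  move=> e e0 _.
  have [N1 /(_ _ (leq_trans (leq_maxl _ _) (leq_maxl _ _))) h1] := ev s e s0 e0.
  have [N2 /(_ _ (leq_trans (leq_maxr _ _) (leq_maxl _ _))) h2] := ev t e t0 e0.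
  have [N3 /(_ _ (leq_maxr _ _)) h3] := evh e e0.
  have := h1 N2 N3; have := h2 N1 N3; have := h3 (maxn N1 N2).
  set n := maxn _ _ => {}h3 {}h2 {}h1.
  apply: le_trans (hnorm_triangle (xn n t) _ _) _; rewrite (hnormBC (x t)).
  have := hnorm_triangle (xn n s) (xn n t) (x s).
  have := euler_lip (idx n s) (idx n t) (h_gt0 n); rewrite -/(xn n t) -/(xn n s).
  have := ler_wpM2r M0 (idist2 n s t s0 t0).
  have := ler_wpM2r M0 (ltW h3); lra.
have xdom t : 0 <= t -> D (x t) /\ hnorm (B (x t)) <= M.
  move=> t0; apply: (dissipative_demiclosed hB hJ) (hx t t0).
    by move=> n; have [] := euler_dom (idx n t) (h_gt0 n).
  by move=> n; have [] := euler_dom (idx n t) (h_gt0 n).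
exists x; split=> //.
  apply/subr0_eq/hnorm_eq0/le_anti; rewrite hnorm_ge0 andbT.
  apply/ler_addgt0Pr => e e0; rewrite add0r; have [N /(_ _ (leqnn _))] := ev 0 e (lexx _) e0.
  by rewrite /xn /idx mul0r truncn0 /euler /= hnormBC => /ltW.
move=> t w e t0 e0; have [Dt Bt] := xdom t t0.
have [d d0 hd] := weak_continuity hB hR w Dt M0 e0.
have M1 : 0 < M + 1 by rewrite ltr_wpDl.
exists (d / 2 / (M + 1)); first by rewrite !divr_gt0.
move=> s s0; rewrite ltr_pdivlMr// => st; have [Ds Bs] := xdom s s0.
split.
  apply: hd => //; apply: le_lt_trans (xlip _ _ t0 s0) _.
  by have := normr_ge0 (s - t); lra.
set v := B (x t).
apply: (@le_of_eps _ _ _ (e + 2 * hnorm w + `|ip v w|)).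
  by rewrite !addr_ge0 ?mulr_ge0 ?hnorm_ge0 ?(ltW e0).
move=> g g0 _; pose f := Num.min g (d / 2 / (M + 1)).
have f0 : 0 < f by rewrite lt_min g0 !divr_gt0.
have [N1 /(_ _ (leq_trans (leq_maxl _ _) (leq_maxl _ _))) h1] := ev s f s0 f0.
have [N2 /(_ _ (leq_trans (leq_maxr _ _) (leq_maxl _ _))) h2] := ev t f t0 f0.
have [N3 /(_ _ (leq_maxr _ _)) h3] := evh f f0.
have := h1 N2 N3; have := h2 N1 N3; have := h3 (maxn N1 N2).
set n := maxn _ _ => {}h3 {}h2 {}h1.
have fg : f <= g by rewrite ge_min lexx.
have fd : f * (M + 1) <= d / 2 by rewrite -ler_pdivlMr// ge_min lexx orbT.
have seg : `|ip (xn n s - xn n t - (((idx n s)%:R - (idx n t)%:R) * h n) *! v) w| <=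
    `|(idx n s)%:R - (idx n t)%:R| * h n * e.
  apply: euler_segment_abs => // l hl.
  have [Dl Bl] := euler_dom l (h_gt0 n); apply: hd => //.
  apply: le_lt_trans (hnorm_triangle (xn n t) _ _) _.
  have lt : `|l%:R - (idx n t)%:R| <= `|(idx n s)%:R - (idx n t)%:R| :> R.
    have [st'|ts'] := leqP (idx n t) (idx n s).
      move: hl; rewrite (minn_idPl st') (maxn_idPr st') => /andP[a b].
      by rewrite !ger0_norm ?subr_ge0 ?ler_nat// lerD2r ler_nat.
    move: hl; rewrite (minn_idPr (ltnW ts')) (maxn_idPl (ltnW ts')) => /andP[a b].
    by rewrite !(distrC _ (idx n t)%:R) !ger0_norm ?subr_ge0 ?ler_nat ?(ltnW ts')// lerD2l lerN2 ler_nat.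
  have a1 := euler_lip (idx n t) l (h_gt0 n); rewrite -/(xn n t) in a1.
  have a2 := ler_wpM2r M0 (le_trans (ler_wpM2r (ltW (h_gt0 n)) lt) (idist2 n t s t0 s0)).
  have a3 := ler_wpM2r M0 (ltW h3).
  by have := normr_ge0 (s - t); lra.
have -> : ip (x s - x t - (s - t) *! v) w =
   ip (xn n s - xn n t - (((idx n s)%:R - (idx n t)%:R) * h n) *! v) w
   - ip (xn n s - x s) w + ip (xn n t - x t) w
   + (((idx n s)%:R - (idx n t)%:R) * h n - (s - t)) * ip v w.
  by rewrite !ipE; ring.
apply: le_trans (ler_normD _ _) _; apply: le_trans (lerD (ler_normD _ _) (lexx _)) _.
apply: le_trans (lerD (lerD (ler_normB _ _) (lexx _)) (lexx _)) _.
have b1 : `|ip (xn n s - x s) w| <= g * hnorm w.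
  apply: le_trans (ip_abs _ _) _; rewrite ler_wpM2r ?hnorm_ge0//.
  exact: le_trans (ltW h1) fg.
have b2 : `|ip (xn n t - x t) w| <= g * hnorm w.
  apply: le_trans (ip_abs _ _) _; rewrite ler_wpM2r ?hnorm_ge0//.
  exact: le_trans (ltW h2) fg.
have b3 : `|(((idx n s)%:R - (idx n t)%:R) * h n - (s - t)) * ip v w| <= g * `|ip v w|.
  rewrite normrM ler_wpM2r//; apply: le_trans (idist n t s t0 s0) _.
  exact: le_trans (ltW h3) fg.
have b4 := ler_wpM2r (ltW e0) (idist2 n t s t0 s0).
have b5 : h n * e <= g * e by rewrite ler_wpM2r ?(ltW e0)//; exact: le_trans (ltW h3) fg.
lra.
Qed.

End ImplicitEuler.

(** * Integrals of real functions *)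
Section Calculus.
Context {R : realType}.
Local Notation mu := (@lebesgue_measure R).
Implicit Types f g k : R -> R.

Lemma within_continuous_eps (a b : R) f :
  (forall t, a <= t <= b -> forall e : R, 0 < e -> exists2 d : R, 0 < d &
     forall s, a <= s <= b -> `|s - t| < d -> `|f s - f t| <= e) ->
  {within `[a, b], continuous f}.
Proof.
move=> h; apply/subspace_continuousP => t /=; rewrite in_itv /= => tab.
apply/cvgrPdist_le => e e0; have [d d0 hd] := h t tab e e0.
rewrite /prop_near1 /within /=; apply/nbhs_ballP; exists d => // s /=.
rewrite /ball /= in_itv /= distrC => sd sab.
by rewrite distrC; exact: hd.
Qed.

(** Continuous differentiability of [g] on the closed interval, with derivative
[f], in a form that treats the endpoints like the other points. *)
Definition C1_on (a b : R) g f := forall t, a <= t <= b -> forall e : R, 0 < e ->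
  exists2 d : R, 0 < d & forall s, a <= s <= b -> `|s - t| < d ->
    `|f s - f t| <= e /\ `|g s - g t - (s - t) * f t| <= e * `|s - t|.

Lemma C1_on_subset (a b a' b' : R) g f : a <= a' -> b' <= b -> C1_on a b g f -> C1_on a' b' g f.
Proof.
move=> aa bb h t /andP[t1 t2] e e0.
have [|d d0 hd] := h t _ e e0; first by rewrite (le_trans aa)// (le_trans t2).
exists d => // s /andP[s1 s2]; apply: hd.
by rewrite (le_trans aa)// (le_trans s2).
Qed.

Lemma C1_on_continuous (a b : R) g f : C1_on a b g f -> {within `[a, b], continuous f}.
Proof.
move=> h; apply: within_continuous_eps => t tab e e0.
by have [d d0 hd] := h t tab e e0; exists d => // s sab /(hd s sab)[].
Qed.

Lemma C1_on_integrable (a b : R) g f : C1_on a b g f -> mu.-integrable `[a, b] (EFin \o f).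
Proof.
move=> /C1_on_continuous h; apply: continuous_compact_integrable => //.
exact: segment_compact.
Qed.

Lemma C1_on_FTC (a b : R) g f : a <= b -> C1_on a b g f ->
  (\int[mu]_(r in `[a, b]) f r)%R = g b - g a.
Proof.
rewrite le_eqVlt => /predU1P[<-|ab] h; first by rewrite set_itv1 Rintegral_set1 subrr.
have cg : {within `[a, b], continuous g}.
  apply: within_continuous_eps => t tab e e0.
  have [d d0 hd] := h t tab _ ltr01.
  pose q := 1 + `|f t|; have q0 : 0 < q by rewrite ltr_wpDr.
  exists (Num.min d (e / q)); first by rewrite lt_min d0 divr_gt0.
  move=> s sab; rewrite lt_min ltr_pdivlMr// => /andP[/(hd s sab)[_ h1] h2].
  rewrite -(subrK ((s - t) * f t) (g s - g t)); apply: le_trans (ler_normD _ _) _.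
  by rewrite normrM; move: h2; rewrite /q; lra.
have der t : t \in `]a, b[ -> h0^-1 *: (g (h0 + t) - g t) @[h0 --> 0^'] --> f t.
  rewrite in_itv /= => /andP[at_ tb]; apply/cvgrPdist_le => e e0.
  have [|d d0 hd] := h t _ e e0; first by rewrite !ltW.
  pose q := Num.min d (Num.min (t - a) (b - t)).
  have q0 : 0 < q by rewrite !lt_min d0 !subr_gt0 at_.
  apply/nbhs_ballP; exists q => //= s; rewrite /ball /= sub0r normrN !lt_min => /andP[sd /andP[sa sb]] sn.
  have sab : a <= s + t <= b.
    by move: sa sb; rewrite !ltr_norml => /andP[? ?] /andP[? ?]; apply/andP; split; lra.
  have [] := hd (s + t) sab; first by rewrite addrK.
  rewrite addrK => _ h1.
  have -> : f t - s^-1 *: (g (s + t) - g t) = - (s^-1 * (g (s + t) - g t - s * f t)).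
    by rewrite /GRing.scale /=; field.
  by rewrite normrN normrM normfV mulrC ler_pdivrMr ?normr_gt0.
have /(continuous_within_itvP _ ab)[_ ga gb] := cg.
rewrite /Rintegral (@continuous_FTC2 _ f g a b ab (C1_on_continuous h)) //.
  split=> // t tab; rewrite /derivable.
  apply/cvg_ex; exists (f t); have := der t tab.
  apply: cvg_trans; apply: near_eq_cvg; near=> s => /=.
  by rewrite /GRing.scale /= mulr1.
by move=> t tab; apply: cvg_lim => //; exact: der.
Unshelve. all: by end_near. Qed.

End Calculus.

Section Integrability.
Context (d : measure_display) (T : measurableType d) {R : realType}.
Variable mu : {measure set T -> \bar R}.
Implicit Types f g : T -> R.

Lemma integrable_addr (A : set T) f g : measurable A ->
  mu.-integrable A (EFin \o f) -> mu.-integrable A (EFin \o g) ->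
  mu.-integrable A (EFin \o (fun x => f x + g x)).
Proof. by move=> mA fi gi; have := integrableD mA fi gi; apply: eq_integrable. Qed.

Lemma integrable_subr (A : set T) f g : measurable A ->
  mu.-integrable A (EFin \o f) -> mu.-integrable A (EFin \o g) ->
  mu.-integrable A (EFin \o (fun x => f x - g x)).
Proof. by move=> mA fi gi; have := integrableB mA fi gi; apply: eq_integrable. Qed.

Lemma integrable_scaler (A : set T) c f : measurable A ->
  mu.-integrable A (EFin \o f) -> mu.-integrable A (EFin \o (fun x => c * f x)).
Proof. by move=> mA fi; have := integrableZl mA c fi; apply: eq_integrable. Qed.

(** Taking the positive part of the difference turns the almost everywhere
inequality into one that holds everywhere. *)
Lemma le_Rintegral_ae (A : set T) f g : measurable A ->
  mu.-integrable A (EFin \o f) -> mu.-integrable A (EFin \o g) ->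
  {ae mu, forall x, A x -> f x <= g x} ->
  (\int[mu]_(x in A) f x <= \int[mu]_(x in A) g x)%R.
Proof.
move=> mA fi gi fg; rewrite -subr_ge0 -RintegralB//.
have mB : measurable_fun A (fun x => g x - f x).
  by apply: measurable_funB; apply/measurable_EFinP; exact: (measurable_int mu).
pose h x := Num.max (g x - f x) 0.
have -> : (\int[mu]_(x in A) (g x - f x) = \int[mu]_(x in A) h x)%R.
  rewrite /Rintegral; congr fine; apply: ae_eq_integral => //.
  - exact/measurable_EFinP.
  - by apply/measurable_EFinP; apply: measurable_maxr.
  - case: fg => N [mN N0 sN]; exists N; split=> // x hx; apply: sN => fgx.
    by apply: hx => Ax; rewrite /h max_l// subr_ge0; exact: fgx.
by apply: Rintegral_ge0 => x _; rewrite le_max lexx orbT.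
Qed.

End Integrability.

(** * Weak primitives and energy estimates *)
Section WeakPrimitive.
Context {R : realType} {X : hilbertType R}.
Local Notation mu := (@lebesgue_measure R).
Implicit Types (x dx : R -> X).

(** [x] is a primitive of [dx] when tested against vectors, where [dx] is
dominated in norm by an integrable function [k]. The bound by a real function
recovers norm estimates from the tested identities. *)
Definition weak_primitive (a b : R) x dx : Prop := exists k : R -> R,
  [/\ mu.-integrable `[a, b] (EFin \o k),
      forall r, a <= r <= b -> hnorm (dx r) <= k r &
      forall w, mu.-integrable `[a, b] (EFin \o (fun r => ip (dx r) w)) /\
        forall s t, a <= s -> s <= t -> t <= b ->
          ip (x t - x s) w = (\int[mu]_(r in `[s, t]) ip (dx r) w)%R].

Lemma integrable_sub_itv (a b s t : R) (f : R -> R) : a <= s -> t <= b ->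
  mu.-integrable `[a, b] (EFin \o f) -> mu.-integrable `[s, t] (EFin \o f).
Proof.
move=> sa tb; apply: integrableS => // r /=; rewrite !in_itv /= => /andP[r1 r2].
by rewrite (le_trans sa)// (le_trans r2).
Qed.

Lemma weak_primitive_subset (a b s t : R) x dx : a <= s -> t <= b ->
  weak_primitive a b x dx -> weak_primitive s t x dx.
Proof.
move=> sa tb [k [ki dk hw]]; exists k; split.
- exact: integrable_sub_itv ki.
- by move=> r /andP[r1 r2]; apply: dk; rewrite (le_trans sa)// (le_trans r2).
- move=> w; have [wi we] := hw w; split; first exact: integrable_sub_itv wi.
  by move=> p q sp pq qt; apply: we => //; [exact: le_trans sp|exact: le_trans tb].
Qed.

Lemma weak_primitive_sub (a b : R) x dx y dy :
  weak_primitive a b x dx -> weak_primitive a b y dy ->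
  weak_primitive a b (fun r => x r - y r) (fun r => dx r - dy r).
Proof.
move=> [k [ki dk hw]] [l [li dl hv]]; exists (fun r => k r + l r); split.
- exact: integrable_addr.
- by move=> r rab; apply: le_trans (hnorm_subr _ _) _; rewrite lerD ?dk ?dl.
- move=> w; have [wi we] := hw w; have [vi ve] := hv w.
  have E : (fun r => ip (dx r - dy r) w) = (fun r => ip (dx r) w - ip (dy r) w).
    by apply/funext => r; rewrite ipDl ipNl.
  rewrite E; split; first exact: integrable_subr.
  move=> s t sa st tb; have wi' := integrable_sub_itv sa tb wi.
  have vi' := integrable_sub_itv sa tb vi; rewrite RintegralB//.
  rewrite -we// -ve//; rewrite !ipE; ring.
Qed.

Lemma C1_weak_primitive (a b M : R) x dx : a <= b ->
  (forall r, a <= r <= b -> hnorm (dx r) <= M) ->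
  (forall w, C1_on a b (fun r => ip (x r) w) (fun r => ip (dx r) w)) ->
  weak_primitive a b x dx.
Proof.
move=> ab hM h; exists (cst M); split=> //.
  apply: continuous_compact_integrable; first exact: segment_compact.
  by apply: continuous_subspaceT => ?; exact: cvg_cst.
move=> w; split; first exact: C1_on_integrable (h w).
move=> s t sa st tb; rewrite (@C1_on_FTC _ _ _ (fun r => ip (x r) w))//; first by rewrite !ipE.
exact: C1_on_subset (h w).
Qed.

(** Increments of the energy are second order in the increments of the
primitive [P] of the dominating function; cutting the interval at equal
increments of [P] makes their sum vanish. *)
Lemma energy_nonincreasing (a b c : R) x dx y dy : a <= b -> 0 <= c ->
  weak_primitive a b x dx -> weak_primitive a b y dy ->
  {ae mu, forall r, a <= r <= b -> ip (dx r) (x r) + c * ip (dy r) (y r) <= 0} ->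
  hnorm (x b) ^+ 2 + c * hnorm (y b) ^+ 2 <= hnorm (x a) ^+ 2 + c * hnorm (y a) ^+ 2.
Proof.
move=> ab c0 [k [ki dk hw]] [l [li dl hv]] hae.
pose m r := k r + l r.
have mi : mu.-integrable `[a, b] (EFin \o m) by exact: integrable_addr.
have k0 r : a <= r <= b -> 0 <= k r by move=> h; apply: le_trans (dk r h); exact: hnorm_ge0.
have l0 r : a <= r <= b -> 0 <= l r by move=> h; apply: le_trans (dl r h); exact: hnorm_ge0.
pose P t := (\int[mu]_(r in `[a, t]) m r)%R.
have PB s t : a <= s -> s <= t -> t <= b -> P t - P s = (\int[mu]_(r in `[s, t]) m r)%R.
  move=> sa st tb; rewrite /P Rintegral_itvB//; first last.
  - exact: integrable_sub_itv mi.
  - rewrite Rintegral_itv_obnd_cbnd//.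
    apply: integrableS (integrable_sub_itv sa tb mi) => //.
    by move=> r /=; rewrite !in_itv /= => /andP[/ltW -> ->].
have Pmono s t : a <= s -> s <= t -> t <= b -> P s <= P t.
  move=> sa st tb; rewrite -subr_ge0 PB//; apply: Rintegral_ge0 => r /=; rewrite in_itv /= => /andP[r1 r2].
  have rab : a <= r <= b by rewrite (le_trans sa)// (le_trans r2).
  by rewrite addr_ge0 ?k0 ?l0.
have incr (z dz : R -> X) : (forall r, a <= r <= b -> hnorm (dz r) <= m r) ->
   (forall w, mu.-integrable `[a, b] (EFin \o (fun r => ip (dz r) w)) /\
        forall s t, a <= s -> s <= t -> t <= b ->
          ip (z t - z s) w = (\int[mu]_(r in `[s, t]) ip (dz r) w)%R) ->
   forall s t, a <= s -> s <= t -> t <= b -> hnorm (z t - z s) <= P t - P s.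
  move=> dzm hz s t sa st tb; apply: hnorm_le_ip; first by rewrite subr_ge0 Pmono.
  move=> w; have [wi ->] := hz w; rewrite // PB//.
  have mi' := integrable_sub_itv sa tb mi; rewrite mulrC -RintegralZl//.
  apply: le_Rintegral => //.
  - exact: integrable_sub_itv wi.
  - exact: integrable_scaler.
  - move=> r /=; rewrite in_itv /= => /andP[r1 r2].
    apply: le_trans (ip_le _ _) _; rewrite mulrC ler_wpM2l ?hnorm_ge0// dzm//.
    by rewrite (le_trans sa)// (le_trans r2).
have dxm r : a <= r <= b -> hnorm (dx r) <= m r.
  by move=> h; apply: le_trans (dk r h) _; rewrite lerDl l0.
have dym r : a <= r <= b -> hnorm (dy r) <= m r.
  by move=> h; apply: le_trans (dl r h) _; rewrite lerDr k0.
have incx := incr x dx dxm hw; have incy := incr y dy dym hv.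
pose F t := hnorm (x t) ^+ 2 + c * hnorm (y t) ^+ 2.
pose C := 2 * (1 + c); have C0 : 0 <= C by rewrite mulr_ge0// addr_ge0.
have FP s t : a <= s -> s <= t -> t <= b -> F t - F s <= C * (P t - P s) ^+ 2.
  move=> sa st tb; set q := P t - P s.
  have sq (z : R -> X) : hnorm (z t) ^+ 2 - hnorm (z s) ^+ 2 <= 2 * ip (z t - z s) (z t).
    have -> : hnorm (z s) ^+ 2 = hnorm (z t) ^+ 2 - 2 * ip (z t - z s) (z t) + hnorm (z t - z s) ^+ 2.
      by rewrite ipC -hnormB_sq; congr (hnorm _ ^+ 2); vec.
    have := sqr_ge0 (hnorm (z t - z s)); lra.
  have [xi xe] := hw (x t); have [yi ye] := hv (y t).
  have xi' := integrable_sub_itv sa tb xi; have yi' := integrable_sub_itv sa tb yi.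
  have mi' := integrable_sub_itv sa tb mi.
  have cyi : mu.-integrable `[s, t] (EFin \o (fun r => c * ip (dy r) (y t))).
    exact: integrable_scaler.
  have qmi : mu.-integrable `[s, t] (EFin \o (fun r => (1 + c) * q * m r)).
    exact: integrable_scaler.
  have : ip (x t - x s) (x t) + c * ip (y t - y s) (y t) <= (1 + c) * q * q.
    have qE : q = (\int[mu]_(r in `[s, t]) m r)%R by exact: PB.
    rewrite xe// ye// -RintegralZl// -RintegralD// [X in _ <= _ * X]qE -RintegralZl//.
    apply: le_Rintegral_ae => //; first exact: integrable_addr.
    case: hae => N [mN N0 sN]; exists N; split=> // r nr; apply: sN => hr; apply: nr.
    rewrite /= in_itv /= => /andP[r1 r2].
    have ar : a <= r by exact: le_trans r1.
    have rb : r <= b by exact: le_trans tb.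
    have rab : a <= r <= b by rewrite ar.
    have dq (z dz : R -> X) : hnorm (z t - z r) <= P t - P r -> hnorm (dz r) <= m r ->
        ip (dz r) (z t) <= ip (dz r) (z r) + m r * q.
      move=> h1 h2; rewrite -{1}(subrK (z r) (z t)) ipDr addrC lerD2l.
      apply: le_trans (ip_le _ _) _; apply: ler_pM; rewrite ?hnorm_ge0//.
      by apply: le_trans h1 _; rewrite /q lerD2l lerN2 Pmono.
    have h1 := dq x dx (incx _ _ ar r2 tb) (dxm r rab).
    have h2 := dq y dy (incy _ _ ar r2 tb) (dym r rab).
    have := ler_wpM2l c0 h2; have := hr rab; lra.
  have := sq x; have := ler_wpM2l c0 (sq y); rewrite /F /C; lra.
have Pa : P a = 0 by rewrite /P set_itv1 Rintegral_set1.
have Pc : {within `[a, b], continuous P} by exact: parameterized_integral_continuous.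
have := Pmono a b (lexx _) ab (lexx _); rewrite Pa le_eqVlt => /predU1P[Pb|Pb].
  by have := FP a b (lexx _) ab (lexx _); rewrite Pa -Pb subrr expr0n mulr0 subr_le0.
rewrite -/(F a) -/(F b); apply: (@le_of_eps _ _ _ 1) => // e e0 _.
have [N hN] := archi_lt e0 (mulr_ge0 C0 (sqr_ge0 (P b))).
pose v (i : nat) := P b * (i%:R / N.+1%:R).
have ex (i : nat) : exists t, (i <= N.+1)%N -> a <= t <= b /\ P t = v i.
  have [iN|/negP iN] := boolP (i <= N.+1)%N; last by exists a.
  have [|t tab tE] := @IVT _ P a b (v i) ab Pc.
    rewrite Pa min_l ?max_r ?(ltW Pb)//; apply/andP; split.
      by rewrite mulr_ge0 ?(ltW Pb)// divr_ge0.
    by rewrite ler_piMr ?(ltW Pb)// ler_pdivrMr// mul1r ler_nat.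
  by exists t => _; move: tab; rewrite in_itv.
have [t ht] := choice ex.
have vS i : v i.+1 - v i = P b / N.+1%:R by rewrite /v -natr1; field; rewrite nat1r pnatr_eq0.
have step i : (i <= N.+1)%N -> F (t i) <= F a + i%:R * (C * (P b / N.+1%:R) ^+ 2).
  elim: i => [|i ih] iN.
    have [/andP[t1 t2] tv] := ht 0%N isT; have := FP a (t 0%N) (lexx _) t1 t2.
    by rewrite tv Pa /v !mul0r mulr0 subrr expr0n mulr0; lra.
  have [/andP[t1 t2] tv] := ht i (ltnW iN); have [/andP[s1 s2] sv] := ht i.+1 iN.
  have ts : t i <= t i.+1.
    rewrite leNgt; apply/negP => /ltW h; have := Pmono _ _ s1 h t2.
    by rewrite tv sv leNgt -subr_gt0 vS divr_gt0.
  have := FP _ _ t1 ts s2; rewrite tv sv vS -[i.+1%:R]natr1.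
  have := ih (ltnW iN); move: (C * _) => q; lra.
have [/andP[t1 t2] tv] := ht N.+1 (leqnn _); have := FP _ _ t1 t2 (lexx _).
rewrite tv /v divff ?pnatr_eq0// mulr1 subrr expr0n mulr0.
have := step _ (leqnn _); move: hN.
have -> : N.+1%:R * (C * (P b / N.+1%:R) ^+ 2) = C * P b ^+ 2 / N.+1%:R.
  by field; rewrite nat1r pnatr_eq0.
move: (C * _ / _) => q; lra.
Qed.

End WeakPrimitive.

(** * Simple functions and Bochner integrals *)
Section SimpleFunctions.
Context (d : measure_display) (T : measurableType d) {R : realType}.
Variable mu : {measure set T -> \bar R}.
Variable A : set T.
Hypothesis mA : measurable A.
Hypothesis finA : (mu A < +oo)%E.

Lemma Rintegral_sum (I : Type) (l : seq I) (f : I -> T -> R) :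
  (forall i, mu.-integrable A (EFin \o f i)) ->
  mu.-integrable A (EFin \o (fun r => \sum_(i <- l) f i r)) /\
  (\int[mu]_(r in A) (\sum_(i <- l) f i r) = \sum_(i <- l) \int[mu]_(r in A) f i r)%R.
Proof.
move=> fi; elim: l => [|i l [ih1 ih2]].
  have E : (fun r => \sum_(i <- [::]) f i r) = cst (0 : R).
    by apply/funext => r; rewrite big_nil.
  rewrite E big_nil Rintegral_cst// mul0r; split=> //.
  exact: integrable0.
have E : (fun r => \sum_(j <- i :: l) f j r) = (fun r => f i r + \sum_(j <- l) f j r).
  by apply/funext => r; rewrite big_cons.
rewrite E big_cons RintegralD// ih2; split=> //.
exact: integrable_addr.
Qed.

Lemma integrable_bounded_real (f : T -> R) (M : R) : measurable_fun A f ->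
  (forall r, A r -> `|f r| <= M) -> mu.-integrable A (EFin \o f).
Proof.
move=> mf fM; apply: measurable_bounded_integrable => //.
exists M; split; first exact: num_real.
by move=> K MK r /= Ar; apply: le_trans (fM r Ar) (ltW MK).
Qed.

Variables (Z : choiceType) (s : T -> Z).
Hypothesis s_fin : finite_set (range s).
Hypothesis s_meas : forall v, measurable (s @^-1` [set v]).

Lemma simple_comp_sum (g : Z -> R) r :
  g (s r) = \sum_(v <- finmap.enum_fset (fset_set (range s))) g v * \1_(s @^-1` [set v]) r.
Proof.
have sr : s r \in fset_set (range s) by rewrite in_fset_set//; apply/mem_set; exists r.
rewrite (bigD1_seq (s r))//= big1 ?addr0; last first.
  move=> v vs; rewrite indicE memNset ?mulr0//= => /esym/eqP.
  by rewrite (negbTE vs).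
by rewrite indicE mem_set ?mulr1.
Qed.

Lemma simple_integral_comp (g : Z -> R) :
  mu.-integrable A (EFin \o (fun r => g (s r))) /\
  (\int[mu]_(r in A) g (s r) =
   \sum_(v <- finmap.enum_fset (fset_set (range s))) g v * fine (mu (A `&` s @^-1` [set v])))%R.
Proof.
have E : (fun r => g (s r)) =
    (fun r => \sum_(v <- finmap.enum_fset (fset_set (range s))) g v * \1_(s @^-1` [set v]) r).
  by apply/funext => r; exact: simple_comp_sum.
have ind v : mu.-integrable A (EFin \o (\1_(s @^-1` [set v]) : T -> R)).
  apply: (@integrable_bounded_real _ 1); first exact: measurable_indic.
  by move=> r _; rewrite indicE; case: (_ \in _); rewrite ?normr1 ?normr0.
have [|i1 i2] := @Rintegral_sum _ (finmap.enum_fset (fset_set (range s))) (fun v r => g v * \1_(s @^-1` [set v]) r).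
  by move=> v; exact: integrable_scaler.
rewrite E; split=> //; rewrite i2; apply: eq_bigr => v _.
by rewrite RintegralZl// /Rintegral integral_indic// classical_sets.setIC.
Qed.

Lemma simple_comp_measurable (g : Z -> R) : measurable_fun A (fun r => g (s r)).
Proof. by have [/(measurable_int mu)/measurable_EFinP] := simple_integral_comp g. Qed.

End SimpleFunctions.

Section SimpleLimits.
Context (d : measure_display) (T : measurableType d) {R : realType} {X : hilbertType R}.
Variable mu : {measure set T -> \bar R}.
Variable A : set T.
Hypothesis mA : measurable A.
Hypothesis finA : (mu A < +oo)%E.

Definition simple_on (s : T -> X) :=
  finite_set (range s) /\ forall v, measurable (s @^-1` [set v]).

Lemma simple_pair_measurable (s s' : T -> X) (g : X -> X -> R) : simple_on s -> simple_on s' ->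
  measurable_fun A (fun r => g (s r) (s' r)).
Proof.
move=> [fs ms] [fs' ms'].
apply: (@simple_comp_measurable _ _ _ mu A mA finA (X * X)%type (fun r => (s r, s' r)) _ _ (fun p => g p.1 p.2)).
  apply: sub_finite_set (finite_setX fs fs') => _ [r _ <-] /=.
  by split; exists r.
move=> [v v']; rewrite (_ : _ @^-1` _ = s @^-1` [set v] `&` s' @^-1` [set v']).
  exact: measurableI.
by apply/seteqP; split => r /= [-> ->].
Qed.

Lemma simple_comp_ip (s : T -> X) w : simple_on s ->
  mu.-integrable A (EFin \o (fun r => ip (s r) w)) /\
  ip (\sum_(v \in range s) (fine (mu (A `&` s @^-1` [set v])))%:C%C *: v) w =
    (\int[mu]_(r in A) ip (s r) w)%R.
Proof.
move=> [fs ms].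
have [i1 i2] := @simple_integral_comp _ _ _ mu A mA finA X s fs ms (fun v => ip v w).
split=> //; rewrite i2 fsbig_finite//=.
elim: (finmap.enum_fset _) => [|v l ih]; first by rewrite !big_nil ip0l.
by rewrite !big_cons ipDl ipZl ih mulrC.
Qed.

Variables (s : nat -> T -> X) (f : T -> X).
Hypothesis s_simple : forall n, simple_on (s n).
Hypothesis s_cvg : forall r, A r -> s n r @[n --> \oo] --> f r.

Lemma simple_limit_measurable (s' : T -> X) : simple_on s' ->
  measurable_fun A (fun r => hnorm (s' r - f r)).
Proof.
move=> hs'; apply: (@measurable_fun_cvg _ _ _ _ (fun m r => hnorm (s' r - s m r))).
  by move=> m; apply: (simple_pair_measurable (fun u v => hnorm (u - v))).
move=> r Ar; apply/cvgrPdist_lt => e e0.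
have [N _ hN] := (hnorm_cvgP _ _).1 (s_cvg Ar) _ e0; exists N => // n /= Nn.
have := hN n Nn => /=; apply: le_lt_trans.
have h1 := hnorm_triangle (s n r) (s' r) (f r); have h2 := hnorm_triangle (f r) (s' r) (s n r).
rewrite (hnormBC (f r)) in h2.
by rewrite ler_norml; apply/andP; split; lra.
Qed.

Lemma simple_limit_ip_measurable w : measurable_fun A (fun r => ip (f r) w).
Proof.
apply: (@measurable_fun_cvg _ _ _ _ (fun m r => ip (s m r) w)).
  by move=> m; apply: (simple_pair_measurable (fun u _ => ip u w) (s_simple m) (s_simple m)).
move=> r Ar; apply/cvgrPdist_lt => e e0.
have w1 : 0 < hnorm w + 1 by rewrite ltr_wpDl// hnorm_ge0.
have e1 : 0 < e / (hnorm w + 1) by rewrite divr_gt0.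
have [N _ hN] := (hnorm_cvgP _ _).1 (s_cvg Ar) _ e1; exists N => // n /= Nn.
rewrite -ipNl -ipDl; apply: le_lt_trans (ip_abs _ _) _; rewrite hnormBC.
have := hN n Nn; rewrite /= ltr_pdivlMr//; have := hnorm_ge0 (s n r - f r); lra.
Qed.

Lemma simple_limit_norm_measurable : measurable_fun A (fun r => hnorm (f r)).
Proof.
have : simple_on (fun _ : T => (0 : X)).
  split; first by apply: sub_finite_set (finite_set1 (0 : X)) => _ [r _ <-].
  move=> v; have [->|v0] := eqVneq v 0.
    by rewrite (_ : _ @^-1` _ = classical_sets.setT)//; apply/seteqP; split.
  rewrite (_ : _ @^-1` _ = classical_sets.set0)//; apply/seteqP; split=> // r /= E.
  by rewrite -E eqxx in v0.
move/simple_limit_measurable; congr (measurable_fun A _).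
by apply/funext => r; rewrite sub0r hnorm_oppr.
Qed.

End SimpleLimits.

Section WeakIntegrals.
Context (d : measure_display) (T : measurableType d) {R : realType} {X : hilbertType R}.
Variable mu : {measure set T -> \bar R}.
Variable A : set T.
Hypothesis mA : measurable A.
Hypothesis finA : (mu A < +oo)%E.

Local Notation weighted_sum s :=
  (\sum_(v \in range s) (fine (mu (A `&` s @^-1` [set v])))%:C%C *: v).

Lemma simple_dist_integrable (s f : T -> X) w :
  mu.-integrable A (EFin \o (fun r => hnorm (s r - f r))) ->
  measurable_fun A (fun r => ip (f r) w) ->
  simple_on s ->
  mu.-integrable A (EFin \o (fun r => ip (f r) w)) /\
  `|(\int[mu]_(r in A) ip (s r) w)%R - (\int[mu]_(r in A) ip (f r) w)%R| <=
    hnorm w * (\int[mu]_(r in A) hnorm (s r - f r))%R.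
Proof.
move=> di mf hs; have [si _] := simple_comp_ip mA finA w hs.
have ms : measurable_fun A (fun r => ip (s r) w).
  by apply/measurable_EFinP; exact: (measurable_int mu).
have wdi := integrable_scaler (hnorm w) mA di.
have ei : mu.-integrable A (EFin \o (fun r => ip (s r - f r) w)).
  apply: le_integrable wdi => //.
    apply/measurable_EFinP.
    have -> : (fun r => ip (s r - f r) w) = (fun r => ip (s r) w - ip (f r) w).
      by apply/funext => r; rewrite ipDl ipNl.
    exact: measurable_funB.
  move=> r Ar /=; rewrite lee_fin [leRHS]ger0_norm ?mulr_ge0 ?hnorm_ge0//.
  by rewrite mulrC ip_abs.
have fi : mu.-integrable A (EFin \o (fun r => ip (f r) w)).
  have := integrable_subr mA si ei; congr (mu.-integrable A _).
  by apply/funext => r /=; rewrite ipDl ipNl; congr (_%:E); ring.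
split=> //; rewrite -RintegralB//.
apply: le_trans (le_normr_Rintegral mA (integrable_subr mA si fi)) _.
rewrite -RintegralZl//; apply: le_Rintegral => //.
  have := integrable_subr mA si fi; by move/integrable_norm.
by move=> r Ar; rewrite -ipNl -ipDl mulrC ip_abs.
Qed.

(** Testing against vectors reduces the vector-valued limit to Lebesgue
integrals of real functions. *)
Lemma approximation_integral_ip (s : nat -> T -> X) (f : T -> X) v w :
  (forall n, simple_on (s n)) -> (forall t, A t -> s n t @[n --> \oo] --> f t) ->
  (\int[mu]_(t in A) (hnorm (s n t - f t))%:E)%E @[n --> \oo] --> 0%E ->
  weighted_sum (s n) @[n --> \oo] --> v ->
  mu.-integrable A (EFin \o (fun r => ip (f r) w)) /\
  ip v w = (\int[mu]_(r in A) ip (f r) w)%R.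
Proof.
move=> hs sf /fine_cvgP[dfin dcvg] scvg.
have mf : measurable_fun A (fun r => ip (f r) w).
  exact: (simple_limit_ip_measurable mA finA hs sf).
have md n : measurable_fun A (fun r => hnorm (s n r - f r)).
  exact: (simple_limit_measurable mA finA hs sf (hs n)).
have [N0 _ hN0] := dfin.
have di n : (N0 <= n)%N -> mu.-integrable A (EFin \o (fun r => hnorm (s n r - f r))).
  move=> nN; apply/integrableP; split; first exact/measurable_EFinP.
  have := hN0 n nN; rewrite /= fin_numElt => /andP[_].
  by move=> h /=; under eq_integral do rewrite ger0_norm ?hnorm_ge0//.
have [fi _] := simple_dist_integrable (di N0 (leqnn _)) mf (hs N0).
split=> //; apply/subr0_eq/normr0_eq0/le_anti; rewrite normr_ge0 andbT.
apply: (@le_of_eps _ _ _ (2 * hnorm w)); first by rewrite mulr_ge0// hnorm_ge0.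
move=> e e0 _; rewrite add0r.
have [N1 _ hN1] := (cvgrPdist_lt _ _).1 dcvg _ e0.
have [N2 _ hN2] := (hnorm_cvgP _ _).1 scvg _ e0.
pose n := maxn N0 (maxn N1 N2).
have n0 : (N0 <= n)%N by exact: leq_maxl.
have n1 : (N1 <= n)%N by rewrite /n !leq_max leqnn orbT.
have n2 : (N2 <= n)%N by rewrite /n !leq_max leqnn !orbT.
have [_ h1] := simple_dist_integrable (di n n0) mf (hs n).
have h2 := hN1 n n1; rewrite /= sub0r normrN ger0_norm in h2; last first.
  by apply: fine_ge0; apply: integral_ge0 => r _; rewrite lee_fin hnorm_ge0.
have h3 := hN2 n n2; rewrite /= in h3.
have [_ h4] := simple_comp_ip mA finA w (hs n).
have -> : ip v w - (\int[mu]_(r in A) ip (f r) w)%R = ip (v - weighted_sum (s n)) w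
   + ((\int[mu]_(r in A) ip (s n r) w)%R - (\int[mu]_(r in A) ip (f r) w)%R).
  by rewrite ipDl ipNl h4; ring.
apply: le_trans (ler_normD _ _) _.
have h5 : `|ip (v - weighted_sum (s n)) w| <= e * hnorm w.
  by apply: le_trans (ip_abs _ _) _; rewrite ler_wpM2r ?hnorm_ge0// hnormBC ltW.
have h6 : hnorm w * (\int[mu]_(r in A) hnorm (s n r - f r))%R <= hnorm w * e.
  by rewrite ler_wpM2l ?hnorm_ge0// ltW.
lra.
Qed.

(** The norms of the differences tend to [0] in mean by dominated convergence, and
this convergence controls the tested integrals uniformly over unit vectors,
which gives convergence of the vector integrals in norm. *)
Lemma approximation_dominated (s : nat -> T -> X) (f : T -> X) v (M : R) :
  (forall n, simple_on (s n)) ->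
  (forall t, A t -> s n t @[n --> \oo] --> f t) ->
  (forall n t, A t -> hnorm (s n t) <= M) ->
  (forall t, A t -> hnorm (f t) <= M) ->
  (forall w, ip v w = (\int[mu]_(r in A) ip (f r) w)%R) ->
  (\int[mu]_(t in A) (hnorm (s n t - f t))%:E)%E @[n --> \oo] --> 0%E /\
  weighted_sum (s n) @[n --> \oo] --> v.
Proof.
move=> hs sf sM fM vw.
have md n := simple_limit_measurable mA finA hs sf (hs n).
have bd n r : A r -> hnorm (s n r - f r) <= 2 * M.
  by move=> Ar; apply: le_trans (hnorm_subr _ _) _; have := sM n r Ar; have := fM r Ar; lra.
have di n : mu.-integrable A (EFin \o (fun r => hnorm (s n r - f r))).
  apply: (integrable_bounded_real mA finA (md n)) => r Ar.
  by rewrite ger0_norm ?hnorm_ge0//; exact: bd.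
have cv : (\int[mu]_(t in A) (hnorm (s n t - f t))%:E)%E @[n --> \oo] --> 0%E.
  have [] := @dominated_convergence _ _ _ mu A mA (fun n r => (hnorm (s n r - f r))%:E)
    (cst 0%E) (cst (2 * M)%:E).
  - by move=> n; apply/measurable_EFinP; exact: md.
  - exact: measurable_cst.
  - apply: aeW => r Ar; apply: cvg_EFin; first exact: nearW.
    exact: (hnorm_cvg0P _ _).1 (sf r Ar).
  - exact: (integrable_bounded_real mA finA (M := `|2 * M|) (measurable_cst _)).
  - by apply: aeW => r n Ar; rewrite /= lee_fin ger0_norm ?hnorm_ge0// bd.
  by move=> _ _; rewrite integral_cst// mul0e.
split=> //; apply/hnorm_cvgP => e e0.
have [dfin dcvg] := (fine_cvgP _ _).1 cv.
have [N _ hN] := (cvgrPdist_lt _ _).1 dcvg _ e0; exists N => // n /= Nn.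
have := hN n Nn; rewrite /= sub0r normrN ger0_norm; last first.
  by apply: fine_ge0; apply: integral_ge0 => r _; rewrite lee_fin hnorm_ge0.
apply: le_lt_trans; apply: hnorm_le_ip.
  by apply: Rintegral_ge0 => r _; exact: hnorm_ge0.
move=> w; rewrite ipDl ipNl vw; have [_ ->] := simple_comp_ip mA finA w (hs n).
have [_ h] := simple_dist_integrable (di n) (simple_limit_ip_measurable mA finA hs sf w) (hs n).
by rewrite mulrC; apply: le_trans h; exact: ler_norm.
Qed.

End WeakIntegrals.

Section Bochner.
Context {R : realType} {X : hilbertType R}.
Local Notation mu := (@lebesgue_measure R).
Implicit Types (x dx f : R -> X) (A : set R).

Lemma itv_finite_measure (a b : R) : (mu `[a, b] < +oo)%E.
Proof. by rewrite lebesgue_measure_itv /=; case: ifP => _; rewrite -?EFinB ltry. Qed.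

Section OnSet.
Variable A : set R.
Hypothesis mA : measurable A.
Hypothesis finA : (mu A < +oo)%E.

Lemma bochner_integral_ip f v w : is_bochner_integral A f v ->
  mu.-integrable A (EFin \o (fun r => ip (f r) w)) /\
  ip v w = (\int[mu]_(r in A) ip (f r) w)%R.
Proof. by move=> [s [hs sf dcvg scvg]]; exact: (@approximation_integral_ip _ _ _ _ mu A mA finA s f v w hs sf dcvg scvg). Qed.

Lemma bochner_integral_intro f v (s : nat -> R -> X) (M : R) :
  (forall n, simple_function (s n)) ->
  (forall t, A t -> s n t @[n --> \oo] --> f t) ->
  (forall n t, A t -> hnorm (s n t) <= M) ->
  (forall t, A t -> hnorm (f t) <= M) ->
  (forall w, ip v w = (\int[mu]_(r in A) ip (f r) w)%R) ->
  is_bochner_integral A f v.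
Proof.
move=> hs sf sM fM vw; exists s.
by have [? ?] := @approximation_dominated _ _ _ _ mu A mA finA s f v M hs sf sM fM vw; split.
Qed.

End OnSet.

(** Square integrability on a bounded interval supplies the integrable bound. *)
Lemma H1_weak_primitive (tau : R) x dx : 0 < tau -> H1_derivative tau x dx ->
  weak_primitive 0 tau x dx.
Proof.
move=> tau0 [[[s [hs sf]] L2] hb].
have mA : measurable (`[0, tau] : set R) by exact: measurable_itv.
have fA := itv_finite_measure 0 tau.
have mn : measurable_fun (`[0, tau] : set R) (fun r => hnorm (dx r)).
  exact: (@simple_limit_norm_measurable _ _ _ _ mu _ mA fA s dx hs sf).
(* A bound for [hnorm (dx r)], since [u <= 1 + u^2]. *)
exists (fun r => 1 + hnorm (dx r) ^+ 2); split.
- apply: integrable_addr => //.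
    apply: (@integrable_bounded_real _ _ _ mu _ mA fA _ 1) => // r _.
    by rewrite normr1.
  apply/integrableP; split; first by apply/measurable_EFinP; exact: measurable_funX.
  by under eq_integral do rewrite gee0_abs ?lee_fin ?sqr_ge0//.
- move=> r _; have := sqr_ge0 (hnorm (dx r) - 1); have := sqr_ge0 (hnorm (dx r)).
  rewrite sqrrB1; lra.
move=> w; have int t : 0 <= t <= tau -> mu.-integrable `[0, t] (EFin \o (fun r => ip (dx r) w)) /\
    ip (x t - x 0) w = (\int[mu]_(r in `[0, t]) ip (dx r) w)%R.
  move=> ht; apply: bochner_integral_ip (hb t ht); first exact: measurable_itv.
  exact: itv_finite_measure.
have [wi _] := int tau (introT andP (conj (ltW tau0) (lexx _))).
split=> // a b a0 ab bt.
have b0 := le_trans a0 ab; have at' := le_trans ab bt.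
have [_ ea] := int a (introT andP (conj a0 at')).
have [_ eb] := int b (introT andP (conj b0 bt)).
have -> : ip (x b - x a) w = ip (x b - x 0) w - ip (x a - x 0) w.
  by rewrite !ipE; ring.
have wb := integrable_sub_itv (lexx 0) bt wi.
rewrite ea eb Rintegral_itvB//.
rewrite Rintegral_itv_obnd_cbnd//.
apply: integrableS (integrable_sub_itv a0 bt wi) => //.
by move=> r /=; rewrite !in_itv /= => /andP[/ltW -> ->].
Qed.

End Bochner.

(** * Strong evolutions *)
Section StepFunctions.
Context {R : realType} {X : hilbertType R}.

(** Step function of mesh [1 / m]; it vanishes outside [0, k) so that it takes
finitely many values on the whole line. *)
Definition grid_step (k m : nat) (v : nat -> X) (t : R) : X :=
  if (0 <= t) && (t < k%:R) then v (Num.truncn (t * m%:R)) else 0.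

Lemma truncn_eqP (t : R) j : 0 <= t -> Num.truncn t = j <-> j%:R <= t < j.+1%:R.
Proof.
move=> t0; split=> [<-|/andP[a b]]; first exact: truncn_itv.
by have := truncn_itv t0; apply: contraTeq; rewrite neq_ltn => /orP[h|h]; apply/negP => /andP[c d];
  [have := le_lt_trans a d|have := le_lt_trans c b]; rewrite ltr_nat ltnS leqNgt h.
Qed.

Lemma grid_step_simple k m v : (0 < m)%N -> simple_function (grid_step k m v).
Proof.
move=> m0; have m0' : 0 < m%:R :> R by rewrite ltr0n.
split.
  apply: (@sub_finite_set _ _ ([set 0] `|` [set v j | j in `I_(k * m)])); last first.
    by rewrite finite_setU; split; [exact: finite_set1|apply: finite_image; exact: finite_II].
  move=> _ [t _ <-]; rewrite /grid_step; case: ifP => [/andP[t0 tk]|_]; [right|by left].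
  exists (Num.truncn (t * m%:R)) => //=.
  have tm0 : 0 <= t * m%:R by rewrite mulr_ge0// ltW.
  have /andP[h _] := truncn_itv tm0.
  by rewrite -(ltr_nat R) natrM; apply: le_lt_trans h _; rewrite ltr_pM2r.
move=> y.
pose E1 : set R := `[0, k%:R[%classic `&` \bigcup_(j in [set j | v j = y]) `[j%:R / m%:R, j.+1%:R / m%:R[%classic.
have mE1 : measurable E1.
  by apply: measurableI; [|apply: bigcup_measurable => j _]; exact: measurable_itv.
have inE1 t : E1 t <-> (0 <= t < k%:R /\ v (Num.truncn (t * m%:R)) = y).
  rewrite /E1 /= in_itv /=; split.
    move=> [/andP[t0 tk] [j /= vj]]; rewrite in_itv /= ler_pdivrMr// ltr_pdivlMr// => h.
    have tm0 : 0 <= t * m%:R by rewrite mulr_ge0// ltW.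
    by rewrite t0 ((truncn_eqP _ tm0).2 h).
  move=> [/andP[t0 tk] h]; split; first by rewrite t0.
  exists (Num.truncn (t * m%:R)) => //=; rewrite in_itv /= ler_pdivrMr// ltr_pdivlMr//.
  by apply: truncn_itv; rewrite mulr_ge0// ltW.
have [y0|y0] := pselect (y = 0).
  rewrite (_ : _ @^-1` _ = E1 `|` ~` `[0, k%:R[%classic); last first.
    apply/seteqP; split=> t; rewrite /= /grid_step in_itv /=.
      by case: ifP => h e; [left; apply/inE1|right].
    by case=> [/inE1[-> ->]//|/negP/negbTE ->].
  by apply: measurableU => //; apply: measurableC; exact: measurable_itv.
rewrite (_ : _ @^-1` _ = E1)//; apply/seteqP; split=> t; rewrite /= /grid_step.
  by case: ifP => h e; [apply/inE1|exfalso; apply: y0].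
by move=> /inE1[-> ->].
Qed.

End StepFunctions.

Section Evolution.
Context {R : realType} {X : hilbertType R}.
Variables (D : set X) (B : X -> X).
Hypothesis hB : dissipative D B.
Hypothesis hR : resolvent_total D B.
Local Notation mu := (@lebesgue_measure R).

(** The weak derivative [B x] is a Bochner integrable function because it is the
pointwise limit of step functions: the Yosida approximations converge to [B] on
the domain, and they are Lipschitz along the Lipschitz curve [x], so they may be
sampled on a grid. *)
Lemma dissipative_strong_evolution z : D z -> exists x : R -> X, [/\ x 0 = z,
  forall s t : R, 0 <= s -> 0 <= t -> hnorm (x t - x s) <= `|t - s| * hnorm (B z),
  forall t : R, 0 <= t -> D (x t) /\ hnorm (B (x t)) <= hnorm (B z) &
  H1loc_derivative x (B \o x)].
Proof.
move=> Dz; have [J hJ] := resolvent_exists hR.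
have [x [x0 xlip xdom xder]] := dissipative_evolution hB hJ Dz (lexx (hnorm (B z))) hR.
set M := hnorm (B z) in xlip xdom; have M0 : 0 <= M by exact: hnorm_ge0.
exists x; split=> // tau tau0.
pose h n : R := n.+1%:R^-1; have h0 n : 0 < h n by rewrite invr_gt0.
(* The Yosida approximation with parameter [h n] has a Lipschitz constant of
   order [n + 1], which a mesh of [1 / (n + 1)^2] makes harmless. *)
pose m n := (n.+1 * n.+1)%N.
pose s n := grid_step n (m n) (fun j => B (J (h n) (x (j%:R / (m n)%:R)))).
have s_simple n : simple_function (s n) by exact: grid_step_simple.
have mgt0 n : 0 < (m n)%:R :> R by rewrite ltr0n.
have s_bound n t : 0 <= t -> hnorm (s n t) <= M.
  move=> t0; rewrite /s /grid_step; case: ifP => _; last by rewrite hnorm0.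
  have [Dx Bx] := xdom ((Num.truncn (t * (m n)%:R))%:R / (m n)%:R) (divr_ge0 (ler0n _ _) (ltW (mgt0 n))).
  exact: le_trans (yosida_le hB hJ (h0 n) Dx) Bx.
have s_cvg t : 0 <= t -> s n t @[n --> \oo] --> B (x t).
  move=> t0; have [Dt _] := xdom t t0.
  apply/hnorm_cvgP => e e0.
  have e2 : 0 < e / 2 by rewrite divr_gt0.
  have [N1 _ hN1] := (hnorm_cvgP _ _).1 (yosida_cvg_dom hB hJ Dt) _ e2.
  have e3 : 0 < e / 2 / (2 * (M + 1)) by rewrite !divr_gt0// mulr_gt0// ltr_wpDl.
  have [N2 hN2] := inv_succ_small e3.
  pose N3 := (Num.truncn t).+1.
  exists (maxn N1 (maxn N2 N3)) => // n; rewrite /= !geq_max => /andP[n1 /andP[n2 n3]].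
  have tn : t < n%:R by apply: lt_le_trans (truncnS_gt _) _; rewrite ler_nat.
  rewrite /s /grid_step t0 tn /=.
  set r := _ / (m n)%:R; have tm0 : 0 <= t * (m n)%:R by rewrite mulr_ge0// ltW.
  have /andP[c d] := truncn_itv tm0.
  have r0 : 0 <= r by rewrite divr_ge0// ltW.
  have rt : `|r - t| <= (m n)%:R^-1.
    rewrite distrC ger0_norm ?subr_ge0 ?ler_pdivrMr// lerBlDl.
    by rewrite -[X in _ <= _ + X]mul1r -mulrDl natr1 ler_pdivlMr// ltW.
  apply: le_lt_trans (hnorm_triangle (B (J (h n) (x t))) _ _) _; rewrite [ltRHS]splitr.
  apply: ltrD; last exact: hN1.
  have E y : B (J (h n) y) = (h n)^-1 *! (J (h n) y - y).
    by rewrite (resolvent_incr hJ)//; vec.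
  rewrite !E -scalerBr hnormZ gtr0_norm ?invr_gt0//.
  have h1 : hnorm (J (h n) (x r) - x r - (J (h n) (x t) - x t)) <= 2 * ((m n)%:R^-1 * M).
    rewrite (_ : _ - _ - _ = (J (h n) (x r) - J (h n) (x t)) - (x r - x t)); last by vec.
    apply: le_trans (hnorm_subr _ _) _.
    have := resolvent_lip hB hJ (x r) (x t) (h0 n); have := xlip t r t0 r0.
    have := ler_wpM2r M0 rt; lra.
  have hi : 0 <= (h n)^-1 by rewrite invr_ge0 ltW.
  apply: le_lt_trans (ler_wpM2l hi h1) _.
  have -> : (h n)^-1 * (2 * ((m n)%:R^-1 * M)) = h n * (2 * M).
    by rewrite /h /m natrM; field; rewrite nat1r pnatr_eq0.
  apply: le_lt_trans (_ : h n * (2 * (M + 1)) < _).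
    by rewrite ler_wpM2l ?(ltW (h0 n))//; lra.
  by rewrite -ltr_pdivlMr ?hN2// mulr_gt0// ltr_wpDl.
have mA (t : R) : measurable (`[0, t] : set R) by exact: measurable_itv.
have fA (t : R) := @itv_finite_measure R 0 t.
have inA (t r : R) : `[0, t]%classic r -> 0 <= r by rewrite /= in_itv /= => /andP[].
split.
  split.
    by exists s; split=> // r /inA; exact: s_cvg.
  have mn := @simple_limit_norm_measurable _ _ _ _ mu _ (mA tau) (fA tau) s (B \o x) s_simple (fun r hr => s_cvg r (inA _ _ hr)).
  apply: integrable_lty; first exact: mA.
  apply: (@integrable_bounded_real _ _ _ mu _ (mA tau) (fA tau) _ (M ^+ 2)).
    exact: measurable_funX.
  move=> r /inA r0; rewrite ger0_norm ?sqr_ge0// ler_sqr ?nnegrE ?hnorm_ge0//.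
  by have [] := xdom r r0.
move=> t /andP[t0 _].
apply: (@bochner_integral_intro _ _ _ (mA t) (fA t) _ _ s M s_simple).
- by move=> r /inA; exact: s_cvg.
- by move=> n r /inA; exact: s_bound.
- by move=> r /inA r0; have [] := xdom r r0.
move=> w; rewrite (@C1_on_FTC _ _ _ (fun r => ip (x r) w))//; first by rewrite !ipE.
move=> r /andP[r0 _] e e0; have [d d0 hd] := xder r w e r0 e0.
exists d => // q /andP[q0 _] qr; have [] := hd q q0 qr.
by rewrite !ipE.
Qed.

End Evolution.

Lemma ae_and (d : measure_display) (T : measurableType d) (R : realType)
  (mu : {measure set T -> \bar R}) (P Q : T -> Prop) :
  {ae mu, forall t, P t} -> {ae mu, forall t, Q t} -> {ae mu, forall t, P t /\ Q t}.
Proof. by move=> hP hQ; apply: filterS2 hP hQ => t. Qed.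

(** * Strong solutions of the feedback system *)
Section Orbits.
Context {R : realType} {X : hilbertType R}.
Variables (T : R -> {linear X -> X}) (D : set X) (A : X -> X).
Hypothesis hT : C0_semigroup T.
Hypothesis hA : is_generator T D A.
Hypothesis A_dissipative : forall x, D x -> ip (A x) x <= 0.
Hypothesis D_dense : dense D.

(** Orbits starting in the domain are continuously differentiable in norm, with
a derivative bounded by its initial norm. *)
Lemma orbit_weak_primitive (a b : R) z : a <= b -> D z ->
  weak_primitive a b (fun r => T (r - a) z) (fun r => T (r - a) (A z)).
Proof.
move=> ab Dz; have contr := semigroup_contraction hT hA A_dissipative D_dense.
apply: (@C1_weak_primitive _ _ _ _ (hnorm (A z))) => //.
  by move=> r /andP[ar _]; apply: contr; rewrite subr_ge0.
move=> w t /andP[at_ _] e e0.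
have w1 : 0 < 2 * (hnorm w + 1) by rewrite mulr_gt0// ltr_wpDl// hnorm_ge0.
pose rho := e / (2 * (hnorm w + 1)); have rho0 : 0 < rho by rewrite divr_gt0.
have rw : 2 * rho * hnorm w <= e.
  have : rho * (2 * (hnorm w + 1)) = e by rewrite /rho divfK// gt_eqF.
  lra.
have rw1 : rho * hnorm w <= e by have := mulr_ge0 (ltW rho0) (hnorm_ge0 w); lra.
have [d d0 hd] := semigroup_near0 hT (A z) rho0.
exists d => // s /andP[as_ _] st.
have sa : 0 <= s - a by rewrite subr_ge0.
have ta : 0 <= t - a by rewrite subr_ge0.
have E : s - a - (t - a) = s - t by ring.
split.
  rewrite -ipNl -ipDl; apply: le_trans (ip_abs _ _) _; apply: le_trans rw1.
  rewrite ler_wpM2r ?hnorm_ge0//.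
  wlog ts : s t at_ as_ st sa ta E / t <= s.
    move=> H; case: (orP (le_total t s)) => h; first exact: H.
    by rewrite hnormBC; apply: H => //; [rewrite distrC|ring].
  have -> : s - a = (t - a) + (s - t) by ring.
  have st0 : 0 <= s - t by rewrite subr_ge0.
  rewrite (C0_add hT)// -linearB; apply: le_trans (contr _ _ ta) _.
  by apply/ltW/hd => //; rewrite -(ger0_norm st0).
have inc := orbit_increment hT hA A_dissipative D_dense (w := rho) Dz ta sa.
rewrite E in inc.
have {}inc := inc (fun r hr => ltW (hd r (proj1 (andP hr)) (le_lt_trans (proj2 (andP hr)) st))).
rewrite -ipNl -ipDl -ipZl -ipNl -ipDl; apply: le_trans (ip_abs _ _) _.
have := ler_wpM2r (hnorm_ge0 w) inc; have := ler_wpM2l (normr_ge0 (s - t)) rw; lra.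
Qed.

End Orbits.

Section Feedback.
Context {R : realType} {U X : hilbertType R}.
Variables (D : set X) (G : X -> U) (L : X -> X) (K : X -> U).
Hypothesis hnode : boundary_node D G L K.
Hypothesis hpassive : impedance_passive D G L K.
Hypothesis hdense : dense (ker_on D G `&` ker_on D K).
Variable phi : U -> U.
Hypothesis hlip : locally_lipschitz phi.
Hypothesis hmono : monotone_map phi.
Hypothesis hphi0 : phi 0 = 0.
Local Notation mu := (@lebesgue_measure R).
Local Notation sol := (strong_solution D G L K phi).

Lemma dense_superset (S S' : set X) : (forall x, S x -> S' x) -> dense S -> dense S'.
Proof. by move=> SS dS O O0 oO; have [x [Ox Sx]] := dS O O0 oO; exists x; split=> //; exact: SS. Qed.

Lemma solution_weak_primitive (x dx : R -> X) (s t : R) : 0 <= s -> s <= t ->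
  H1loc_derivative x dx -> weak_primitive s t x dx.
Proof.
move=> s0 st h; have t1 : 0 < t + 1 by rewrite ltr_wpDl// (le_trans s0).
apply: weak_primitive_subset s0 _ (H1_weak_primitive t1 (h _ t1)).
by rewrite lerDl.
Qed.

(** The energy of the difference of two solutions dissipates by
[feedback_dissipative]. *)
Lemma strong_solution_contraction x y (s t : R) : sol x -> sol y -> 0 <= s -> s <= t ->
  hnorm (x t - y t) <= hnorm (x s - y s).
Proof.
move=> [dx [hx bx ex]] [dy [hy by_ ey]] s0 st.
have px := solution_weak_primitive s0 st hx; have py := solution_weak_primitive s0 st hy.
have pz := weak_primitive_sub px py.
(* The weighted energy estimate for a pair of functions, with weight [0]. *)
have hae : {ae mu, forall r, s <= r <= t ->
    ip (dx r - dy r) (x r - y r) + 0 * ip (dx r - dy r) (x r - y r) <= 0}.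
  have [N [mN N0 sN]] := ae_and ex ey; exists N; split=> // r nr; apply: sN => -[e1 e2]; apply: nr.
  move=> /andP[sr _]; have r0 := le_trans s0 sr.
  have [[Dx Gx] [Dy Gy]] := (bx r r0, by_ r r0).
  rewrite mul0r addr0 e1// e2//.
  exact: (@feedback_dissipative _ _ _ D G L K hnode hpassive phi hmono).
have := energy_nonincreasing st (lexx 0) pz pz hae.
by rewrite !mul0r !addr0 ler_sqr ?nnegrE ?hnorm_ge0.
Qed.

Lemma strong_solution_exists z : feedback_dom D G K phi z -> exists x : R -> X, [/\ sol x, x 0 = z,
  forall s t : R, 0 <= s -> 0 <= t -> hnorm (x t - x s) <= `|t - s| * hnorm (L z) &
  forall t : R, 0 <= t -> hnorm (L (x t)) <= hnorm (L z)].
Proof.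
move=> Dz.
have kerG : dense (ker_on D G) by apply: dense_superset hdense => x [].
have diss : dissipative (feedback_dom D G K phi) L.
  by move=> x y; exact: (feedback_dissipative hnode hpassive hmono).
have ran : resolvent_total (feedback_dom D G K phi) L.
  by move=> h f h0; exact: (feedback_range hnode hpassive kerG hlip hmono).
have [x [x0 xlip xdom xH]] := dissipative_strong_evolution diss ran Dz.
exists x; split=> // [|t t0]; last by have [] := xdom t t0.
exists (L \o x); split=> // [t t0|]; first by have [] := xdom t t0.
by apply: aeW.
Qed.

(** Comparison with the solution that starts at the origin and stays there. *)
Lemma strong_solution_bounded x (t : R) : sol x -> 0 <= t -> hnorm (x t) <= hnorm (x 0).
Proof.
move=> sx t0; have D0 := (bn_dom hnode).1.
have lin0 (W : hilbertType R) (F : X -> W) : linear_on D F -> F 0 = 0.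
  by move=> hF; rewrite -[X in F X](subrr 0) (linear_on_sub hF D0 D0) subrr.
have dom0 : feedback_dom D G K phi 0.
  by split=> //; rewrite (lin0 _ _ (bn_G hnode).1) (lin0 _ _ (bn_K hnode).1) oppr0 hphi0.
have [y [sy y0 ylip _]] := strong_solution_exists dom0.
have yt : y t = 0.
  apply/hnorm_eq0/le_anti; rewrite hnorm_ge0 andbT.
  by have := ylip 0 t (lexx _) t0; rewrite y0 subr0 (lin0 _ _ (bn_L hnode)) hnorm0 mulr0.
by have := strong_solution_contraction sx sy (lexx _) t0; rewrite yt y0 !subr0.
Qed.

(** Near the origin the sector condition controls [phi v - v] because [phi] is
Lipschitz there; away from it boundedness is enough. *)
Lemma sector_bound (alpha beta delta b : R) : 0 < alpha -> 0 < beta -> 0 < delta ->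
  (forall u : U, hnorm u < delta -> alpha * hnorm u ^+ 2 <= ip (phi u) u) ->
  (forall u : U, delta <= hnorm u -> beta <= ip (phi u) u) -> 0 <= b ->
  exists2 C : R, 0 < C & forall v : U, hnorm v <= b -> hnorm (phi v) <= b ->
    hnorm (phi v - v) ^+ 2 <= C * ip (phi v) v.
Proof.
move=> a0 b0 d0 hs hl bb.
have [r r0 [l l0 hll]] := locally_lipschitz_ball hlip 0.
pose q := Num.min r delta; have q0 : 0 < q by rewrite lt_min r0.
pose g := Num.min beta (alpha * q ^+ 2).
have g0 : 0 < g by rewrite lt_min b0 mulr_gt0// exprn_gt0.
have C1 : 0 < (l + 1) ^+ 2 / alpha by rewrite divr_gt0// exprn_gt0// addr_gt0.
have C2 : 0 <= (2 * b) ^+ 2 / g by rewrite divr_ge0 ?sqr_ge0// ltW.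
exists ((l + 1) ^+ 2 / alpha + (2 * b) ^+ 2 / g); first by rewrite ltr_wpDr.
move=> v vb pb.
have p0 : 0 <= ip (phi v) v by have := hmono 0 v; rewrite hphi0 !subr0.
have [vq|vq] := ltP (hnorm v) q.
  move: vq; rewrite lt_min => /andP[vr vd].
  have h1 : hnorm (phi v - v) <= (l + 1) * hnorm v.
    have := hll v 0; rewrite !subr0 hnorm0 hphi0 subr0 => /(_ vr r0) h.
    by apply: le_trans (hnorm_subr _ _) _; lra.
  have h2 : hnorm (phi v - v) ^+ 2 <= (l + 1) ^+ 2 / alpha * (alpha * hnorm v ^+ 2).
    rewrite mulrA divfK ?gt_eqF// -exprMn ler_sqr ?nnegrE ?hnorm_ge0//.
    by rewrite mulr_ge0 ?hnorm_ge0// addr_ge0// ltW.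
  have := ler_wpM2l (ltW C1) (hs v vd); have := mulr_ge0 C2 p0; lra.
have gp : g <= ip (phi v) v.
  have [vd|vd] := ltP (hnorm v) delta; last by rewrite ge_min hl.
  rewrite ge_min; apply/orP; right; apply: le_trans (hs v vd).
  by rewrite ler_wpM2l ?(ltW a0)// ler_sqr ?nnegrE ?hnorm_ge0// ltW.
have h2 : hnorm (phi v - v) ^+ 2 <= (2 * b) ^+ 2.
  rewrite ler_sqr ?nnegrE ?hnorm_ge0 ?mulr_ge0//.
  by apply: le_trans (hnorm_subr _ _) _; lra.
have := ler_wpM2l C2 gp; rewrite divfK ?gt_eqF//.
have := mulr_ge0 (ltW C1) p0; lra.
Qed.

Variable T : R -> {linear X -> X}.
Hypothesis hT : C0_semigroup T.
Hypothesis hTgen : is_generator T (ker_on D (fun x => G x + K x)) L.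
Hypothesis hTstable : strongly_stable T.

Lemma kerGK_dissipative x : ker_on D (fun x => G x + K x) x -> ip (L x) x <= 0.
Proof.
move=> [Dx /eqP]; rewrite addr_eq0 => /eqP Gx; apply: le_trans (hpassive Dx) _.
by rewrite Gx ipNl ipxx oppr_le0 sqr_ge0.
Qed.

Lemma kerGK_dense : dense (ker_on D (fun x => G x + K x)).
Proof. by apply: dense_superset hdense => x [[Dx Gx] [_ Kx]]; split=> //; rewrite Gx Kx addr0. Qed.

(** Let [y] be the orbit of [z]. Since [G y = - K y], the vectors [G x - G y] and
[K x - K y] add up to [phi v - v], so passivity bounds their inner product, and
with it half the growth rate of [|x - y|^2], by [|phi v - v|^2 / 4]. Half the
decay rate of [|x|^2] is at least [Re <phi v, v>], which compensates after
multiplication by [C / 4]. *)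
Lemma lyapunov_comparison (C : R) x (s t : R) z : 0 <= C -> sol x ->
  (forall r, 0 <= r -> let v := - K (x r) in hnorm (phi v - v) ^+ 2 <= C * ip (phi v) v) ->
  ker_on D (fun x => G x + K x) z -> 0 <= s -> s <= t ->
  hnorm (x t - T (t - s) z) ^+ 2 + C / 4 * hnorm (x t) ^+ 2 <=
  hnorm (x s - z) ^+ 2 + C / 4 * hnorm (x s) ^+ 2.
Proof.
move=> C0 [dx [hx bx ex]] hC zD s0 st.
have C4 : 0 <= C / 4 by rewrite divr_ge0.
have px := solution_weak_primitive s0 st hx.
have po := orbit_weak_primitive hT hTgen kerGK_dissipative kerGK_dense st zD.
have := energy_nonincreasing st C4 (weak_primitive_sub px po) px.
rewrite subrr (C0_id hT); apply.
case: ex => N [mN N0 sN]; exists N; split=> // r nr; apply: sN => er; apply: nr.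
move=> /andP[sr _]; have r0 := le_trans s0 sr; have [Dx Gx] := bx r r0.
have rs0 : 0 <= r - s by rewrite subr_ge0.
have [[Dy GKy] Ly] := generator_semigroup hT hTgen rs0 zD.
rewrite er// -Ly; set y := T (r - s) z in Dy GKy *; set v := - K (x r) in Gx.
have h1 := passive_sub hnode hpassive Dx Dy.
have h2 := hpassive Dx; rewrite Gx in h2.
have h3 := hC r r0; rewrite /= -/v in h3.
have Kx : K (x r) = - v by rewrite /v opprK.
rewrite Kx ipNr in h2.
have h4 : 4 * ip (G (x r) - G y) (K (x r) - K y) <= hnorm (phi v - v) ^+ 2.
  have -> : phi v - v = (G (x r) - G y) + (K (x r) - K y).
    have Gy : G y = - K y by apply/eqP; rewrite -addr_eq0 GKy.
    by rewrite Gx Kx Gy; vec.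
  rewrite hnormD_sq; have := sqr_ge0 (hnorm ((G (x r) - G y) - (K (x r) - K y))).
  rewrite (hnormB_sq (G (x r) - G y)); lra.
have := ler_wpM2l C4 h2; lra.
Qed.

(** At a time [s] when the energy of [x] is close to its infimum, start an orbit
of the stable semigroup near [x s]. Afterwards the energy can hardly decrease,
so [lyapunov_comparison] keeps [x] close to that orbit. *)
Lemma strong_solution_cvg0 (C : R) x : 0 <= C -> sol x ->
  (forall r, 0 <= r -> let v := - K (x r) in hnorm (phi v - v) ^+ 2 <= C * ip (phi v) v) ->
  x t @[t --> +oo] --> (0 : X).
Proof.
move=> C0 sx hC.
pose E := [set hnorm (x t) ^+ 2 | t in [set t : R | 0 <= t]].
have hE : has_inf E.
  split; first by exists (hnorm (x 0) ^+ 2), 0 => //=.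
  by exists 0 => _ [t _ <-]; exact: sqr_ge0.
apply/hnorm_cvgP => e e0.
have e2 : 0 < e / 4 by rewrite divr_gt0.
have C1 : 0 < C / 4 + 1 by rewrite ltr_wpDl// divr_ge0.
have n0 : 0 < (e / 4) ^+ 2 / (C / 4 + 1) by rewrite divr_gt0// exprn_gt0.
have [_ [s s0 <-] hs] := inf_adherent n0 hE; rewrite /= in s0.
have [z zD zx] := dense_hnorm kerGK_dense (x s) e2.
have e3 : 0 < e / 2 by rewrite divr_gt0.
have [S [_ hS]] := (hnorm_cvgP _ _).1 (hTstable z) _ e3.
exists (Num.max S 0 + s); split; first exact: num_real.
move=> t ht; have st : s <= t.
  by apply/ltW/(le_lt_trans _ ht); rewrite lerDr le_max lexx orbT.
have t0 := le_trans s0 st.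
have := lyapunov_comparison C0 sx hC zD s0 st.
have Et : inf E <= hnorm (x t) ^+ 2 by apply: inf_lbound; [case: hE|exists t].
have {}hs : C / 4 * (hnorm (x s) ^+ 2 - hnorm (x t) ^+ 2) <= (e / 4) ^+ 2.
  have h : hnorm (x s) ^+ 2 - hnorm (x t) ^+ 2 <= (e / 4) ^+ 2 / (C / 4 + 1) by lra.
  apply: le_trans (ler_wpM2l (_ : 0 <= C / 4) h) _; first by rewrite divr_ge0.
  by rewrite mulrA ler_pdivrMr// mulrC ler_wpM2l ?sqr_ge0// lerDl.
have zx2 : hnorm (x s - z) ^+ 2 <= (e / 4) ^+ 2.
  by rewrite ler_sqr ?nnegrE ?hnorm_ge0 ?(ltW e2)// hnormBC ltW.
move=> hl.
have h1 : hnorm (x t - T (t - s) z) <= e / 2.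
  rewrite -ler_sqr ?nnegrE ?hnorm_ge0 ?(ltW e3)//.
  have -> : (e / 2) ^+ 2 = 4 * (e / 4) ^+ 2 by field.
  have := sqr_ge0 (e / 4); lra.
have h2 : hnorm (T (t - s) z) < e / 2.
  rewrite -[T _ z]subr0; apply: hS; rewrite ltrBrDr.
  by apply: le_lt_trans ht; rewrite lerD2r le_max lexx.
rewrite subr0 -[x t](subrK (T (t - s) z)); apply: le_lt_trans (hnorm_addr _ _) _.
by rewrite [ltRHS]splitr; exact: ler_ltD.
Qed.

End Feedback.

(** * Generalised solutions *)
Section UniformDistance.
Context {R : realType} {X : hilbertType R}.
Implicit Types (xk : nat -> R -> X) (x : R -> X).

(** Uniform convergence on [0, tau], from the extended-real suprema of the
definition of generalised solutions to real tolerances. *)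
Lemma sup_dist_cvg0P (tau : R) xk x : 0 <= tau ->
  ereal_sup [set (hnorm (xk k t - x t))%:E | t in `[0, tau]] @[k --> \oo] --> 0%E <->
  (forall e : R, 0 < e -> exists N, forall k, (N <= k)%N -> forall t, 0 <= t <= tau ->
     hnorm (xk k t - x t) <= e).
Proof.
move=> tau0; pose S k := ereal_sup [set (hnorm (xk k t - x t))%:E | t in `[0, tau]%classic].
have le_S k t : 0 <= t <= tau -> ((hnorm (xk k t - x t))%:E <= S k)%E.
  by move=> ht; apply: ereal_sup_ubound; exists t => //=; rewrite in_itv.
have S_le k (e : R) : (forall t, 0 <= t <= tau -> hnorm (xk k t - x t) <= e) -> (S k <= e%:E)%E.
  by move=> h; apply: ge_ereal_sup => _ [t /= + <-]; rewrite in_itv /= lee_fin => /h.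
have S0 k : (0 <= S k)%E.
  by apply: le_trans (le_S k 0 _); rewrite ?lee_fin ?hnorm_ge0// lexx.
have Sfin k (e : R) : (S k <= e%:E)%E -> S k \is a fin_num.
  by move=> h; rewrite ge0_fin_numE//; apply: le_lt_trans h (ltry _).
split.
  move=> /fine_cvgP[[N1 _ hN1] /cvgrPdist_lt h] e e0.
  have [N2 _ hN2] := h e e0; exists (maxn N1 N2) => k; rewrite geq_max => /andP[k1 k2] t ht.
  have := hN2 k k2; rewrite /= sub0r normrN ger0_norm ?fine_ge0//; last exact: S0.
  move=> h2; rewrite -lee_fin; apply: le_trans (le_S k t ht) _.
  by rewrite -[S k](fineK (hN1 k k1)) lee_fin ltW.
move=> h; apply/fine_cvgP; split.
  have [N hN] := h 1 ltr01; exists N => // k /= Nk.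
  by apply: (Sfin k 1); apply: S_le; exact: hN.
apply/cvgrPdist_le => e e0; have [N hN] := h e e0; exists N => // k /= Nk.
rewrite sub0r normrN ger0_norm ?fine_ge0//; last exact: S0.
have h1 := S_le k e (hN k Nk).
by rewrite -lee_fin fineK//; exact: Sfin h1.
Qed.

End UniformDistance.

Section Generalised.
Context {R : realType} {U X : hilbertType R}.
Variables (D : set X) (G : X -> U) (L : X -> X) (K : X -> U).
Hypothesis hnode : boundary_node D G L K.
Hypothesis hpassive : impedance_passive D G L K.
Hypothesis hdense : dense (ker_on D G `&` ker_on D K).
Variable phi : U -> U.
Hypothesis hlip : locally_lipschitz phi.
Hypothesis hmono : monotone_map phi.
Hypothesis hphi0 : phi 0 = 0.
Local Notation sol := (strong_solution D G L K phi).

Lemma kernel_feedback_dom z : (ker_on D G `&` ker_on D K) z -> feedback_dom D G K phi z.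
Proof. by move=> [[Dz Gz] [_ Kz]]; split=> //; rewrite Gz Kz oppr0 hphi0. Qed.

(** Strong solutions from points of the dense set approximating [x0] are
uniformly Cauchy on the whole half-line by contraction. *)
Lemma generalised_solution_exists x0 : exists x, generalised_solution D G L K phi x /\ x 0 = x0.
Proof.
have exz n : exists2 z, (ker_on D G `&` ker_on D K) z & hnorm (z - x0) < n.+1%:R^-1.
  by apply: dense_hnorm => //; rewrite invr_gt0.
have ex n : exists x : R -> X, [/\ sol x, hnorm (x 0 - x0) < n.+1%:R^-1 &
    exists M : R, forall s t : R, 0 <= s -> 0 <= t -> hnorm (x t - x s) <= `|t - s| * M].
  have [z zK zx] := exz n.
  have [x [sx xz xl _]] := strong_solution_exists hnode hpassive hdense hlip hmono (kernel_feedback_dom zK).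
  by exists x; split=> //; [rewrite xz|exists (hnorm (L z))].
have [xk hxk] := choice ex.
have contr n m (t : R) : 0 <= t -> hnorm (xk n t - xk m t) <= hnorm (xk n 0 - xk m 0).
  move=> t0; have [[sn _ _] [sm _ _]] := (hxk n, hxk m).
  exact: (strong_solution_contraction hnode hpassive hmono sn sm (lexx _) t0).
have cauchy (e : R) : 0 < e -> exists N, forall n m, (N <= n)%N -> (N <= m)%N ->
    forall t : R, 0 <= t -> hnorm (xk n t - xk m t) < e.
  move=> e0; have e2 : 0 < e / 2 by rewrite divr_gt0.
  have [N hN] := inv_succ_small e2; exists N => n m hn hm t t0.
  apply: le_lt_trans (contr n m t t0) _; apply: le_lt_trans (hnorm_triangle x0 _ _) _.
  have [[_ h1 _] [_ h2 _]] := (hxk n, hxk m); rewrite (hnormBC x0) [ltRHS]splitr.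
  by apply: ltrD; [exact: lt_trans h1 (hN _ hn)|exact: lt_trans h2 (hN _ hm)].
have exl (t : R) : exists l : X, 0 <= t -> xk n t @[n --> \oo] --> l.
  have [t0|/negP t0] := boolP (0 <= t); last by exists 0.
  have [|l hl] := @hilbert_complete _ _ (fun n => xk n t); last by exists l.
  by move=> e e0; have [N hN] := cauchy e e0; exists N => n m hn hm; exact: hN.
have [x hx] := choice exl.
have unif (e : R) : 0 < e -> exists N, forall n, (N <= n)%N -> forall t : R, 0 <= t ->
    hnorm (xk n t - x t) <= e.
  move=> e0; have [N hN] := cauchy e e0; exists N => n hn t t0.
  apply/ler_addgt0Pr => g g0; have [N' _ hN'] := (hnorm_cvgP _ _).1 (hx t t0) _ g0.
  apply: le_trans (hnorm_triangle (xk (maxn N N') t) _ _) _.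
  have := hN n (maxn N N') hn (leq_maxl _ _) t t0; have := hN' (maxn N N') (leq_maxr _ _) => /=.
  lra.
exists x; split; last first.
  apply/subr0_eq/hnorm_eq0/le_anti; rewrite hnorm_ge0 andbT.
  apply/ler_addgt0Pr => e e0; rewrite add0r; have e2 : 0 < e / 2 by rewrite divr_gt0.
  have [N hN] := unif _ e2; have [N' hN'] := inv_succ_small e2.
  pose n := maxn N N'; have [_ h1 _] := hxk n.
  apply: le_trans (hnorm_triangle (xk n 0) _ _) _.
  have := hN n (leq_maxl _ _) 0 (lexx _); have := lt_trans h1 (hN' n (leq_maxr _ _)).
  rewrite (hnormBC (x 0)); lra.
split; last first.
  exists xk; split; first by move=> k; have [] := hxk k.
  move=> tau tau0; apply/(sup_dist_cvg0P _ _ (ltW tau0)) => e e0.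
  by have [N hN] := unif e e0; exists N => k hk t /andP[t0 _]; exact: hN.
apply/subspace_continuousP => t /=; rewrite in_itv /= andbT => t0.
apply/hnorm_cvgP => e e0; have e4 : 0 < e / 4 by rewrite divr_gt0.
have [N /(_ N (leqnn _)) hN] := unif _ e4; have [_ _ [M hM]] := hxk N.
have M1 : 0 < `|M| + 1 by rewrite ltr_wpDl.
rewrite /prop_near1 /within /=; apply/nbhs_ballP.
exists (e / 4 / (`|M| + 1)); first by rewrite /= divr_gt0.
move=> s /=; rewrite /ball /= distrC ltr_pdivlMr// => st; rewrite in_itv /= andbT => s0.
apply: le_lt_trans (hnorm_triangle (xk N s) _ _) _.
apply: le_lt_trans (lerD (lexx _) (hnorm_triangle (xk N t) _ _)) _.
have := hN s s0; have := hN t t0; have := hM t s t0 s0; rewrite (hnormBC (x s)).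
have : `|s - t| * M <= `|s - t| * (`|M| + 1).
  by rewrite ler_wpM2l// (le_trans (ler_norm _))// lerDl.
lra.
Qed.

Variable T : R -> {linear X -> X}.
Hypothesis hT : C0_semigroup T.
Hypothesis hTgen : is_generator T (ker_on D (fun x => G x + K x)) L.
Hypothesis hTstable : strongly_stable T.
Hypothesis hgrowth : exists alpha beta delta : R,
     [/\ 0 < alpha, 0 < beta, 0 < delta,
         forall u : U, hnorm u < delta ->
           alpha * hnorm u ^+ 2 <= Re_dotp (phi u) u &
         forall u : U, delta <= hnorm u -> beta <= Re_dotp (phi u) u].

(** The bounds on [x] and [L x] along the solution bound [G x] and [K x], so that
one constant from [sector_bound] serves for all times. *)
Lemma strong_solution_stable z : feedback_dom D G K phi z ->
  exists x : R -> X, [/\ sol x, x 0 = z & x t @[t --> +oo] --> (0 : X)].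
Proof.
move=> Dz; have [x [sx x0 _ xL]] := strong_solution_exists hnode hpassive hdense hlip hmono Dz.
exists x; split=> //.
have [M M0 hM] := node_bound hnode.
pose b := M * (hnorm z + hnorm (L z)).
have b0 : 0 <= b by rewrite mulr_ge0 ?addr_ge0 ?hnorm_ge0// ltW.
have [alpha [beta [delta [a0 be0 d0 hs hl]]]] := hgrowth.
have [C C0 hC] := sector_bound hlip hmono hphi0 a0 be0 d0 hs hl b0.
apply: (strong_solution_cvg0 hnode hpassive hdense hT hTgen hTstable (ltW C0) sx) => r r0 /=.
have [dx [_ bx _]] := sx; have [Dx Gx] := bx r r0.
have gb : M * graph_norm L (x r) <= b.
  rewrite ler_wpM2l ?(ltW M0)// lerD ?xL// -x0.
  exact: (strong_solution_bounded hnode hpassive hdense hlip hmono hphi0 sx r0).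
have [h1 h2] := hM _ Dx.
by apply: hC; rewrite ?hnorm_oppr -?Gx; exact: le_trans gb.
Qed.

(** By contraction the approximating strong solutions stay close to any strong
solution with a nearby initial state, and one such solution tends to [0]. *)
Lemma generalised_solution_cvg0 x : generalised_solution D G L K phi x ->
  x t @[t --> +oo] --> (0 : X).
Proof.
move=> [_ [xk [sk hk]]]; apply/hnorm_cvgP => e e0.
have e4 : 0 < e / 4 by rewrite divr_gt0.
have [z zK zx] := dense_hnorm hdense (x 0) e4.
have [y [sy y0 ycv]] := strong_solution_stable (kernel_feedback_dom zK).
have [S [_ hS]] := (hnorm_cvgP _ _).1 ycv _ e4.
exists (Num.max S 0); split; first exact: num_real.
move=> t; rewrite gt_max => /andP[St t0].
have [N /(_ N (leqnn _)) hN] := (sup_dist_cvg0P xk x (ltW t0)).1 (hk t t0) _ e4.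
have h1 := hN t (introT andP (conj (ltW t0) (lexx _))).
have h2 := hN 0 (introT andP (conj (lexx _) (ltW t0))).
have h3 := strong_solution_contraction hnode hpassive hmono (sk N) sy (lexx _) (ltW t0).
have h4 := hS t St; rewrite subr0 in h4; rewrite subr0.
have h5 := hnorm_triangle (xk N t) (x t) 0; rewrite !subr0 hnormBC in h5.
have h6 := hnorm_triangle (y t) (xk N t) 0; rewrite !subr0 in h6.
have h7 := hnorm_triangle (x 0) (xk N 0) (y 0); rewrite y0 (hnormBC (x 0)) in h7.
rewrite y0 in h3; lra.
Qed.

End Generalised.

Theorem theorem5p6 (R : realType) (U X : hilbertType R)
  (hU : exists u : U, u <> 0)
  (D : set X) (G : X -> U) (L : X -> X) (K : X -> U)
  (hnode : boundary_node D G L K)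
  (hpassive : impedance_passive D G L K)
  (hdense : dense (ker_on D G `&` ker_on D K))
  (hstable : generates_strongly_stable_semigroup
               (ker_on D (fun x => G x + K x)) L)
  (phi : U -> U)
  (hlip : locally_lipschitz phi)
  (hmono : monotone_map phi)
  (hphi0 : phi 0 = 0)
  (hgrowth : exists alpha beta delta : R,
     [/\ 0 < alpha, 0 < beta, 0 < delta,
         forall u : U, hnorm u < delta ->
           alpha * hnorm u ^+ 2 <= Re_dotp (phi u) u &
         forall u : U, delta <= hnorm u -> beta <= Re_dotp (phi u) u]) :
  origin_globally_asymptotically_stable D G L K phi.
Proof.
have [T [hT hTgen hTstable]] := hstable.
move=> x0; split; first exact: (generalised_solution_exists hnode hpassive hdense hlip hmono hphi0).
by move=> x hx _; exact: (generalised_solution_cvg0 hnode hpassive hdense hlip hmono hphi0 hT hTgen hTstable hgrowth hx).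
Qed.
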